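(* Let $r \geq 2$ be an integer and let $p = p(n) \geq 2^9 r^{5} n^{-1/(2r)}$. Then with high probability the random graph $\Gamma \sim G(n,p)$ has the following property: for every colouring of the edges of $\Gamma$ with $r$ colours, the vertex set of $\Gamma$ can be partitioned into at most $1000 r^4 \log r$ vertex-disjoint monochromatic cycles.
   Context: $G(n,p)$ is the binomial random graph on $n$ vertices in which each pair of vertices is an edge independently with probability $p$. ''With high probability'' means with probability tending to $1$ as $n \to \infty$. A monochromatic cycle is a cycle all of whose edges have the same colour; a single vertex and a single edge are allowed as (degenerate) cycles. $\log$ denotes the natural logarithm. *)

(* Defs.v *)
From HB Require Import structures.
From mathcomp Require Import all_boot all_order all_algebra.
From mathcomp Require Import all_classical all_reals all_analysis.
Set Implicit Arguments. Unset Strict Implicit. Unset Printing Implicit Defensive.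
Import Order.TTheory GRing.Theory Num.Theory.
Local Open Scope ring_scope.

Definition pairs (n : nat) : {set {set 'I_n}} := [set e : {set 'I_n} | #|e| == 2%N].

Definition is_graph (n : nat) (G : {set {set 'I_n}}) : bool := G \subset pairs n.

Definition gnp_prob (R : realType) (n : nat) (p : R) (P : {set {set 'I_n}} -> Prop) : R :=
  \sum_(G : {set {set 'I_n}} | is_graph G && `[< P G >])
     p ^+ #|G| * (1 - p) ^+ (#|pairs n| - #|G|).

Definition col_adj (n r : nat) (G : {set {set 'I_n}}) (c : {set 'I_n} -> 'I_r) (k : 'I_r)
  : rel 'I_n := fun x y => ([set x; y] \in G) && (c [set x; y] == k).

(* A monochromatic cycle, given by the cyclic sequence of its (distinct) vertices.
   A single vertex is allowed (size 1); a single edge is the case size 2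
   (path.cycle on [:: a; b] requires the edge ab twice); size >= 3 is a genuine cycle. *)
Definition mono_cycle (n r : nat) (G : {set {set 'I_n}}) (c : {set 'I_n} -> 'I_r)
  (s : seq 'I_n) : Prop :=
  uniq s /\ (size s = 1%N \/ (1 < size s)%N /\ exists k : 'I_r, cycle (col_adj G c k) s).

Definition mono_cycle_partition (R : realType) (n r : nat) (G : {set {set 'I_n}})
  (c : {set 'I_n} -> 'I_r) (m : R) : Prop :=
  exists ss : seq (seq 'I_n),
    [/\ (size ss)%:R <= m,
        (forall s, s \in ss -> mono_cycle G c s) &
        perm_eq (flatten ss) (enum 'I_n)].

Definition cycle_partition_property (R : realType) (n r : nat) (m : R)
  (G : {set {set 'I_n}}) : Prop :=
  forall c : {set 'I_n} -> 'I_r, mono_cycle_partition G c m.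

(* Main.v *)
(** Let [s] be of order [log n / p]. A random graph satisfies, with high probability,
    a few first-moment statements about edge counts between sets of size at least [s]
    and about common neighbourhoods of pairs and of [r + 1] vertices; for any graph
    satisfying them and any colouring the cycles are found as follows.

    First set aside an absorber: a monochromatic cycle containing a reservoir [U] of
    linear size such that any part of [U] can be removed leaving a monochromatic cycle.
    It is a chain of gadgets, grown greedily; if a colour cannot be continued, it is
    missing from a set of linear size, and one recurses there with one colour less.
    Removing long monochromatic cycles greedily, each found by depth-first search,
    leaves a set much smaller than [U]. Cycles alternating between this set and half of
    [U] in majority colours cover all but [O(s)] of it.

    Any [r + 1] of the remaining vertices have many common neighbours in the other half
    of [U], so by pigeonhole two of the vertices have many common neighbours in one and
    the same colour. Linking such pairs gives an [r]-coloured auxiliary graph with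
    independence number at most [r]; as in the theorem of Erdos, Gyarfas and Pyber for
    complete graphs, it is covered by boundedly many monochromatic cycles, and Hall's
    theorem turns each link into a path of length two through its own vertex of [U].
    The [O(p^-(r+1))] vertices that have too few common neighbours in [U] are covered
    in the same way through other parts of the vertex set, in four rounds. Hall's
    condition there needs [p^2 p^-(r+1)] to be small compared with [n p^(r+1)], which is
    the origin of the threshold [p = C n^(-1/(2r))].

    Finally the absorber closes up without the vertices of [U] that were used. *)
Require Import Defs.
From HB Require Import structures.
From mathcomp Require Import all_boot all_order all_algebra.
From mathcomp Require Import zify ring lra.
Set Implicit Arguments.
Unset Strict Implicit.
Unset Printing Implicit Defensive.
Import Order.TTheory GRing.Theory Num.Theory.

(** * Depth-first search *)

(** Where [r^4 log r] comes from. A link graph has [r] colours and independence number at most [r],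
    and is treated in [r] stages, each lowering the independence number by one. At independence
    number [i] a long cycle takes a fraction of order [1 / (i r)] of what is left, and the set has
    to shrink by a factor [2^b] with [b] of order [r log r]. All stages together cost of order
    [r^2 * r * r log r] cycles, and five link graphs occur. The greedy step in the random graph
    itself costs only of order [r^3 log r].

    Why four rounds. About [p^-(r+1)] vertices are poor. A set with fewer than about [n p^(r+1)]
    vertices is harmless, since it cannot contain most of the connectors of [r + 1] vertices; each
    further round enlarges the admissible size by a factor of order [n p^(r+1) / log n]. So [K]
    rounds need [(n p^(r+1))^K p^(r+1)] to beat a power of [log n]. At [p = n^(-1/(2r))] this means
    [2 r K > (K + 1) (r + 1)], and for [r = 2] it says [K > 3]. *)

Section DepthFirstBlock.
Variables (T : finType) (e : rel T).
Hypothesis e_sym : symmetric e.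

(** For the empty path every vertex is attached, as if a virtual root were joined to everything;
    this lets the search restart in another component. *)
Definition attached (P : seq T) (y : T) := if P is v :: _ then e v y else true.

Definition reachable (P : seq T) (Y : {set T}) : Prop :=
  if P is v :: _ then
    forall y, y \in Y ->
      exists q, [/\ path e v q, last v q = y, uniq q & {subset q <= Y}]
  else True.

Definition closed_within (A Y : {set T}) : Prop :=
  forall y z, y \in Y -> z \in A -> e y z -> z \in Y.

Definition cycle_or_point (C : seq T) : Prop :=
  uniq C /\ (size C <= 1 \/ cycle e C).

Definition blocked_by (A Y : {set T}) (C : seq T) : Prop :=
  forall y z, y \in Y -> z \in A -> e y z -> z \in Y \/ z \in C.

(** Size is measured inside [W]: everything when long cycles are sought, only the side to be covered
    when the cycles alternate with a reservoir. *)
Definition block_found s (A W : {set T}) (P : seq T) : Prop :=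
  exists (Y : {set T}) (C : seq T), [/\ Y \subset A, {subset C <= A :|: [set x in P]},
    s <= #|Y :&: W| < s.*2, cycle_or_point C
    & blocked_by (A :|: [set x in P]) Y C].

Definition block_pending s (A W : {set T}) (P : seq T) : Prop :=
  exists Y : {set T}, [/\ Y \subset A, closed_within A Y, #|Y :&: W| < s,
    forall w, w \in A -> attached P w -> w \in Y & reachable P Y].

(* The cycle runs from the highest path vertex adjacent to [Y] down to the top
   of the path [v :: p] (listed top first) and back through [Y], so it meets
   every path vertex adjacent to [Y]. *)
Lemma close_block (A Y : {set T}) (P : seq T) :
  uniq P -> sorted e P -> (forall x, x \in A -> x \notin P) ->
  Y \subset A -> closed_within A Y -> reachable P Y ->
  exists C, [/\ {subset C <= A :|: [set x in P]}, cycle_or_point C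
    & blocked_by (A :|: [set x in P]) Y C].
Proof.
move=> uP sP dAP YA clY.
case: P uP sP dAP => [|v p] uP sP dAP rY.
  exists [::]; split=> //; first by split=> //; left.
  move=> y z yY; rewrite inE => /orP[zA|]; last by rewrite inE.
  by move=> eyz; left; apply: clY eyz.
pose adjY z := [exists y in Y, e y z].
have [/hasP[z0 z0p z0Y]|nadj] := boolP (has adjY p); last first.
  exists [:: v]; split.
  - by move=> x; rewrite !inE => /eqP->; rewrite eqxx orbT.
  - by split=> //; left.
  move=> y z yY; rewrite !inE => /orP[zA|/orP[/eqP->|zp]] eyz.
  - by left; apply: clY eyz.
  - by right; rewrite eqxx.
  - by case/hasP: nadj; exists z => //; apply/existsP; exists y; rewrite yY.
have hasR : has adjY (rev p) by rewrite has_rev; apply/hasP; exists z0.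
(* Searching [rev p] starts at the bottom of the path, so [j] is the length of the prefix of [p]
   ending in the vertex adjacent to [Y] that is farthest from the top. *)
pose j := size p - find adjY (rev p).
have fl : find adjY (rev p) < size p by rewrite -(size_rev p) -has_find.
have jgt : 0 < j by rewrite subn_gt0.
have jle : j <= size p by rewrite leq_subr.
pose x := nth v p j.-1.
have xE : x = nth v (rev p) (find adjY (rev p)).
  rewrite nth_rev // /x /j; congr nth; lia.
have xY : adjY x by rewrite xE; apply: nth_find.
case/existsP: xY => y /andP[yY eyx].
have [q [pq lq uq qY]] := rY _ yY.
have pT : path e v (take j p) by move: sP; rewrite /= -{1}(cat_take_drop j p) cat_path => /andP[].
have lT : last v (take j p) = x.
  rewrite (last_nth v) size_take_min (minn_idPl jle) -(prednK jgt) /= nth_take //.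
have yA : y \in A by apply: (subsetP YA).
have qn : q != [::].
  apply/eqP=> q0; move: lq (dAP _ yA); rewrite q0 /= => <-; by rewrite inE eqxx.
have qsub z : z \in q -> z \notin v :: p by move=> /qY zY; apply/dAP/(subsetP YA).
exists (v :: take j p ++ rev q); split.
- move=> z; rewrite !inE mem_cat mem_rev => /or3P[->|/mem_take->|zq]; rewrite ?orbT //.
  by rewrite (subsetP YA _ (qY _ zq)).
- split.
    rewrite -cat_cons cat_uniq; apply/and3P; split.
    + have -> : v :: take j p = take j.+1 (v :: p) by [].
      exact: take_uniq.
    + apply/hasPn=> z; rewrite mem_rev => /qsub; apply: contra.
      by have -> : v :: take j p = take j.+1 (v :: p) by []; move/mem_take.
    + by rewrite rev_uniq.
  right; rewrite /cycle rcons_cat cat_path pT lT /= -rev_cons.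
  case: q pq lq uq qY qn qsub => // a q pq lq uq qY _ _.
  have -> : rev (v :: a :: q) = y :: rev (belast v (a :: q)).
    by rewrite lastI lq rev_rcons.
  rewrite /= e_sym eyx /=.
  have := pq; rewrite -rev_path lq.
  rewrite (eq_path (e' := e)) //; by move=> b c; rewrite /= e_sym.
- move=> b z bY; rewrite !inE => zAP ebz.
  case/orP: zAP => [zA|/orP[/eqP->|zp]]; first by left; apply: clY ebz.
    by right; rewrite eqxx.
  right; rewrite mem_cat; apply/orP; right; apply/orP; left.
  have az : adjY z by apply/existsP; exists b; rewrite bY.
  have zi : index z p < size p by rewrite index_mem.
  have : find adjY (rev p) <= size p - (index z p).+1.
    rewrite leqNgt; apply/negP=> /(before_find v).
    rewrite nth_rev; last by rewrite ltn_subrL (leq_trans _ zi).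
    by rewrite subnSK // subKn ?(ltnW zi) // nth_index // az.
  rewrite leq_subRL // => H; have zj : index z p < j by rewrite ltn_subRL addnC.
  rewrite -(nth_index v zp) -(nth_take v zj); apply: mem_nth.
  by rewrite size_take_min (minn_idPl jle).
Qed.

(** [Y0] gathers the branches at the top of [P] that were finished without a block, and a new branch
    starts at an attached vertex [w] outside [Y0]. Every finished piece has fewer than [s] vertices
    in [W], so [Y0], [w] and one more piece have fewer than [2s] together: the union that first
    reaches [s] is the block. *)
Lemma dfs_block_rec s (W : {set T}) n (A : {set T}) (P : seq T) :
  0 < s -> #|A| <= n -> uniq P -> sorted e P ->
  (forall x, x \in A -> x \notin P) ->
  block_found s A W P \/ block_pending s A W P.
Proof.
move=> s0; elim: n => [|n IHn] in A P *; move=> cA uP sP dAP.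
  right; exists set0; move: cA; rewrite leqn0 cards_eq0 => /eqP->.
  split; rewrite ?sub0set ?set0I ?cards0 //; try by move=> y z; rewrite inE.
  by case: P {uP sP dAP} => [|v p] //= y; rewrite inE.
(* The outer induction descends along the path; [loop] runs through the branches at its top. *)
suff loop m (Y0 : {set T}) : #|A :\: Y0| <= m -> Y0 \subset A ->
    closed_within A Y0 -> #|Y0 :&: W| < s -> reachable P Y0 ->
    block_found s A W P \/ block_pending s A W P.
  apply: (loop _ set0 (leqnn _)); rewrite ?sub0set ?set0I ?cards0 //.
    by move=> y z; rewrite inE.
  by case: P {uP sP dAP loop} => [|v p] //= y; rewrite inE.
elim: m => [|m IHm] in Y0 *; move=> cm YA clY sY rY.
  right; exists Y0; split=> // w wA _; apply: contraLR cm => wY.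
  by rewrite -ltnNge card_gt0; apply/set0Pn; exists w; rewrite inE wY.
have [/existsP[w /and3P[wA aw wY]]|none] :=
  boolP [exists w, [&& w \in A, attached P w & w \notin Y0]]; last first.
  right; exists Y0; split=> // w wA aw; apply: contraNT none => wY.
  by apply/existsP; exists w; rewrite wA aw.
pose A' := (A :\: Y0) :\ w.
have wAY : w \in A :\: Y0 by rewrite inE wY.
have cA' : #|A'| <= n.
  have := cardsD1 w (A :\: Y0); rewrite wAY -/A' => c1.
  by have := subset_leq_card (subsetDl A Y0); move: cA c1; clear; lia.
have uP' : uniq (w :: P) by rewrite /= uP dAP.
have sP' : sorted e (w :: P).
  by move: sP aw; case: (P) => //= v p; rewrite e_sym => -> ->.
have dA' x : x \in A' -> x \notin w :: P.
  by rewrite !inE => /and3P[xw _ xA]; rewrite negb_or xw dAP.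
case: (IHn A' (w :: P) cA' uP' sP' dA').
  case=> Y [C [Y1 C1 sY1 cC bY]]; left; exists Y, C; split=> //.
  - apply: subset_trans Y1 _; apply/subsetP=> x; by rewrite !inE => /and3P[].
  - move=> x /C1; rewrite !inE => /orP[/and3P[_ _ ->] //|/orP[/eqP->|->]].
      by rewrite wA.
    by rewrite orbT.
  (* The block was found without looking at [Y0]. An edge from [Y] to [Y0] would put its other end
     into [Y0], which is closed within [A]. *)
  - move=> y z yY zAP eyz; have := bY y z yY _ eyz; apply.
    move: zAP; rewrite !inE; case: (eqVneq z w) => [_|zw] /=; first by rewrite ?orbT.
    case zA : (z \in A); case zP : (z \in P) => //=; rewrite ?orbT ?orbF //.
    move=> _; rewrite andbT; apply/negP=> zY0.
    have yA : y \in A by have := subsetP Y1 _ yY; rewrite !inE => /and3P[].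
    have := clY z y zY0 yA; rewrite e_sym eyz => /(_ isT) yY0.
    by have := subsetP Y1 _ yY; rewrite !inE yY0 andbF.
case=> Y1 [Y1A cl1 s1 at1 r1].
pose Y2 := w |: Y1; pose Y3 := Y0 :|: Y2.
have Y1sub x : x \in Y1 -> [/\ x != w, x \notin Y0 & x \in A].
  by move/(subsetP Y1A); rewrite !inE => /and3P[].
have Y3A : Y3 \subset A.
  apply/subsetP=> x; rewrite !inE => /or3P[/(subsetP YA)//|/eqP->//|/Y1sub[]//].
have cl3 : closed_within A Y3.
  move=> y z; rewrite !inE => yY zA eyz.
  case zY0: (z \in Y0) => //=.
  have yN : y \notin Y0 by apply: contraFN zY0 => /clY; apply.
  move: yY; rewrite (negPf yN) /= => yY.
  case: (eqVneq z w) => //= zw.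
  have zA' : z \in A' by rewrite !inE zw zY0.
  case/orP: yY => [/eqP yw|yY1]; first by apply: at1 => //=; rewrite -yw.
  exact: cl1 eyz.
have r3 : reachable P Y3.
  move: aw rY; case: (P) => //= v p aw' rY' y.
  rewrite !inE => /or3P[yY|/eqP->|yY].
  - have [q [q1 q2 q3 q4]] := rY' _ yY; exists q; split=> // x /q4.
    by rewrite !inE => ->.
  - exists [:: w]; split=> //=; first by rewrite aw'.
    by move=> x; rewrite !inE => ->; rewrite orbT.
  - have [q [q1 q2 q3 q4]] := r1 _ yY; exists (w :: q); split=> //=.
    + by rewrite aw'.
    + rewrite q3 andbT; apply/negP=> /q4 /Y1sub[]; by rewrite eqxx.
    + by move=> x; rewrite !inE => /orP[->|/q4->]; rewrite ?orbT.
have [lt3|ge3] := ltnP #|Y3 :&: W| s.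
  apply: (IHm Y3) => //.
  have : #|A :\: Y3| < #|A :\: Y0|.
    apply/proper_card/properP; split; first by apply: setDS; apply: subsetUl.
    by exists w => //; rewrite !inE eqxx orbT.
  by move: cm; clear; lia.
left; have [C [C1 C2 C3]] := close_block uP sP dAP Y3A cl3 r3.
exists Y3, C; split=> //; rewrite ge3 /=.
have : #|Y3 :&: W| <= #|Y0 :&: W| + (1 + #|Y1 :&: W|).
  rewrite setIUl (leq_trans (leq_card_setU _ _)) // leq_add2l setIUl.
  rewrite (leq_trans (leq_card_setU _ _)) // leq_add2r.
  by rewrite -(cards1 w); apply/subset_leq_card/subsetIl.
move: sY s1; rewrite -addnn.
by move: #|Y3 :&: W| #|Y0 :&: W| #|Y1 :&: W|; clear; lia.
Qed.

Lemma dfs_block s (A W : {set T}) :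
  0 < s -> s <= #|A :&: W| ->
  exists (Y : {set T}) (C : seq T), [/\ Y \subset A, {subset C <= A}, s <= #|Y :&: W| < s.*2,
    cycle_or_point C & blocked_by A Y C].
Proof.
move=> s0 sA.
have E : A :|: [set x in [::]] = A by apply/setP=> x; rewrite !inE orbF.
case: (@dfs_block_rec s W _ A [::] s0 (leqnn _)) => //.
  by case=> Y [C]; rewrite E => H; exists Y, C.
case=> Y [YA _ sY aY _]; suff YE : Y = A by move: sY; rewrite YE ltnNge sA.
by apply/eqP; rewrite eqEsubset YA; apply/subsetP=> x xA; apply: aY.
Qed.

End DepthFirstBlock.

(** * Partitions into cycles and edge counts *)

Section CyclePartitions.
Variables (T : finType) (r : nat) (e : 'I_r -> rel T).

(** Stated for arbitrary relations [e k], because it is applied both to the coloured random graph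
    and to its link graphs. *)
Definition mcyc (s : seq T) : Prop :=
  uniq s /\ (size s = 1 \/ 1 < size s /\ exists k : 'I_r, cycle (e k) s).

Definition cpart (X : {set T}) (m : nat) : Prop :=
  exists ss : seq (seq T),
    [/\ size ss <= m, (forall s, s \in ss -> mcyc s) & perm_eq (flatten ss) (enum X)].

Lemma cpart_le X m m' : m <= m' -> cpart X m -> cpart X m'.
Proof. by move=> mm [ss [H1 H2 H3]]; exists ss; split=> //; apply: leq_trans mm. Qed.

Lemma cpart0 m : cpart set0 m.
Proof. by exists [::]; rewrite enum_set0. Qed.

Lemma cpartU (X Y : {set T}) m m' :
  [disjoint X & Y] -> cpart X m -> cpart Y m' -> cpart (X :|: Y) (m + m').
Proof.
move=> dXY [s1 [a1 b1 c1]] [s2 [a2 b2 c2]]; exists (s1 ++ s2); split.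
- by rewrite size_cat leq_add.
- by move=> s; rewrite mem_cat => /orP[/b1|/b2].
- rewrite flatten_cat (perm_trans (perm_cat c1 c2)) //.
  apply: uniq_perm; rewrite ?cat_uniq ?enum_uniq ?andbT //=.
    apply/hasPn=> x; rewrite !mem_enum => xY; apply: contraTN xY => xX.
    by rewrite (disjointFr dXY xX).
  by move=> x; rewrite mem_cat !mem_enum inE.
Qed.

Lemma cpartD (X Y : {set T}) m m' :
  Y \subset X -> cpart Y m -> cpart (X :\: Y) m' -> cpart X (m + m').
Proof.
move=> YX cY cXY; have -> : X = Y :|: (X :\: Y).
  by rewrite setUC -{1}(setID X Y) (setIidPr YX) setUC.
apply: cpartU => //; rewrite -setI_eq0; apply/eqP/setP=> x; rewrite !inE.
by case: (x \in Y).
Qed.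

Lemma cpart_seq (C : seq T) : uniq C -> mcyc C -> cpart [set x in C] 1.
Proof.
move=> uC mC; exists [:: C]; split=> //; first by move=> s; rewrite inE => /eqP->.
rewrite /= cats0; apply: uniq_perm; rewrite ?enum_uniq // => x.
by rewrite mem_enum inE.
Qed.

Lemma cpart_point k (C : seq T) : cycle_or_point (e k) C -> cpart [set x in C] 1.
Proof.
case=> uC; case sz : (size C) => [|[|n]].
- by move=> _; rewrite (size0nil sz) set_nil; apply: cpart0.
- by move=> _; apply: cpart_seq => //; split=> //; left.
- case=> // cC; apply: cpart_seq => //; split=> //; right; rewrite sz.
  by split=> //; exists k.
Qed.

Lemma cpart_singles X : cpart X #|X|.
Proof.
exists [seq [:: x] | x <- enum X]; split; first by rewrite size_map cardE.
- by move=> s /mapP[x _ ->]; split=> //; left.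
- by rewrite flatten_seq1.
Qed.

End CyclePartitions.

Section Counting.
Variables (T : finType).
Implicit Types (f : rel T) (X Y Z : {set T}).

Definition deg f x Y : nat := \sum_(y in Y) f x y.
(** Ordered pairs: an edge inside [X] counts twice in [ecount f X X]. *)
Definition ecount f X Y : nat := \sum_(x in X) deg f x Y.

Lemma degE f x Y : deg f x Y = #|[set y in Y | f x y]|.
Proof.
rewrite /deg -sum1_card [LHS]big_mkcond [RHS]big_mkcond; apply: eq_bigr => y _.
by rewrite inE; case: ifP => //=; case: ifP.
Qed.

Lemma ecountC f X Y : symmetric f -> ecount f X Y = ecount f Y X.
Proof.
move=> sf; rewrite /ecount exchange_big; apply: eq_bigr => y _; apply: eq_bigr => x _.
by rewrite sf.
Qed.

Lemma deg_mono f x Y Z : Y \subset Z -> deg f x Y <= deg f x Z.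
Proof.
move=> YZ; rewrite !degE; apply/subset_leq_card/subsetP=> y; rewrite !inE.
by case/andP=> /(subsetP YZ)-> ->.
Qed.

Lemma deg_card f x Y : deg f x Y <= #|Y|.
Proof. by rewrite degE; apply/subset_leq_card/subsetP=> y; rewrite inE => /andP[]. Qed.

Lemma degUle f x Y Z : deg f x (Y :|: Z) <= deg f x Y + deg f x Z.
Proof.
rewrite !degE (leq_trans _ (leq_card_setU _ _)) //; apply/subset_leq_card/subsetP=> y.
by rewrite !inE andb_orl.
Qed.

Lemma ecount_mono f X Y Z : Y \subset Z -> ecount f X Y <= ecount f X Z.
Proof. by move=> YZ; apply: leq_sum => x _; apply: deg_mono. Qed.

Lemma ecountUle f X Y Z : ecount f X (Y :|: Z) <= ecount f X Y + ecount f X Z.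
Proof. by rewrite -big_split /=; apply: leq_sum => x _; apply: degUle. Qed.

Lemma ecount_card f X Y : ecount f X Y <= #|X| * #|Y|.
Proof.
rewrite /ecount -sum_nat_const; apply: leq_sum => x _; exact: deg_card.
Qed.

Lemma ecount_rel f g X Y : subrel f g -> ecount f X Y <= ecount g X Y.
Proof.
move=> fg; do 2!apply: leq_sum => ? _.
by case: (boolP (f _ _)) => // /fg ->.
Qed.

Lemma ecountD1 f X x : symmetric f -> irreflexive f -> x \in X ->
  ecount f X X = ecount f (X :\ x) (X :\ x) + 2 * deg f x X.
Proof.
move=> sf irf xX.
have dE y : deg f y X = f y x + deg f y (X :\ x).
  by rewrite /deg (big_setD1 x xX).
rewrite {1}/ecount (big_setD1 x xX) /= (eq_bigr (fun y => f y x + deg f y (X :\ x))); last first.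
  by move=> y _; rewrite dE.
rewrite big_split /= -/(ecount f (X :\ x) (X :\ x)).
have -> : \sum_(y in X :\ x) f y x = deg f x X.
  rewrite [RHS]dE irf /= /deg; apply: eq_bigr => y _; by rewrite sf.
by rewrite mul2n -addnn addnA addnC; congr (_ + _).
Qed.

(** Delete vertices of degree below [d] one at a time. A deletion removes less than [2d] ordered
    pairs, so the density hypothesis survives, and it cannot persist down to a single vertex. *)
Lemma min_degree_subset (R : realFieldType) f X (d : R) :
  symmetric f -> irreflexive f -> (0 < d)%R -> X != set0 ->
  (2 * d * #|X|%:R <= (ecount f X X)%:R)%R ->
  exists X' : {set T}, [/\ X' \subset X, X' != set0 &
    forall x, x \in X' -> (d <= (deg f x X')%:R)%R].
Proof.
move=> sf irf d0; move: {2}(#|X|) (erefl #|X|) => n.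
elim: n X => [|n IHn] X cX X0 EX.
  by move/eqP: cX X0; rewrite cards_eq0 => ->.
have [/forallP all|] := boolP [forall x, (x \in X) ==> (d <= (deg f x X)%:R)%R].
  by exists X; split=> // x xX; apply: (implyP (all x)).
rewrite negb_forall => /existsP[x]; rewrite negb_imply -ltNge => /andP[xX dx].
have cX1 : #|X :\ x| = n by move: (cardsD1 x X); rewrite xX cX => -[].
have E1 : (2 * d * #|X :\ x|%:R <= (ecount f (X :\ x) (X :\ x))%:R)%R.
  move: EX; rewrite (ecountD1 sf irf xX) cX cX1 natrD natrM -natr1; lra.
have [e0|n0] := eqVneq (X :\ x) set0.
  move: EX; rewrite (ecountD1 sf irf xX) e0 /ecount big_set0 add0n.
  have -> : X = [set x] by rewrite -(setD1K xX) e0 setU0.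
  by rewrite /deg !big_set1 irf cards1 /= muln0; lra.
have [X' [s1 s2 s3]] := IHn _ cX1 n0 E1; exists X'; split=> //.
exact: subset_trans s1 (subsetDl _ _).
Qed.

End Counting.

(** * Pseudorandom coloured graphs *)

Section Halving.
Variables (T : finType) (r : nat) (e : 'I_r -> rel T) (V0 : {set T}) (M n1 : nat).
Hypothesis large_cycle : forall X : {set T}, X \subset V0 -> n1 < #|X| ->
  exists C : {set T}, [/\ C \subset X, cpart e C 1 & #|X| <= M * #|C|].

(** As long as more than half of [X] is left, each cycle removes at least [|X| / (2M)] vertices; the
    third alternative records this progress after [j] cycles. For [j = M] it amounts to half of
    [X]. *)
Lemma cover_some (X : {set T}) j : X \subset V0 ->
  exists Y : {set T}, [/\ Y \subset X, cpart e (X :\: Y) j &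
    [\/ #|Y| <= n1, 2 * #|Y| <= #|X| | j * #|X| <= 2 * M * (#|X| - #|Y|)]].
Proof.
move=> XV; elim: j => [|j [Y [YX cY alt]]].
  by exists X; rewrite setDv subxx; split=> //; [exact: cpart0|constructor 3].
have [small|big] := leqP #|Y| n1.
  by exists Y; split=> //; [apply: cpart_le cY|constructor 1].
have [half|nhalf] := leqP (2 * #|Y|) #|X|.
  by exists Y; split=> //; [apply: cpart_le cY|constructor 2].
have [C [CY cC sC]] := large_cycle (subset_trans YX XV) big.
exists (Y :\: C); split.
- by apply: subset_trans YX; apply: subsetDl.
- have -> : X :\: (Y :\: C) = (X :\: Y) :|: C.
    apply/setP=> x; rewrite !inE.
    case xC: (x \in C); last by rewrite orbF.
    by rewrite (subsetP YX) ?(subsetP CY) // orbT.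
  rewrite -addn1; apply: cpartU => //.
  rewrite -setI_eq0; apply/eqP/setP=> x; rewrite !inE.
  by case xC: (x \in C); rewrite ?andbF // (subsetP CY _ xC).
- constructor 3; case: alt => [|/(leq_trans nhalf)|alt]; [by rewrite leqNgt big|by rewrite ltnn|].
  have cYX := subset_leq_card YX.
  have cCY := subset_leq_card CY.
  rewrite cardsD (setIidPr CY).
  have -> : #|X| - (#|Y| - #|C|) = (#|X| - #|Y|) + #|C| by move: cYX cCY; clear; lia.
  rewrite mulnDr mulSn addnC leq_add // -mulnA.
  by move: sC nhalf; move: (M * _) #|X| #|Y|; clear; lia.
Qed.

Lemma cover_half (X : {set T}) : X \subset V0 -> 0 < M ->
  exists Y : {set T}, [/\ Y \subset X, cpart e (X :\: Y) M &
    #|Y| <= n1 \/ 2 * #|Y| <= #|X|].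
Proof.
move=> XV M0; have [Y [YX cY alt]] := cover_some M XV; exists Y; split=> //.
case: alt => [|? |]; [by left|by right|].
rewrite -mulnA (mulnCA 2) leq_pmul2l // => H; right.
by move: H (subset_leq_card YX); move: #|X| #|Y|; clear; lia.
Qed.

(** Each round of [M] cycles halves what is left or reaches [n1], hence [b] rounds. *)
Lemma greedy_cover b (X : {set T}) : X \subset V0 -> 0 < M -> #|X| <= 2 ^ b * n1 ->
  exists Y : {set T}, [/\ Y \subset X, cpart e (X :\: Y) (M * b) & #|Y| <= n1].
Proof.
move=> XV M0; elim: b X XV => [|b IHb] X XV.
  by rewrite expn0 mul1n => cX; exists X; rewrite setDv muln0; split=> //; apply: cpart0.
move=> cX; have [Y [YX cY alt]] := cover_half XV M0.
have cY' : #|Y| <= 2 ^ b * n1.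
  case: alt => [sY|]; first by rewrite (leq_trans sY) // leq_pmull // expn_gt0.
  by move=> H; move: (leq_trans H cX); rewrite expnS -mulnA leq_pmul2l.
have [Z [ZY cZ sZ]] := IHb _ (subset_trans YX XV) cY'.
exists Z; split=> //; first exact: subset_trans ZY YX.
have -> : X :\: Z = (X :\: Y) :|: (Y :\: Z).
  apply/setP=> x; rewrite !inE; case xY: (x \in Y) => /=.
    by rewrite (subsetP YX _ xY) andbT.
  by case xZ: (x \in Z); rewrite ?orbF //=; rewrite (subsetP ZY _ xZ) in xY.
rewrite mulnS; apply: cpartU => //.
rewrite -setI_eq0; apply/eqP/setP=> x; rewrite !inE.
by case: (x \in Y); rewrite ?andbF.
Qed.

End Halving.

Section Pseudorandom.
Variables (R : realFieldType) (T : finType) (r : nat) (e : 'I_r -> rel T).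
Hypothesis e_sym : forall k, symmetric (e k).
Hypothesis e_irr : forall k, irreflexive (e k).
Hypothesis r0 : 0 < r.

Definition adj : rel T := fun x y => [exists k, e k x y].

(** The summand [s] makes the bound hold for every [Y], so it can be applied to neighbourhoods of
    unknown size; read backwards it bounds them from below. *)
Definition upper_regular (q : R) (s : nat) : Prop :=
  forall X Y : {set T}, s <= #|X| ->
    ((ecount adj X Y)%:R <= q * #|X|%:R * (#|Y| + s)%:R)%R.

Definition lower_dense (kap : R) (n0 : nat) (V0 : {set T}) : Prop :=
  forall X : {set T}, X \subset V0 -> n0 <= #|X| ->
    (kap * #|X|%:R ^+ 2 <= (ecount adj X X)%:R)%R.

Lemma sub_adj k : subrel (e k) adj.
Proof. by move=> x y exy; apply/existsP; exists k. Qed.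

Lemma adj_sym : symmetric adj.
Proof. by move=> x y; apply: eq_existsb => k; rewrite e_sym. Qed.

Lemma deg_adj_le x Y : deg adj x Y <= \sum_k deg (e k) x Y.
Proof.
rewrite /deg exchange_big /=; apply: leq_sum => y _.
case: (boolP (adj x y)) => // /existsP[k exy].
by rewrite (bigD1 k) //= exy.
Qed.

Lemma ecount_adj_le X Y : ecount adj X Y <= \sum_k ecount (e k) X Y.
Proof.
by rewrite /ecount [leqRHS]exchange_big /=; apply: leq_sum => x _; apply: deg_adj_le.
Qed.

(** Some colour has average degree at least [2d] in [X], and low degrees are pruned in that
    colour. *)
Lemma dense_colour (kap d : R) (X : {set T}) :
  (0 < d)%R -> X != set0 -> (2 * r%:R * d <= kap * #|X|%:R)%R ->
  (kap * #|X|%:R ^+ 2 <= (ecount adj X X)%:R)%R ->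
  exists k (X' : {set T}), [/\ X' \subset X, X' != set0 &
    forall x, x \in X' -> (d <= (deg (e k) x X')%:R)%R].
Proof.
move=> d0 X0 dk EX.
have cX : (0 < #|X|%:R :> R)%R by rewrite ltr0n card_gt0.
have [/existsP[k Ek]|/existsPn none] :=
    boolP [exists k : 'I_r, (2 * d * #|X|%:R <= (ecount (e k) X X)%:R)%R].
  by have [X' H] := min_degree_subset (e_sym k) (e_irr k) d0 X0 Ek; exists k, X'.
exfalso; move: EX; apply/negP; rewrite -ltNge.
apply: le_lt_trans (_ : (\sum_k ecount (e k) X X)%:R < _)%R.
  by rewrite ler_nat ecount_adj_le.
rewrite natr_sum.
apply: (@lt_le_trans _ _ (\sum_(k < r) (2 * d * #|X|%:R)))%R.
  apply: ltr_sum; last by move=> k _; rewrite ltNge; apply: none.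
  by apply/hasP; exists (Ordinal r0) => //; rewrite mem_index_enum.
rewrite sumr_const card_ord -mulr_natl expr2 mulrA.
have := ler_wpM2r (ltW cX) dk; lra.
Qed.

End Pseudorandom.

Section LongCycle.
Variables (R : realFieldType) (T : finType) (r : nat) (e : 'I_r -> rel T).
Hypothesis e_sym : forall k, symmetric (e k).
Hypothesis e_irr : forall k, irreflexive (e k).
Hypothesis r0 : 0 < r.
Variables (q : R) (s : nat).
Hypothesis s0 : 0 < s.
Hypothesis reg : upper_regular e q s.

Lemma ecount_lower f (Y N : {set T}) (d : R) :
  (forall y, y \in Y -> (d <= (deg f y N)%:R)%R) ->
  (#|Y|%:R * d <= (ecount f Y N)%:R)%R.
Proof.
move=> dY; rewrite natr_sum mulr_natl -sumr_const; exact: ler_sum.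
Qed.

Lemma ecount_k_upper k (Y N : {set T}) : s <= #|Y| ->
  ((ecount (e k) Y N)%:R <= q * #|Y|%:R * (#|N| + s)%:R)%R.
Proof.
move=> /reg reg'; apply: le_trans (reg' N); rewrite ler_nat ecount_rel //.
exact: sub_adj.
Qed.

Lemma neighbourhood_large k (Y N : {set T}) (d : R) : s <= #|Y| ->
  (forall y, y \in Y -> (d <= (deg (e k) y N)%:R)%R) ->
  (d <= q * (#|N| + s)%:R)%R.
Proof.
move=> sY dY; have Y0 : (0 < #|Y|%:R :> R)%R by rewrite ltr0n (leq_trans s0).
rewrite -(ler_pM2l Y0); apply: le_trans (ecount_lower dY) _.
by rewrite mulrCA mulrA; apply: ecount_k_upper.
Qed.

(** In a subset of minimum degree [q b |X|] in one colour take a block [Y] of fewer than [2s]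
    vertices. All its neighbours lie in [Y] or on the cycle, and regularity forces these two to have
    at least [b |X| - s] vertices together. *)
Lemma large_mono_cycle (kap b : R) (X : {set T}) :
  (0 < q)%R -> (0 < b)%R -> X != set0 -> (2 * r%:R * (q * b) <= kap)%R ->
  (kap * #|X|%:R ^+ 2 <= (ecount (adj e) X X)%:R)%R ->
  (s%:R <= q * b * #|X|%:R)%R ->
  exists C : {set T}, [/\ C \subset X, cpart e C 1 &
    (b * #|X|%:R <= (#|C| + 3 * s)%:R)%R].
Proof.
move=> q0 b0 X0 kb EX sX.
have cX : (0 < #|X|%:R :> R)%R by rewrite ltr0n card_gt0.
have d0 : (0 < q * b * #|X|%:R)%R by rewrite !mulr_gt0.
have kd : (2 * r%:R * (q * b * #|X|%:R) <= kap * #|X|%:R)%R.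
  by rewrite mulrA ler_wpM2r // ltW.
have [k [X' [X'X X'0 dX']]] := dense_colour e_sym e_irr r0 d0 X0 kd EX.
have sX' : s <= #|X' :&: setT|.
  case/set0Pn: X'0 => x xX'; rewrite setIT -(ler_nat R).
  apply: le_trans sX (le_trans (dX' x xX') _); rewrite ler_nat; exact: deg_card.
have [Y [C [YX CX /andP[sY Ys] cC bl]]] := dfs_block (e_sym k) s0 sX'.
rewrite setIT in sY Ys.
exists [set x in C]; split.
- by apply: subset_trans X'X; apply/subsetP=> x; rewrite inE => /CX.
- exact: cpart_point cC.
have dY y : y \in Y -> (q * b * #|X|%:R <= (deg (e k) y (Y :|: [set x in C]))%:R)%R.
  move=> yY; apply: le_trans (dX' _ (subsetP YX _ yY)) _.
  rewrite ler_nat !degE; apply/subset_leq_card/subsetP=> z.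
  by rewrite !inE => /andP[zX' eyz]; rewrite eyz andbT; apply/orP; apply: bl eyz.
have := neighbourhood_large sY dY.
rewrite -mulrA ler_pM2l // => /le_trans; apply; rewrite ler_nat.
have := (leq_card_setU Y [set x in C]).1; move: Ys; rewrite -addnn.
by move: #|_ :|: _| #|Y| #|[set x in C]|; clear; lia.
Qed.

End LongCycle.

(** * Cycles alternating between a set and a reservoir *)

Section Majority.
Variables (R : realFieldType) (T : finType) (r : nat) (e : 'I_r -> rel T).
Hypothesis e_sym : forall k, symmetric (e k).
Hypothesis r0 : 0 < r.
Variables (q : R) (s : nat).
Hypothesis s0 : 0 < s.
Hypothesis q0 : (0 < q)%R.
Hypothesis reg : upper_regular e q s.

(** The successor map of the cycle sends its vertices in [F] injectively into [A]; the extra 1 is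
    for a cycle that is a single vertex. *)
Lemma alternating_card (f : rel T) (A F : {set T}) (C : seq T) :
  (forall x y, f x y -> x \in F -> y \in A) -> cycle_or_point f C ->
  #|F :&: [set x in C]| <= #|A :&: [set x in C]| + 1.
Proof.
move=> fAF [uC [sC|cC]].
  apply: leq_trans (leq_addl _ _); apply: leq_trans sC.
  apply: leq_trans (subset_leq_card (subsetIr _ _)) _.
  by rewrite cardsE; apply: card_size.
apply: leq_trans (leq_addr _ _).
have inj : injective (next C) by apply: can_inj (prev_next uC).
rewrite -(card_imset _ inj); apply/subset_leq_card/subsetP=> y /imsetP[x].
rewrite !inE => /andP[xF xC] ->; rewrite mem_next xC andbT.
by apply: fAF xF; apply: next_cycle.
Qed.

(** Depth-first search in the bipartite graph of colour [k] between [A] and the reservoir [F],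
    weighing only [A]. [B] is the part of the reservoir already spent; it still counts for degrees.
    Each round leaves over fewer than [2s] vertices of [A] but removes at least [nu] vertices from
    [F], which bounds the number of rounds by [t]. *)
Lemma one_colour_cover k (lam nu : R) t (A F B : {set T}) :
  [disjoint A & F] ->
  (forall x, x \in A -> (lam <= (deg (e k) x (F :|: B))%:R)%R) ->
  (#|F|%:R < t%:R * nu)%R ->
  (q * ((#|B| + #|A| + t + s.*2)%:R + nu) <= lam)%R ->
  exists Lf P : {set T}, [/\ Lf \subset A, P \subset F,
    cpart e ((A :\: Lf) :|: P) t, #|Lf| <= t * s.*2.-1 + s.-1
    & #|P| <= #|A :\: Lf| + t].
Proof.
elim: t A F B => [|t IHt] A F B dAF degA cF lamB.
  by move: cF; rewrite mul0r ltNge ler0n.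
have [sA|sA] := ltnP #|A| s.
  exists A, set0; rewrite setDv setU0 subxx sub0set cards0; split=> //; first exact: cpart0.
  by rewrite (leq_trans _ (leq_addl _ _)) // -ltnS prednK.
pose f : rel T := fun x y => e k x y && ((x \in A) && (y \in F) || (x \in F) && (y \in A)).
have fsym : symmetric f.
  by move=> x y; rewrite /f e_sym orbC [(x \in F) && _]andbC [(x \in A) && _]andbC.
have sW : s <= #|(A :|: F) :&: A| by rewrite (setIidPr (subsetUl A F)).
have [Y [C [YAF CAF /andP[sY Ys] cC bl]]] := dfs_block fsym s0 sW.
set C' := [set x in C].
have dAFE x : x \in A -> x \in F = false by move=> xA; apply: (disjointFr dAF).
have cCF : #|F :&: C'| <= #|A :&: C'| + 1.
  apply: alternating_card cC => x y /andP[_ /orP[/andP[xA _]|/andP[]//]] xF.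
  by rewrite dAFE in xF.
have cCk : cpart e C' 1.
  apply: (@cpart_point _ _ _ k); case: cC => uC alt; split=> //.
  case: alt => [|cf]; [by left|right]; case: (C) cf => //= a l.
  by apply: sub_path => x y /andP[].
have blA x z : x \in A -> z \in F -> e k x z -> x \in Y -> z \in Y \/ z \in C.
  move=> xA zF exz xY; apply: bl xY _ _; first by rewrite inE zF orbT.
  by rewrite /f exz xA zF.
have blF x z : x \in A -> z \in F -> e k x z -> z \in Y -> x \in Y \/ x \in C.
  move=> xA zF exz zY; apply: bl zY _ _; first by rewrite inE xA.
  by rewrite /f e_sym exz xA zF orbT.
pose A1 := (A :\: Y) :\: C'; pose F1 := (F :\: Y) :\: C'.
pose B1 := B :|: (F :&: C').
have dA1F1 : [disjoint A1 & F1].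
  apply: disjointWl (_ : A1 \subset A) _; first by rewrite /A1 setDDl subsetDl.
  by apply: disjointWr dAF; rewrite /F1 setDDl subsetDl.
(* The neighbours of [Y :&: A] lie in [Y], on the cycle or in [B]. The last two are too small to
   hold a neighbourhood of the size that regularity demands. *)
have nuY : (nu <= #|Y :&: F|%:R)%R.
  have dY y : y \in Y :&: A ->
      (lam <= (deg (e k) y ((Y :&: F) :|: (F :&: C') :|: B))%:R)%R.
    rewrite inE => /andP[yY yA]; apply: le_trans (degA _ yA) _.
    rewrite ler_nat !degE; apply/subset_leq_card/subsetP=> z.
    rewrite !inE => /andP[zFB eyz]; rewrite eyz andbT.
    case/orP: zFB => [zF|->]; last by rewrite orbT.
    by case: (blA y z yA zF eyz yY) => ->; rewrite zF ?orbT.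
  have := neighbourhood_large s0 reg sY dY.
  move=> /(le_trans lamB); rewrite ler_pM2l //.
  have c1 : #|Y :&: F :|: F :&: C' :|: B| <= #|Y :&: F| + #|F :&: C'| + #|B|.
    by rewrite (leq_trans (leq_card_setU _ _)) // leq_add2r (leq_card_setU _ _).1.
  have c2 : #|A :&: C'| <= #|A| by apply/subset_leq_card/subsetIl.
  have c3 : #|Y :&: F :|: F :&: C' :|: B| + s <= #|Y :&: F| + (#|B| + #|A| + t.+1 + s.*2).
    move: c1 c2 cCF; rewrite -addnn; move: #|_ :|: B| #|F :&: C'| #|A :&: C'| #|Y :&: F| #|A| #|B|.
    by clear; lia.
  move: c3; rewrite -(ler_nat R) [leRHS]natrD; lra.
have cF1 : #|F1| + #|Y :&: F| <= #|F|.
  rewrite -(cardsID Y F) setIC addnC leq_add2l.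
  by apply/subset_leq_card; rewrite /F1 subsetDl.
have cA1 : #|A1| + #|A :&: C'| <= #|A|.
  rewrite -(cardsID C' A) addnC leq_add2l; apply/subset_leq_card.
  by apply/subsetP=> x; rewrite !inE => /and3P[-> _ ->].
have cB1 : #|B1| <= #|B| + #|F :&: C'| by rewrite (leq_card_setU _ _).1.
(* No edge of colour [k] joins [A1] to [F :&: Y], except where the latter meets the cycle and goes
   to [B1]; so dropping [F :&: Y] costs no degree. *)
have degA1 x : x \in A1 -> (lam <= (deg (e k) x (F1 :|: B1))%:R)%R.
  rewrite !inE => /and3P[xC xY xA]; apply: le_trans (degA _ xA) _.
  rewrite ler_nat !degE; apply/subset_leq_card/subsetP=> z.
  rewrite !inE => /andP[zFB exz]; rewrite exz andbT.
  case/orP: zFB => [zF|->]; last by rewrite orbT.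
  rewrite zF andbT /=; case zC: (z \in C); rewrite ?orbT //=.
  case zY: (z \in Y) => //.
  by case: (blF x z xA zF exz zY) => H; [rewrite H in xY|rewrite H in xC].
have cF1' : (#|F1|%:R < t%:R * nu)%R.
  have : ((#|F1| + #|Y :&: F|)%:R <= (#|F|%:R : R))%R by rewrite ler_nat.
  move: cF; rewrite natrD -natr1; lra.
(* [|B| + |A| + t] does not grow: the cycle moves at most one more vertex into [B] than it removes
   from [A], and the decrease of [t] pays for that one. *)
have lamB1 : (q * ((#|B1| + #|A1| + t + s.*2)%:R + nu) <= lam)%R.
  apply: le_trans lamB; rewrite ler_pM2l // lerD2r ler_nat leq_add2r.
  move: cB1 cA1 cCF; move: #|B1| #|A1| #|A :&: C'| #|F :&: C'| #|A| #|B|; clear; lia.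
have [L1 [P1 [L1A P1F cov cL cP]]] := IHt A1 F1 B1 dA1F1 degA1 cF1' lamB1.
have L1x x : x \in L1 -> [/\ x \in A, x \notin Y & x \notin C].
  by move/(subsetP L1A); rewrite !inE => /and3P[].
have P1x x : x \in P1 -> [/\ x \in F, x \notin Y & x \notin C].
  by move/(subsetP P1F); rewrite !inE => /and3P[].
pose L := L1 :|: ((Y :&: A) :\: C').
exists L, (P1 :|: (F :&: C')); split.
- by apply/subsetP=> x; rewrite !inE => /orP[/L1x[]//|/and3P[]].
- by apply/subsetP=> x; rewrite !inE => /orP[/P1x[]//|/andP[]].
- have -> : (A :\: L) :|: (P1 :|: F :&: C') = ((A1 :\: L1) :|: P1) :|: C'.
    apply/setP=> x; rewrite !inE.
    case xC: (x \in C); rewrite /= ?andbT ?andbF ?orbF ?orbT.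
      have := CAF x xC; rewrite inE => /orP[xA|xF]; rewrite ?xF ?orbT // xA.
      by case xL: (x \in L1) => //; case: (L1x _ xL); rewrite xC.
    case xY: (x \in Y) => //=; rewrite ?andbF ?orbF //.
    by case: (x \in L1); case: (x \in A).
  rewrite -addn1; apply: cpartU => //.
  rewrite -setI_eq0; apply/eqP/setP=> x; rewrite !inE.
  case xC: (x \in C); rewrite ?andbF //= andbT.
  case xP: (x \in P1); last by rewrite ?andbF.
  by case: (P1x _ xP); rewrite xC.
- apply: leq_trans (leq_card_setU _ _).1 _.
  have : #|(Y :&: A) :\: C'| <= s.*2.-1.
    rewrite -ltnS prednK ?double_gt0 //; apply: leq_ltn_trans Ys.
    by apply/subset_leq_card/subsetDl.
  by move: cL; rewrite mulSn; move: #|L1| #|_ :\: C'| (t * _); clear; lia.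
- apply: leq_trans (leq_card_setU _ _).1 _.
  have : #|A1 :\: L1| + #|A :&: C'| <= #|A :\: L|.
    have <- : (A1 :\: L1) :|: (A :&: C') = A :\: L.
      apply/setP=> x; rewrite !inE; case xL: (x \in L1) => /=.
        by case: (L1x _ xL) => _ _ /negPf->; rewrite !andbF.
      by case: (x \in C); case: (x \in Y); case: (x \in A).
    rewrite cardsU (_ : (A1 :\: L1) :&: (A :&: C') = set0) ?cards0 ?subn0 //.
    apply/setP=> x; rewrite !inE; case: (x \in C); rewrite ?andbF //.
  by move: cP cCF; move: #|P1| #|_ :\: L1| #|_ :\: L| #|A :&: C'| #|F :&: C'|; clear; lia.
Qed.

(** The colours are treated one after another; reservoir vertices spent for one colour join [B] for
    the next, which keeps [F :|: B] and hence all degrees fixed. *)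
Lemma colours_cover (maj : T -> 'I_r) (lam nu : R) t (ks : seq 'I_r) (A F B : {set T}) :
  uniq ks -> (forall x, x \in A -> maj x \in ks) ->
  [disjoint A & F] ->
  (forall x, x \in A -> (lam <= (deg (e (maj x)) x (F :|: B))%:R)%R) ->
  (#|F|%:R < t%:R * nu)%R ->
  (q * ((#|B| + #|A| + size ks * t + s.*2)%:R + nu) <= lam)%R ->
  exists Lf P : {set T}, [/\ Lf \subset A, P \subset F,
    cpart e ((A :\: Lf) :|: P) (size ks * t),
    #|Lf| <= size ks * (t * s.*2.-1 + s.-1)
    & #|P| <= #|A :\: Lf| + size ks * t].
Proof.
elim: ks A F B => [|k ks IHk] A F B /=.
  move=> _ Anil _ _ _ _; have -> : A = set0.
    by apply/setP=> x; rewrite inE; apply/negP=> /Anil.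
  exists set0, set0; rewrite !sub0set set0D setU0 cards0; split=> //; exact: cpart0.
case/andP=> kks uks majA dAF degA cF lamB.
pose Ak := [set x in A | maj x == k]; pose A' := A :\: Ak.
have AkA : Ak \subset A by apply/subsetP=> x; rewrite inE => /andP[].
have cA : #|A| = #|Ak| + #|A'| by rewrite -(cardsID Ak A) (setIidPr AkA).
have dk : [disjoint Ak & F] by apply: disjointWl dAF.
have degk x : x \in Ak -> (lam <= (deg (e k) x (F :|: B))%:R)%R.
  by rewrite inE => /andP[xA /eqP <-]; apply: degA.
have lamk : (q * ((#|B| + #|Ak| + t + s.*2)%:R + nu) <= lam)%R.
  apply: le_trans lamB; rewrite ler_pM2l // lerD2r ler_nat cA mulSn.
  by move: (size ks * t); clear; lia.
have [L1 [P1 [L1A P1F cov1 cL1 cP1]]] := one_colour_cover dk degk cF lamk.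
have dA'F' : [disjoint A' & F :\: P1].
  apply: disjointWl (_ : A' \subset A) _; first by apply: subsetDl.
  by apply: disjointWr dAF; apply: subsetDl.
have FB : (F :\: P1) :|: (B :|: P1) = F :|: B.
  apply/setP=> x; rewrite !inE; case xP: (x \in P1) => //=.
    by rewrite !orbT (subsetP P1F).
  by rewrite orbF.
have deg' x : x \in A' -> (lam <= (deg (e (maj x)) x ((F :\: P1) :|: (B :|: P1)))%:R)%R.
  by rewrite FB !inE => /andP[_ xA]; apply: degA.
have maj' x : x \in A' -> maj x \in ks.
  rewrite !inE => /andP[xk xA]; have := majA x xA; rewrite inE.
  by rewrite xA /= in xk; rewrite (negPf xk).
have cF' : (#|F :\: P1|%:R < t%:R * nu)%R.
  by apply: le_lt_trans cF; rewrite ler_nat subset_leq_card // subsetDl.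
have lam' : (q * ((#|B :|: P1| + #|A'| + size ks * t + s.*2)%:R + nu) <= lam)%R.
  apply: le_trans lamB; rewrite ler_pM2l // lerD2r ler_nat leq_add2r cA mulSn.
  have c3 := subset_leq_card (subsetDl Ak L1).
  move: (leq_card_setU B P1).1 cP1 c3.
  by move: #|_ :|: _| #|B| #|P1| #|Ak :\: _| #|Ak| #|A'| (size ks * t); clear; lia.
have [L2 [P2 [L2A P2F cov2 cL2 cP2]]] := IHk _ _ _ uks maj' dA'F' deg' cF' lam'.
have L1x x : x \in L1 -> x \in Ak by apply: (subsetP L1A).
have L2x x : x \in L2 -> x \in A /\ x \notin Ak.
  by move/(subsetP L2A); rewrite inE => /andP[].
have P2x x : x \in P2 -> x \in F /\ x \notin P1.
  by move/(subsetP P2F); rewrite inE => /andP[].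
have dAFE x : x \in A -> x \in F = false by move=> xA; apply: (disjointFr dAF).
exists (L1 :|: L2), (P1 :|: P2); split.
- by rewrite subUset (subset_trans L1A AkA) (subset_trans L2A (subsetDl _ _)).
- by rewrite subUset P1F (subset_trans P2F (subsetDl _ _)).
- have -> : (A :\: (L1 :|: L2)) :|: (P1 :|: P2) =
      ((Ak :\: L1) :|: P1) :|: ((A' :\: L2) :|: P2).
    apply/setP=> x; rewrite !in_setU !in_setD !in_setU.
    case xAk: (x \in Ak).
      rewrite (subsetP AkA _ xAk) /= andbT andbF.
      case xL2: (x \in L2); first by case: (L2x _ xL2); rewrite xAk.
      by rewrite orbF /=; case: (x \in L1); case: (x \in P1).
    case xL1: (x \in L1); first by move: (L1x _ xL1); rewrite xAk.
    by rewrite /= ?andbF /=; case: (x \in P1); case: (x \in L2); case: (x \in A).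
  rewrite mulSn; apply: cpartU => //.
  rewrite -setI_eq0; apply/eqP/setP=> x; rewrite in_set0 in_setI !in_setU !in_setD.
  apply/negP=> /andP[]; case/orP=> [/andP[_ xAk]|xP1]; case/orP=> [/and3P[_ nAk xA]|xP2].
  - by rewrite xAk in nAk.
  - by case: (P2x _ xP2); rewrite dAFE // (subsetP AkA).
  - by move: (subsetP P1F _ xP1); rewrite dAFE.
  - by case: (P2x _ xP2); rewrite xP1.
- by rewrite (leq_trans (leq_card_setU _ _).1) // mulSn leq_add.
- apply: leq_trans (leq_card_setU _ _).1 _.
  have : #|Ak :\: L1| + #|A' :\: L2| <= #|A :\: (L1 :|: L2)|.
    rewrite -(cardsID Ak (A :\: _)) leq_add //; apply/subset_leq_card/subsetP=> x.
      rewrite !in_setI !in_setD !in_setU => /andP[xL1 xAk]; rewrite xAk (subsetP AkA _ xAk) (negPf xL1) !andbT /=.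
      by apply/negP=> /L2x[_]; rewrite xAk.
    rewrite !in_setD !in_setU => /and3P[xL2 xAk xA]; rewrite xAk xA (negPf xL2) orbF /= andbT.
    by apply: contra xAk => /L1x.
  move: cP1 cP2; rewrite mulSn.
  by move: #|P1| #|P2| #|Ak :\: L1| #|A' :\: L2| #|A :\: _| (_ * t); clear; lia.
Qed.

Lemma majority_cover (tau lam nu : R) t (A U : {set T}) :
  [disjoint A & U] -> (r%:R * lam <= tau)%R ->
  (forall x, x \in A -> (tau <= (deg (adj e) x U)%:R)%R) ->
  (#|U|%:R < t%:R * nu)%R ->
  (q * ((#|A| + r * t + s.*2)%:R + nu) <= lam)%R ->
  exists Lf P : {set T}, [/\ Lf \subset A, P \subset U,
    cpart e ((A :\: Lf) :|: P) (r * t),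
    #|Lf| <= r * (t * s.*2.-1 + s.-1)
    & #|P| <= #|A :\: Lf| + r * t].
Proof.
move=> dAU lamtau degA cU lamB.
(* The default is not reached on [A]: otherwise all [r] colour degrees would be below [lam], against
   [tau >= r * lam]. *)
pose maj x := odflt (Ordinal r0) [pick k | (lam <= (deg (e k) x U)%:R)%R].
have majP x : x \in A -> (lam <= (deg (e (maj x)) x U)%:R)%R.
  move=> xA; rewrite /maj; case: pickP => //= none; exfalso.
  have := degA x xA; apply/negP; rewrite -ltNge.
  apply: le_lt_trans (_ : (\sum_k (deg (e k) x U))%:R < _)%R.
    by rewrite ler_nat deg_adj_le.
  apply: lt_le_trans lamtau; rewrite natr_sum mulr_natl -[X in (_ < _ *+ X)%R]card_ord -sumr_const.
  apply: ltr_sum; last by move=> k _; rewrite ltNge none.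
  by apply/hasP; exists (Ordinal r0) => //; rewrite mem_index_enum.
have sz : size (enum 'I_r) = r by rewrite size_enum_ord.
have := @colours_cover maj lam nu t (enum 'I_r) A U set0 (enum_uniq _).
rewrite setU0 cards0 sz add0n; apply=> // x _; by rewrite mem_enum.
Qed.

End Majority.

(** * Absorbers *)

Section Gadgets.
Variables (T : finType) (f : rel T).

(* A gadget is traversed from [gy] to [gb] either through all six vertices or
   through all but [gu]: the vertex [gu] can be absorbed. *)
Record gadget := Gadget { gy : T; ga : T; gz : T; gc : T; gu : T; gb : T }.

Definition body g := [:: gy g; ga g; gz g; gc g; gb g].
Definition full g := [:: gy g; ga g; gz g; gc g; gu g; gb g].
Definition bypass g := [:: gy g; gc g; gz g; ga g; gb g].

Definition hooked x g := path f x (full g) && path f x (bypass g).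

Fixpoint chain x gs := if gs is g :: gs' then hooked x g && chain (gb g) gs' else true.

Definition verts gs := flatten [seq full g | g <- gs].

Definition route (U : {set T}) gs :=
  flatten [seq if gu g \in U then bypass g else full g | g <- gs].

Lemma route_path U x gs : chain x gs ->
  path f x (route U gs) /\ last x (route U gs) = last x (map gb gs).
Proof.
elim: gs x => //= g gs IH x /andP[/andP[h1 h2] /IH[p l]].
rewrite /route /= -/(route U gs); case: ifP => _; rewrite cat_path last_cat.
  by rewrite h2 /= p l.
by rewrite h1 /= p l.
Qed.

Lemma chain_cat x gs1 gs2 :
  chain x (gs1 ++ gs2) = chain x gs1 && chain (last x (map gb gs1)) gs2.
Proof. by elim: gs1 x => //= g gs1 IH x; rewrite IH andbA. Qed.

Lemma verts_cat gs1 gs2 : verts (gs1 ++ gs2) = verts gs1 ++ verts gs2.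
Proof. by rewrite /verts map_cat flatten_cat. Qed.

Lemma verts_cons g gs : verts (g :: gs) = full g ++ verts gs.
Proof. by []. Qed.

Lemma size_verts gs : size (verts gs) = 6 * size gs.
Proof. by elim: gs => //= g gs IH; rewrite /verts /= -/(verts gs) IH mulnS. Qed.

Lemma verts_gb gs : {subset map gb gs <= verts gs}.
Proof.
elim: gs => //= g gs IH x; rewrite /verts /= -/(verts gs) !inE => /orP[->|/IH->].
  by rewrite !orbT.
by rewrite !orbT.
Qed.

Lemma verts_gu gs : {subset map gu gs <= verts gs}.
Proof.
elim: gs => //= g gs IH x; rewrite /verts /= -/(verts gs) !inE => /orP[->|/IH->].
  by rewrite !orbT.
by rewrite !orbT.
Qed.

Lemma subseq_gb gs : subseq (map gb gs) (verts gs).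
Proof.
elim: gs => // g gs IH.
apply: (@cat_subseq _ [:: gb g] _ (full g) (verts gs)) => //.
by rewrite sub1seq !inE eqxx ?orbT.
Qed.

Lemma subseq_gu gs : subseq (map gu gs) (verts gs).
Proof.
elim: gs => // g gs IH.
apply: (@cat_subseq _ [:: gu g] _ (full g) (verts gs)) => //.
by rewrite sub1seq !inE eqxx ?orbT.
Qed.

Lemma uniq_verts_body gs : uniq (verts gs) ->
  forall g, List.In g gs -> forall z, z \in body g -> z \notin map gu gs.
Proof.
elim: gs => // g gs IH; rewrite verts_cons cat_uniq => /and3P[ug ugs uv] g' [<-|gg'] z zg'; rewrite map_cons.
  rewrite inE negb_or; apply/andP; split.
    by apply: contraTneq ug => zu; move: zg'; rewrite zu /full /body /= !inE => zg; rewrite !negb_or;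
      case/or4P: zg => [|||/orP[]] /eqP ->; rewrite !eqxx ?andbF.
  apply/negP=> /verts_gu zv; case/hasP: ugs; exists z => //.
  by move: zg'; rewrite /body /full !inE => /or4P[|||/orP[]] ->; rewrite ?orbT.
rewrite inE negb_or (IH uv g' gg' z zg') andbT; apply/eqP=> zu.
case/hasP: ugs; exists z; last by rewrite zu !inE eqxx !orbT.
have {zg'} zf : z \in full g'.
  by move: zg'; rewrite /body /full !inE => /or4P[|||/orP[]] ->; rewrite ?orbT.
elim: (gs) gg' => //= g1 l IHl [->|/IHl]; rewrite verts_cons mem_cat ?zf // => ->.
by rewrite orbT.
Qed.

Lemma route_perm (U : {set T}) gs : uniq (verts gs) -> {subset U <= map gu gs} ->
  perm_eq (route U gs) [seq z <- verts gs | z \notin U].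
Proof.
move=> uv UG; have := uniq_verts_body uv.
(* Only this consequence is kept, and [G] is then detached from [gs]: the inclusion of [U] in the
   vertices [gu] would not pass to the tail in the induction. *)
have {UG} : forall z, z \notin map gu gs -> z \notin U by move=> z; apply: contra => /UG.
move: (map gu gs) => G GU.
elim: gs {uv} => // g gs IH Hb.
have nU z : z \in body g -> z \notin U by move=> zb; apply/GU/(Hb g) => //; left.
have pr : perm_eq (route U gs) [seq z <- verts gs | z \notin U].
  by apply: IH => g' gg'; apply: Hb; right.
rewrite verts_cons filter_cat; apply: (perm_cat _ pr).
have [Ey Ea Ez Ec Eb] : [/\ gy g \notin U, ga g \notin U, gz g \notin U,
    gc g \notin U & gb g \notin U].
  by split; apply: nU; rewrite !inE eqxx ?orbT.
rewrite /full /= Ey Ea Ez Ec Eb.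
case: (gu g \in U) => //=; apply/permP=> P /=.
by move: (P (gy g)) (P (ga g)) (P (gz g)) (P (gc g)) (P (gb g)) => [] [] [] [] [].
Qed.

End Gadgets.

Section Extend.
Variables (R : realFieldType) (T : finType) (r : nat) (e : 'I_r -> rel T).
Hypothesis e_sym : forall k, symmetric (e k).
Hypothesis e_irr : forall k, irreflexive (e k).
Variables (q : R) (s : nat).
Hypothesis s0 : 0 < s.
Hypothesis q0 : (0 < q)%R.
Hypothesis reg : upper_regular e q s.
Variables (k : 'I_r) (X : {set T}) (bx : R) (w0 : nat).
Local Notation f := (e k).
Local Notation d := (q * bx)%R.
Hypothesis dX : forall x, x \in X -> (d <= (deg f x X)%:R)%R.
Hypothesis w0X : (w0%:R * #|X|%:R <= d * d / 8)%R.
Hypothesis w3X : (6 * #|X|%:R <= w0%:R * d)%R.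
Hypothesis sw0 : s <= w0.
Hypothesis sbx : (2 * s%:R + w0%:R + 1 <= bx / 8)%R.
Hypothesis sd : (s%:R <= d / 4)%R.
Hypothesis d24 : (24 <= d)%R.

(** [Y] sends at least [|Y| d] edges into [X], at most half of them to vertices that receive fewer
    than [m]. The other half ends in the popular vertices, so by regularity these are many. *)
Lemma popular (Y : {set T}) (m : nat) : s <= #|Y| -> Y \subset X ->
  (m%:R * #|X|%:R <= #|Y|%:R * d / 2)%R ->
  (bx / 2 <= (#|[set w in X | (m <= deg f w Y)%N]| + s)%:R)%R.
Proof.
move=> sY YX mX; set D := [set w in X | _].
have Y0 : (0 < #|Y|%:R :> R)%R by rewrite ltr0n (leq_trans s0).
have E1 : (#|Y|%:R * d <= (ecount f Y X)%:R)%R.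
  by apply: ecount_lower => y /(subsetP YX); apply: dX.
have E2 : ecount f Y X <= ecount f Y D + ecount f (X :\: D) Y.
  rewrite [X in _ + X]ecountC; last exact: e_sym.
  apply: leq_trans (ecountUle _ _ _ _); apply: ecount_mono.
  by apply/subsetP=> x xX; rewrite inE in_setD xX andbT; case: (x \in D).
have E3 : ((ecount f (X :\: D) Y)%:R <= m%:R * #|X|%:R :> R)%R.
  rewrite -natrM ler_nat mulnC.
  apply: (@leq_trans (\sum_(x in X :\: D) m)).
    apply: leq_sum => x; rewrite !inE => /andP[].
    by rewrite negb_and; case: (x \in X) => //=; rewrite -ltnNge => /ltnW.
  by rewrite sum_nat_const leq_mul2r subset_leq_card ?orbT ?subsetDl.
have E4 := ecount_k_upper reg k D sY.
rewrite -(ler_pM2l q0) -(ler_pM2l Y0).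
have : ((ecount f Y X)%:R <= (ecount f Y D)%:R + (ecount f (X :\: D) Y)%:R :> R)%R.
  by rewrite -natrD ler_nat.
move: E1 E3 E4 mX. lra.
Qed.

(** By regularity [s] such vertices could not send so many edges into the small set [used]. *)
Lemma few_crowded (used : {set T}) : (#|used|%:R <= bx / 8)%R ->
  #|[set w in X | (d / 2 <= (deg f w used)%:R)%R]| < s.
Proof.
move=> cu; rewrite ltnNge; apply/negP=> sV.
have := @neighbourhood_large _ _ _ _ _ _ s0 reg k _ used (d / 2)%R sV.
have -> : (d / 2 = q * (bx / 2))%R by rewrite mulrA.
rewrite ler_pM2l // natrD => H.
have : (bx / 2 <= #|used|%:R + s%:R)%R.
  by apply: H => y; rewrite inE => /andP[].
have : (0 <= w0%:R :> R)%R by [].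
move: cu sbx.
have : (1 <= s%:R :> R)%R by rewrite ler1n.
lra.
Qed.

(** The invariant under which a chain that ends in [x] can be continued. *)
Definition free_end (used : {set T}) x := (d / 4 <= (deg f x (X :\: used))%:R)%R.

(* The only obstruction to growing a chain in colour [k] is a large set without
   edges of this colour. *)
Definition sparse_spot := exists D' : {set T}, [/\ D' \subset X,
  (bx / 4 <= #|D'|%:R)%R & forall a b, a \in D' -> b \in D' -> ~~ f a b].

Lemma big_nbrs x Y m : m <= deg f x Y -> exists Z : {set T},
  [/\ Z \subset Y, #|Z| = m & forall z, z \in Z -> f x z].
Proof.
rewrite degE => mY.
have : 0 < #|[set Z : {set T} | (Z \subset [set y in Y | f x y]) && (#|Z| == m)]|.
  by rewrite cards_draws bin_gt0.
rewrite card_gt0 => /set0Pn[Z]; rewrite inE => /andP[ZY /eqP cZ].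
exists Z; split=> //; last by move=> z /(subsetP ZY); rewrite inE => /andP[].
by apply/subsetP=> z /(subsetP ZY); rewrite inE => /andP[].
Qed.

(** Among the free neighbours of [x] pick [w0] that share a further neighbour [c]. All of this set
    [Y] is joined to both [x] and [c], so with [gy], [gz], [gu] in [Y] a gadget only needs an edge
    [a b] whose ends have neighbours in [Y]. If the many candidates span no such edge, they form a
    sparse spot. *)
Lemma extend_chain (used : {set T}) x : (#|used|%:R <= bx / 8)%R ->
  free_end used x ->
  sparse_spot \/ exists g, [/\ hooked f x g, uniq (full g),
    {subset full g <= X :\: used} &
    free_end (used :|: [set z in full g]) (gb g)].
Proof.
move=> cu; rewrite /free_end => fx.
set Y0 := [set y in X :\: used | f x y].
have cY0 : (d / 4 <= #|Y0|%:R)%R by rewrite -degE.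
have sY0 : s <= #|Y0| by rewrite -(ler_nat R); apply: le_trans cY0.
have Y0X : Y0 \subset X by apply/subsetP=> y; rewrite !inE => /andP[/andP[]].
have dpos : (0 < d)%R by apply: lt_le_trans d24.
have D0 := @popular Y0 w0 sY0 Y0X.
have {}D0 : (bx / 2 <= (#|[set w in X | (w0 <= deg f w Y0)%N]| + s)%:R)%R.
  apply: D0; apply: le_trans w0X _.
  by have := ler_wpM2r (ltW dpos) cY0; lra.
have [c cD cu'] : exists2 c, c \in [set w in X | (w0 <= deg f w Y0)%N] & c \notin used.
  apply/subsetPn; apply/negP=> /subset_leq_card; rewrite -(ler_nat R) => H.
  move: D0 cu sbx H; rewrite !natrD.
  have : (0 <= w0%:R :> R)%R by [].
  have : (1 <= s%:R :> R)%R by rewrite ler1n.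
  lra.
move: cD; rewrite inE => /andP[cX /big_nbrs[Y [YY0 cY fcY]]].
have YX := subset_trans YY0 Y0X.
have YP y : y \in Y -> [/\ y \in X, y \notin used, f x y & f c y].
  move=> yY; have := subsetP YY0 _ yY; rewrite !inE => /andP[/andP[yu yX] fxy].
  by split=> //; apply: fcY.
(* Three neighbours, because [gu] must differ from both [gy] and [gz]. *)
have D1 : (bx / 2 <= (#|[set w in X | (3 <= deg f w Y)%N]| + s)%:R)%R.
  apply: popular; [by rewrite cY|by []|rewrite cY].
  by rewrite ler_pdivlMr ?ltr0n // mulrAC -natrM.
(* Excluding [V] keeps enough free neighbours at the new end [b]; the six vertices of the gadget
   itself cost at most [d / 4], by [d24]. *)
set V := [set w in X | (d / 2 <= (deg f w used)%:R)%R].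
have cV : #|V| < s by apply: few_crowded.
set D' := [set w in X | (3 <= deg f w Y)%N] :\: (used :|: V :|: Y :|: [set c]).
have cD' : (bx / 4 <= #|D'|%:R)%R.
  have : #|[set w in X | (3 <= deg f w Y)%N]| <= #|D'| + (#|used| + s + w0 + 1).
    rewrite -(cardsID (used :|: V :|: Y :|: [set c])) addnC leq_add2l.
    apply: leq_trans (subset_leq_card (subsetIr _ _)) _.
    have c1 := (leq_card_setU (used :|: V :|: Y) [set c]).1.
    have c2 := (leq_card_setU (used :|: V) Y).1.
    have c3 := (leq_card_setU used V).1.
    move: c1 c2 c3 cV; rewrite cards1 cY.
    move: #|used :|: V :|: Y :|: [set c]| => x4; move: #|used :|: V :|: Y| => x3.
    by move: #|used :|: V| #|used| #|V|; clear; lia.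
  rewrite -(ler_nat R) !natrD; move: D1 cu sbx; rewrite !natrD; lra.
have [/existsP[a /existsP[b /and3P[aD bD fab]]]|none] :=
    boolP [exists a, exists b, [&& a \in D', b \in D' & f a b]]; last first.
  left; exists D'; split=> //.
    by apply/subsetP=> w; rewrite !inE => /and3P[].
  move=> a b aD bD; apply: contraNN none => fab.
  by apply/existsP; exists a; apply/existsP; exists b; rewrite aD bD.
right.
have D'P w : w \in D' ->
    [/\ w \in X, (3 <= deg f w Y)%N, w \notin used, w \notin V & (w \notin Y) && (w != c)].
  rewrite !in_setD !in_setU !inE !negb_or => /andP[/andP[/andP[/andP[-> ->] ->] ->] /andP[-> ->]] //.
have [aX a3 au _ /andP[aY ac]] := D'P _ aD.
have [bX b3 bu bV /andP[bY bc]] := D'P _ bD.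
have [Za [ZaY cZa faZ]] := big_nbrs a3.
have [Zb [ZbY cZb fbZ]] := big_nbrs b3.
have [y1 y1Z] : exists y, y \in Za by apply/set0Pn; rewrite -card_gt0 cZa.
have [y2] : exists y, y \in Za :\ y1.
  apply/set0Pn; rewrite -card_gt0; move: (cardsD1 y1 Za); rewrite y1Z cZa.
  by case: #|Za :\ y1|.
rewrite !inE => /andP[y21 y2Z].
have [u] : exists u, u \in Zb :\: [set y1; y2].
  apply/set0Pn; rewrite -card_gt0.
  have := cardsID [set y1; y2] Zb; rewrite cZb => H.
  have : #|Zb :&: [set y1; y2]| <= 2.
    by apply: leq_trans (subset_leq_card (subsetIr _ _)) _; rewrite cards2; case: eqP.
  by move: H; move: #|_ :&: _| #|_ :\: _|; clear; lia.
rewrite !inE negb_or => /andP[/andP[u1 u2] uZ].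
have [y1X y1u fxy1 fcy1] := YP _ (subsetP ZaY _ y1Z).
have [y2X y2u fxy2 fcy2] := YP _ (subsetP ZaY _ y2Z).
have [uX uu fxu fcu] := YP _ (subsetP ZbY _ uZ).
have fay1 := faZ _ y1Z; have fay2 := faZ _ y2Z; have fbu := fbZ _ uZ.
have neq v w : f v w -> v != w by apply: contraTneq => ->; rewrite e_irr.
have notY v w : v \in Y -> w \notin Y -> v != w by move=> vY; apply: contraNneq => <-.
have y1Y := subsetP ZaY _ y1Z; have y2Y := subsetP ZaY _ y2Z; have uY := subsetP ZbY _ uZ.
have cNY : c \notin Y by apply/negP=> /fcY; rewrite e_irr.
exists (Gadget y1 a y2 c u b); split.
- rewrite /hooked /= fxy1 fab fcu e_sym fay1 fay2 [f y2 c]e_sym fcy2 [f u b]e_sym fbu.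
  by rewrite [f y1 c]e_sym fcy1 [f y2 a]e_sym fay2.
- rewrite /full /= !inE !negb_or !andbT.
  rewrite (notY y1 a) // [y1 == y2]eq_sym y21 (notY y1 c) // [y1 == u]eq_sym u1 (notY y1 b) //.
  rewrite [a == y2]eq_sym (notY y2 a) // ac [a == u]eq_sym (notY u a) // (neq a b) //.
  rewrite (notY y2 c) // [y2 == u]eq_sym u2 (notY y2 b) //.
  by rewrite [c == u]eq_sym (notY u c) // [c == b]eq_sym bc (notY u b).
- move=> z; rewrite /full !inE => /or4P[|||/or3P[]] /eqP->; rewrite ?y1X ?y1u ?aX ?au ?y2X ?y2u //.
  + by rewrite cX cu'.
  + by rewrite uX uu.
  + by rewrite bX bu.
- rewrite /=; set Q := [set z in _].
  have cQ : #|Q| <= 6 by rewrite cardsE; apply: leq_trans (card_size _) _.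
  have : deg f b X <= deg f b (X :\: (used :|: Q)) + (deg f b used + 6).
    apply: leq_trans (_ : _ <= deg f b (X :\: (used :|: Q)) + (deg f b used + deg f b Q)) _.
      rewrite -leq_subLR; apply: leq_trans (degUle _ _ _ _).
      rewrite leq_subLR; apply: leq_trans (degUle _ _ _ _); apply: deg_mono.
      by apply/subsetP=> z zX; rewrite !in_setU !in_setD in_setU zX andbT; case: (z \in used); case: (z \in Q).
    by rewrite !leq_add2l; apply: leq_trans (deg_card _ _ _) cQ.
  rewrite -(ler_nat R) !natrD => H.
  have := dX bX; move: bV; rewrite inE bX /= -ltNge.
  move: H d24; lra.
Qed.

Lemma build_chain G (used : {set T}) x :
  ((#|used| + 6 * G)%:R <= bx / 8)%R -> free_end used x ->
  sparse_spot \/ exists gs, [/\ size gs = G, chain f x gs, uniq (verts gs) &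
    {subset verts gs <= X :\: used}].
Proof.
elim: G used x => [|G IHG] used x cu fx; first by right; exists [::].
have cu1 : (#|used|%:R <= bx / 8)%R.
  by apply: le_trans cu; rewrite ler_nat leq_addr.
case: (extend_chain cu1 fx) => [|[g [hg ug sg fg]]]; first by left.
have cu2 : ((#|used :|: [set z in full g]| + 6 * G)%:R <= bx / 8)%R.
  apply: le_trans cu; rewrite ler_nat mulnS addnA leq_add2r.
  rewrite (leq_trans (leq_card_setU _ _).1) // leq_add2l cardsE.
  exact: (leq_trans (card_size _)).
case: (IHG _ _ cu2 fg) => [|[gs [sz ch uv sv]]]; [by left|right].
exists (g :: gs); split.
- by rewrite /= sz.
- by rewrite /= hg ch.
- rewrite verts_cons cat_uniq ug uv andbT /=; apply/hasPn=> z /sv.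
  by rewrite !in_setD in_setU inE negb_or => /andP[/andP[]].
- move=> z; rewrite verts_cons mem_cat => /orP[/sg //|/sv].
  by rewrite !in_setD in_setU negb_or => /andP[/andP[-> _] ->].
Qed.

End Extend.

Section Close.
Variables (R : realFieldType) (T : finType) (r : nat) (e : 'I_r -> rel T).
Hypothesis e_sym : forall k, symmetric (e k).
Hypothesis e_irr : forall k, irreflexive (e k).

Definition absorber (C U : {set T}) : Prop :=
  U \subset C /\ forall U' : {set T}, U' \subset U -> cpart e (C :\: U') 1.

Lemma pigeonhole_sets n (X : {set T}) (M : 'I_n -> {set T}) :
  (forall j, M j \subset X) -> #|X| < \sum_j #|M j| ->
  exists (i j : 'I_n) z, [/\ (i < j)%N, z \in M i & z \in M j].
Proof.
move=> MX lt; suff [i [j [z [ij zi zj]]]] : exists (i j : 'I_n) z, [/\ i != j, z \in M i & z \in M j].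
  have [lij|lji|/val_inj eij] := ltngtP i j; first by exists i, j, z.
    by exists j, i, z.
  by rewrite eij eqxx in ij.
have [/existsP[z /card_gt1P[i [j [zi zj ij]]]]|/existsPn none] :=
    boolP [exists z, 1 < #|[set j | z \in M j]|].
  by exists i, j, z; split=> //; [move: zi|move: zj]; rewrite inE.
exfalso; move: lt; apply/negP; rewrite -leqNgt.
have -> : \sum_j #|M j| = \sum_(z in X) #|[set j | z \in M j]|.
  transitivity (\sum_j \sum_(z in X) (z \in M j : nat)).
    apply: eq_bigr => j _; rewrite -sum1_card [LHS]big_mkcond [RHS]big_mkcond /=.
    by apply: eq_bigr => z _; case: ifP => [/(subsetP (MX j))->|] //; case: ifP.
  rewrite exchange_big; apply: eq_bigr => z _; rewrite -sum1_card [RHS]big_mkcond.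
  by apply: eq_bigr => j _; rewrite inE; case: ifP.
rewrite -sum1_card; apply: leq_sum => z _; by rewrite leqNgt none.
Qed.

(** The vertex [z] closes the chain. Leaving out vertices [gu] merely switches their gadgets to the
    bypass, which has the same ends. *)
Lemma chain_absorber k (z y : T) gs :
  chain (e k) y gs -> uniq (z :: y :: verts gs) -> e k z y ->
  e k (last y (map (@gb T) gs)) z ->
  absorber ([set z; y] :|: [set v in verts gs]) [set v in map (@gu T) gs].
Proof.
move=> ch; rewrite [uniq _]/= => /and3P[]; rewrite inE negb_or => /andP[zy zv] yv uv ezy elz; split.
  by apply/subsetP=> v; rewrite !inE => /verts_gu->; rewrite orbT.
move=> U' U'U; have sU' : {subset U' <= map (@gu T) gs}.
  by move=> v /(subsetP U'U); rewrite inE.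
have pr := route_perm uv sU'.
have [rp rl] := route_path U' ch.
have mr v : v \in route U' gs = (v \notin U') && (v \in verts gs).
  by rewrite (perm_mem pr) mem_filter.
have -> : ([set z; y] :|: [set v in verts gs]) :\: U' = [set v in z :: y :: route U' gs].
  apply/setP=> v; rewrite !inE mr.
  case vU: (v \in U') => //=; last by rewrite orbA.
  have vv : v \in verts gs by apply: verts_gu (sU' _ vU).
  rewrite orbF; apply/esym/norP; split; apply: contraTneq vv => ->//.
apply: (@cpart_point _ _ _ k); split.
  rewrite /= inE negb_or zy !mr (negPf zv) (negPf yv) !andbF /=.
  by rewrite (perm_uniq pr) filter_uniq.
by right; rewrite /= rcons_path ezy /= rp rl.
Qed.

Variables (q : R) (s : nat).
Hypothesis s0 : 0 < s.
Hypothesis q0 : (0 < q)%R.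
Hypothesis reg : upper_regular e q s.
Variables (k : 'I_r) (X : {set T}) (bx : R) (w0 h n : nat).
Local Notation f := (e k).
Local Notation d := (q * bx)%R.
Hypothesis dX : forall x, x \in X -> (d <= (deg f x X)%:R)%R.
Hypothesis w0X : (w0%:R * #|X|%:R <= d * d / 8)%R.
Hypothesis w3X : (6 * #|X|%:R <= w0%:R * d)%R.
Hypothesis sw0 : s <= w0.
Hypothesis sbx : (2 * s%:R + w0%:R + 1 <= bx / 8)%R.
Hypothesis sd : (s%:R <= d / 4)%R.
Hypothesis d24 : (24 <= d)%R.
Hypothesis nX : (#|X|%:R < n%:R * (bx / 4))%R.
Hypothesis hbx : (1 + 6 * (n%:R * (h%:R + 2 * s%:R)) <= bx / 8)%R.

Lemma spot_or_absorber : X != set0 ->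
  sparse_spot e k X bx \/
  exists C U : {set T}, [/\ C \subset X, absorber C U & h <= #|U|].
Proof.
case/set0Pn=> x0 x0X; pose L := h + 2 * s; pose G := n * L.
have hG : ((1 + 6 * G)%:R <= bx / 8)%R by rewrite /G /L natrD !natrM natrD natrM.
have f0 : free_end e q k X bx [set x0] x0.
  rewrite /free_end; apply: le_trans (_ : (deg f x0 X)%:R <= _)%R.
    apply: le_trans (dX x0X); move: d24; lra.
  rewrite ler_nat !degE; apply/subset_leq_card/subsetP=> y.
  rewrite !inE => /andP[yX fy]; rewrite yX fy !andbT.
  by apply: contraTneq fy => ->; rewrite e_irr.
have c0 : ((#|[set x0]| + 6 * G)%:R <= bx / 8)%R by rewrite cards1.
have [|[gs [sz ch uv sv]]] :=
  build_chain e_sym e_irr s0 q0 reg dX w0X w3X sw0 sbx sd d24 c0 f0; first by left.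
right.
pose used := x0 |: [set v in verts gs].
have cused : (#|used|%:R <= bx / 8)%R.
  apply: le_trans hG; rewrite ler_nat (leq_trans (leq_card_setU _ _).1) //.
  by rewrite cards1 leq_add2l cardsE (leq_trans (card_size _)) // size_verts sz.
pose ends := map (@gb T) gs.
have uends : uniq ends by apply: subseq_uniq uv; apply: subseq_gb.
have szE : size ends = G by rewrite size_map.
pose V := [set w in X | (d / 2 <= (deg f w used)%:R)%R].
have cV : #|V| < s by apply: (few_crowded s0 q0 reg k X sbx cused).
(* Of [2s] ends fewer than [s] are crowded, so at least [s] remain for regularity; the other [h]
   positions of the block keep the two chosen ends far apart. *)
pose blk (j : 'I_n) := take (2 * s) (drop (j * L) ends).
pose Tj (j : 'I_n) := [set x in blk j] :\: V.
pose M (j : 'I_n) := [set z in X :\: used | [exists y in Tj j, f y z]].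
have szb j : size (blk j) = 2 * s.
  rewrite size_take_min size_drop szE; apply/minn_idPl.
  rewrite leq_subRL; last by rewrite leq_mul2r (ltnW (ltn_ord j)) orbT.
  apply: (@leq_trans (j.+1 * L)); last by rewrite leq_mul2r ltn_ord orbT.
  by rewrite mulSn addnC leq_add2r leq_addl.
have cT j : s <= #|Tj j|.
  have := cardsID V [set x in blk j].
  have -> : #|[set x in blk j]| = 2 * s.
    by rewrite cardsE (card_uniqP _) ?szb // take_uniq // drop_uniq.
  have := subset_leq_card (subsetIr [set x in blk j] V).
  rewrite -/(Tj j); move: cV; move: #|V| #|_ :&: _| #|Tj j|; clear; lia.
have endX y : y \in ends -> y \in X.
  by move/verts_gb/sv; rewrite inE => /andP[].
have blkE j y : y \in blk j -> y \in ends by move/mem_take/mem_drop.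
have cM j : (bx / 4 <= #|M j|%:R)%R.
  have := @neighbourhood_large _ _ _ _ _ _ s0 reg k _ (M j) (d / 2)%R (cT j).
  have -> : (d / 2 = q * (bx / 2))%R by rewrite mulrA.
  rewrite ler_pM2l // natrD => H.
  have : (bx / 2 <= #|M j|%:R + s%:R)%R.
    apply: H => y yT; move: (yT); rewrite !inE => /andP[yV /blkE/endX yX].
    move: yV; rewrite yX /= -ltNge => yV.
    have : deg f y X <= deg f y (M j) + deg f y used.
      apply: leq_trans (degUle _ _ _ _); rewrite !degE; apply/subset_leq_card/subsetP=> z.
      rewrite [z \in _]inE => /andP[zX fyz]; rewrite inE fyz andbT in_setU.
      case zu: (z \in used); rewrite ?orbT ?orbF // inE in_setD zu zX.
      by apply/existsP; exists y; rewrite yT.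
    rewrite -(ler_nat R) natrD => H1; have := dX yX; rewrite mulrA; move: H1 yV; lra.
  have : (0 <= w0%:R :> R)%R by [].
  have : (0 <= s%:R :> R)%R by [].
  move: sbx; lra.
have [i [j [z [ij zi zj]]]] : exists (i j : 'I_n) z, [/\ (i < j)%N, z \in M i & z \in M j].
  apply: (@pigeonhole_sets _ X); first by move=> j; apply/subsetP=> x; rewrite !inE => /andP[/andP[]].
  rewrite -(ltr_nat R); apply: lt_le_trans nX _; rewrite natr_sum.
  rewrite mulr_natl -[X in (_ *+ X <= _)%R]card_ord -sumr_const.
  by apply: ler_sum => l _.
have Mend l : z \in M l -> exists m, [/\ l * L <= m < l * L + 2 * s, m < G & f (nth x0 ends m) z].
  rewrite !inE => /andP[_ /existsP[y /andP[]]]; rewrite !inE => /andP[_ yb] fyz.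
  have := yb => /(nthP x0)[a]; rewrite szb => aL ya.
  exists (l * L + a); split.
  - by rewrite leq_addr ltn_add2l.
  - rewrite -szE; have := yb; rewrite -index_mem => ib.
    have : l * L + 2 * s <= size ends.
      rewrite szE; apply: (@leq_trans (l.+1 * L)); last by rewrite leq_mul2r ltn_ord orbT.
      by rewrite mulSn addnC leq_add2r leq_addl.
    by apply: leq_trans; rewrite ltn_add2l.
  - by move: ya; rewrite nth_take // nth_drop => ->.
have zX : z \in X by move: zi; rewrite !inE => /andP[/andP[]].
have zN : z \notin used by move: zi; rewrite in_set in_setD => /andP[/andP[]].
have [a [/andP[a1 a2] aG fa]] := Mend i zi.
have [b [/andP[b1 b2] bG fb]] := Mend j zj.
have hab : a + h < b.
  apply: leq_trans b1; apply: (@leq_trans (i.+1 * L)); last by rewrite leq_mul2r ij orbT.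
  by rewrite mulSn /L; move: a2; rewrite -/L; move: (i * L); clear; lia.
have ab : a < b by apply: leq_ltn_trans hab; apply: leq_addr.
pose gs1 := take a.+1 gs; pose gs2 := take (b - a) (drop a.+1 gs).
have gsE : gs = gs1 ++ gs2 ++ drop (b - a) (drop a.+1 gs) by rewrite !cat_take_drop.
pose y := nth x0 ends a.
have l1 : last x0 (map (@gb T) gs1) = y.
  rewrite map_take -/ends (last_nth x0) size_take_min szE (minn_idPl aG) /=.
  by rewrite nth_take.
have sz2 : size gs2 = b - a.
  rewrite size_take_min size_drop sz; apply/minn_idPl.
  by move: bG ab; clear; lia.
have l2 : last y (map (@gb T) gs2) = nth x0 ends b.
  rewrite map_take map_drop -/ends (last_nth x0) size_take_min size_drop szE.
  rewrite (minn_idPl _); last by move: bG ab; clear; lia.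
  have -> : b - a = (b - a).-1.+1 by move: ab; clear; lia.
  rewrite /= nth_take // nth_drop; congr nth; by move: ab; clear; lia.
have ch2 : chain f y gs2.
  by move: ch; rewrite gsE !chain_cat l1 => /and3P[].
have vsub : {subset verts gs2 <= verts gs}.
  by move=> v v2; rewrite gsE !verts_cat !mem_cat v2 orbT.
have y1 : y \in verts gs1.
  apply: verts_gb; rewrite -l1.
  have : 0 < size gs1 by rewrite size_take_min sz (minn_idPl aG).
  by case: (gs1) => // g l _; rewrite /= mem_last.
have u2 : uniq (z :: y :: verts gs2).
  move: zN; rewrite in_setU1 inE negb_or => /andP[_ zv].
  rewrite /= inE negb_or; apply/and3P; split.
  - apply/andP; split; last by apply: contra zv => /vsub.
    apply: contraNneq zv => ->; by rewrite gsE !verts_cat mem_cat y1.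
  - move: uv; rewrite gsE !verts_cat cat_uniq => /and3P[_ /hasPn nh _].
    by apply/negP=> yv; have := nh y; rewrite mem_cat yv y1 => /(_ isT).
  - by move: uv; rewrite gsE !verts_cat !cat_uniq => /and5P[_ _ ->].
have fzy : f z y by rewrite e_sym.
have fl : f (last y (map (@gb T) gs2)) z by rewrite l2.
exists ([set z; y] :|: [set v in verts gs2]), [set v in map (@gu T) gs2]; split.
- rewrite !subUset !sub1set zX /=; apply/andP; split.
    by apply: endX; rewrite mem_nth // szE.
  by apply/subsetP=> v; rewrite inE => /vsub/sv; rewrite inE => /andP[].
- exact: chain_absorber ch2 u2 fzy fl.
- rewrite cardsE (card_uniqP _); first by rewrite size_map sz2; move: hab; clear; lia.
  by apply: subseq_uniq (subseq_gu gs2) _; move: u2 => /= /and3P[].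
Qed.

End Close.

Section AbsorberExists.
Variables (R : realFieldType) (T : finType) (r : nat) (e : 'I_r -> rel T).
Hypothesis e_sym : forall k, symmetric (e k).
Hypothesis e_irr : forall k, irreflexive (e k).
Hypothesis r0 : 0 < r.
Variables (q kap b xmin : R) (s n0 w0 h n : nat) (V0 : {set T}).
Hypothesis s0 : 0 < s.
Hypothesis q0 : (0 < q)%R.
Hypothesis b0 : (0 < b)%R.
Hypothesis b1 : (b <= 1)%R.
Hypothesis kb : (2 * r%:R * (q * b) <= kap)%R.
Hypothesis reg : upper_regular e q s.
Hypothesis low : lower_dense e kap n0 V0.
Hypothesis c1 : (w0%:R <= q * b * (q * b) * xmin / 8)%R.
Hypothesis c2 : (6 <= w0%:R * (q * b))%R.
Hypothesis c3 : s <= w0.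
Hypothesis c4 : (2 * s%:R + w0%:R + 1 <= b * xmin / 8)%R.
Hypothesis c5 : (s%:R <= q * b * xmin / 4)%R.
Hypothesis c6 : (24 <= q * b * xmin)%R.
Hypothesis c7 : (4 < n%:R * b)%R.
Hypothesis c8 : (1 + 6 * (n%:R * (h%:R + 2 * s%:R)) <= b * xmin / 8)%R.
Hypothesis c9 : (n0%:R <= b * xmin / 4)%R.

(* [J] contains the colours still present in [X]; each failure shrinks [X] by the
   factor [b / 4] and [J] by one colour. *)
Lemma absorber_rec j (J : {set 'I_r}) (X : {set T}) : #|J| = j -> X \subset V0 ->
  (forall k x y, x \in X -> y \in X -> e k x y -> k \in J) ->
  (xmin * (4 / b) ^+ j <= 4 / b * #|X|%:R)%R ->
  exists C U : {set T}, [/\ C \subset X, absorber e C U & h <= #|U|].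
Proof.
have qb0 : (0 < q * b)%R by rewrite mulr_gt0.
have xm0 : (0 < xmin)%R.
  by rewrite -(pmulr_rgt0 _ qb0); apply: lt_le_trans c6.
have B4 : (4 <= 4 / b)%R by rewrite ler_pdivlMr // ler_piMr.
have B0 : (0 < 4 / b)%R by apply: lt_le_trans B4.
elim: j J X => [|j IHj] J X cJ XV colJ cX.
  (* No colour is left, so [X] spans no edge, although it still has at least [n0] vertices and must
     be dense. *)
  exfalso; have cX0 : (b * xmin / 4 <= #|X|%:R)%R.
    move: cX; rewrite expr0 mulr1 mulrAC ler_pdivlMr // => cX.
    rewrite ler_pdivrMr //; move: cX; lra.
  have nX : n0 <= #|X| by rewrite -(ler_nat R); apply: le_trans cX0.
  have Xpos : (0 < #|X|%:R :> R)%R by apply: lt_le_trans cX0; rewrite divr_gt0 ?mulr_gt0 ?ltr0n.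
  have := low XV nX; rewrite /ecount big1 ?lt_geF ?mulr_gt0 ?exprn_gt0 //.
    apply: lt_le_trans kb; rewrite !mulr_gt0 ?ltr0n //.
  move=> x xX; rewrite /deg big1 // => y yX.
  case: (boolP (adj e x y)) => // /existsP[k /(colJ k x y xX yX)].
  by move/eqP: cJ; rewrite cards_eq0 => /eqP->; rewrite inE.
have xX : (xmin <= #|X|%:R)%R.
  rewrite -(ler_pM2l B0); apply: le_trans cX.
  rewrite mulrC ler_wpM2l ?(ltW xm0) // exprS ler_peMr ?(ltW B0) //.
  by apply: exprn_ege1; move: B4; lra.
have Xpos : (0 < #|X|%:R :> R)%R by apply: lt_le_trans xX.
have X0 : X != set0 by rewrite -card_gt0 -(ltr_nat R).
have mon (a : R) : (0 <= a)%R -> (a * xmin <= a * #|X|%:R)%R by move=> a0; rewrite ler_wpM2l.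
have nX : n0 <= #|X|.
  rewrite -(ler_nat R); apply: le_trans c9 _.
  have := mon b (ltW b0); have : (b * #|X|%:R <= #|X|%:R)%R by rewrite ler_piMl.
  move: Xpos; lra.
have EX := low XV nX.
have d0 : (0 < q * (b * #|X|%:R))%R by rewrite !mulr_gt0.
have kd : (2 * r%:R * (q * (b * #|X|%:R)) <= kap * #|X|%:R)%R.
  by rewrite [(q * _)%R]mulrA mulrA ler_wpM2r // ltW.
have [k [X' [X'X X'0 dX']]] := dense_colour e_sym e_irr r0 d0 X0 kd EX.
have cX' : (#|X'|%:R <= #|X|%:R :> R)%R by rewrite ler_nat subset_leq_card.
have mqb := mon _ (ltW qb0); have mb := mon _ (ltW b0).
have h1 : (w0%:R * #|X'|%:R <= q * (b * #|X|%:R) * (q * (b * #|X|%:R)) / 8)%R.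
  apply: (@le_trans _ _ (w0%:R * #|X|%:R)%R); first by rewrite ler_wpM2l.
  have := ler_wpM2r (ltW Xpos) c1.
  have := ler_wpM2r (ltW Xpos) (mon (q * b * (q * b))%R (ltW (mulr_gt0 qb0 qb0))).
  lra.
have h2 : (6 * #|X'|%:R <= w0%:R * (q * (b * #|X|%:R)))%R.
  apply: (@le_trans _ _ (6 * #|X|%:R)%R); first by rewrite ler_pM2l.
  have := ler_wpM2r (ltW Xpos) c2; lra.
have h4 : (2 * s%:R + w0%:R + 1 <= b * #|X|%:R / 8)%R by move: c4 mb; lra.
have h5 : (s%:R <= q * (b * #|X|%:R) / 4)%R by move: c5 mqb; lra.
have h6 : (24 <= q * (b * #|X|%:R))%R by move: c6 mqb; lra.
have h7 : (#|X'|%:R < n%:R * (b * #|X|%:R / 4))%R.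
  apply: le_lt_trans cX' _; have := c7; rewrite -(ltr_pM2r Xpos); lra.
have h8 : (1 + 6 * (n%:R * (h%:R + 2 * s%:R)) <= b * #|X|%:R / 8)%R.
  by move: c8 mb; lra.
have := spot_or_absorber e_sym e_irr s0 q0 reg dX' h1 h2 c3 h4 h5 h6 h7 h8 X'0.
case=> [[D [DX' cD nD]]|[C [U [CX' aCU hU]]]]; last first.
  by exists C, U; split=> //; apply: subset_trans X'X.
have kJ : k \in J.
  case/set0Pn: X'0 => x xX'; have := lt_le_trans d0 (dX' x xX').
  rewrite ltr0n degE card_gt0 => /set0Pn[y]; rewrite inE => /andP[yX'].
  by apply: colJ; apply: (subsetP X'X).
have DX := subset_trans DX' X'X.
have [C [U [CD aCU hU]]] : exists C U : {set T}, [/\ C \subset D, absorber e C U & h <= #|U|].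
  apply: (IHj (J :\ k)).
  - by move: (cardsD1 k J); rewrite kJ cJ => -[].
  - exact: subset_trans DX XV.
  - move=> k' x y xD yD exy; rewrite in_setD1 (colJ k' x y) ?(subsetP DX) // andbT.
    by apply: contraTneq exy => ->; apply: nD.
  - apply: (@le_trans _ _ #|X|%:R)%R.
      by move: cX; rewrite exprS mulrCA ler_pM2l.
    rewrite mulrAC ler_pdivlMr //; move: cD; lra.
exists C, U; split=> //; exact: subset_trans DX.
Qed.

Lemma absorber_exists :
  (xmin * (4 / b) ^+ r <= 4 / b * #|V0|%:R)%R ->
  exists C U : {set T}, [/\ C \subset V0, absorber e C U & h <= #|U|].
Proof.
move=> cV; apply: (@absorber_rec r setT) => //; first by rewrite cardsT card_ord.
by move=> k x y _ _ _; rewrite inE.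
Qed.

End AbsorberExists.

(** * Graphs of bounded independence number *)

Section BoundedIndependence.
Variables (T : finType) (r : nat) (e : 'I_r -> rel T).
Hypothesis e_sym : forall k, symmetric (e k).
Hypothesis e_irr : forall k, irreflexive (e k).
Hypothesis r0 : 0 < r.

Definition alpha_le a (X : {set T}) : Prop := forall I : {set T}, I \subset X ->
  (forall x y, x \in I -> y \in I -> ~~ adj e x y) -> #|I| <= a.

Lemma alpha_sub a (X Y : {set T}) : Y \subset X -> alpha_le a X -> alpha_le a Y.
Proof. by move=> YX aX I IY; apply: aX; apply: subset_trans YX. Qed.

Lemma adj_irr : irreflexive (adj e).
Proof. by move=> x; apply/existsP=> -[k]; rewrite e_irr. Qed.

(** A maximal independent set dominates [X], so at most [a] closed neighbourhoods cover [X]. *)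
Lemma alpha_degree a (X : {set T}) : alpha_le a X -> X != set0 ->
  exists2 x, x \in X & #|X| <= a * (deg (adj e) x X).+1.
Proof.
move=> aX X0.
pose ind (I : {set T}) := (I \subset X) && [forall x in I, forall y in I, ~~ adj e x y].
have ind0 : ind set0.
  by rewrite /ind sub0set; apply/forallP=> x; rewrite inE.
have [I /maxsetP[/andP[IX /forall_inP indI] maxI] _] := maxset_exists ind0.
have dom x : x \in X -> exists2 i, i \in I & (x == i) || adj e i x.
  move=> xX; have [xI|xI] := boolP (x \in I); first by exists x; rewrite ?eqxx.
  have [/existsP[i /andP[iI ix]]|/existsPn none] := boolP [exists i, (i \in I) && adj e i x].
    by exists i => //; rewrite ix orbT.
  have : x |: I = I.
    apply: maxI; last by apply: subsetUr.
    rewrite /ind subUset sub1set xX IX /=.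
    have nx y : y \in I -> ~~ adj e y x by move=> yI; have := none y; rewrite yI.
    apply/forall_inP=> y; rewrite !inE => /orP[/eqP->|yI]; apply/forall_inP=> z;
      rewrite !inE => /orP[/eqP->|zI]; rewrite ?adj_irr ?nx //.
    - by rewrite (adj_sym e_sym) nx.
    - exact: (forall_inP (indI _ yI)).
  by move/setP/(_ x); rewrite !inE eqxx (negPf xI).
case/set0Pn: X0 => x0 x0X; have [i0 i0I _] := dom x0 x0X.
have [m mI maxm] := @arg_maxnP _ i0 (mem I) (fun i => deg (adj e) i X) i0I.
exists m; first exact: (subsetP IX).
have cI : #|I| <= a.
  by apply: aX => // x y xI yI; apply: (forall_inP (indI _ xI)).
apply: (@leq_trans (\sum_(i in I) (deg (adj e) i X).+1)); last first.
  apply: (@leq_trans (\sum_(i in I) (deg (adj e) m X).+1)).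
    by apply: leq_sum => i /maxm; rewrite ltnS.
  by rewrite sum_nat_const leq_mul2r cI orbT.
have -> : \sum_(i in I) (deg (adj e) i X).+1 =
    \sum_(i in I) \sum_(x in X) ((x == i) || adj e i x).
  apply: eq_bigr => i iI; have iX := subsetP IX _ iI.
  rewrite /deg (bigD1 i iX) (bigD1 i iX) /= eqxx adj_irr /= add0n add1n; congr _.+1.
  by apply: eq_bigr => x /andP[_ /negPf->].
rewrite exchange_big /= -sum1_card; apply: leq_sum => x /dom[i iI xi].
by rewrite (bigD1 i) //= xi.
Qed.

(** A weak form of Turan's bound, by deleting a vertex of large degree again and again. *)
Lemma alpha_edges a (X : {set T}) : alpha_le a X ->
  #|X| ^ 2 <= a * ecount (adj e) X X + 2 * a * #|X|.
Proof.
move: {2}(#|X|) (erefl #|X|) => n; elim: n X => [|n IHn] X cX aX; first by rewrite cX.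
have X0 : X != set0 by rewrite -card_gt0 cX.
have [x xX dx] := alpha_degree aX X0.
have cX1 : #|X :\ x| = n by move: (cardsD1 x X); rewrite xX cX => -[].
have := IHn _ cX1 (alpha_sub (subsetDl _ _) aX).
rewrite (ecountD1 (adj_sym e_sym) adj_irr xX) cX1 cX; move: dx; rewrite cX.
move: (ecount _ _ _) (deg _ _ _); clear; nia.
Qed.

(** Every graph is regular with [q = s = 1]. So the tools for pseudorandom graphs also serve for
    dense graphs without randomness, such as the link graphs. *)
Lemma regular_trivial (R : realFieldType) : upper_regular e (1 : R) 1.
Proof.
move=> X Y _; rewrite mul1r -natrM ler_nat; apply: leq_trans (ecount_card _ _ _) _.
by rewrite leq_mul2l leq_addr orbT.
Qed.

Lemma alpha_dense (R : realFieldType) a (V0 : {set T}) : 0 < a -> alpha_le a V0 ->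
  lower_dense e (3 / (4 * a%:R) : R) (8 * a) V0.
Proof.
move=> a0 aV X XV cX; have aR : (0 < a%:R :> R)%R by rewrite ltr0n.
have E0 := alpha_edges (alpha_sub XV aV).
move: E0 cX; rewrite -!(ler_nat R) natrX natrD !natrM => E0 cX.
have X0 : (0 <= #|X|%:R :> R)%R by [].
have E1 := ler_wpM2r X0 cX.
rewrite mulrAC ler_pdivrMr ?mulr_gt0 // expr2.
move: E0 E1; rewrite expr2; lra.
Qed.

(* [a.+1] such vertices have neighbours in at most half of [U], so an independent set
   of them would extend by a vertex of [U]. *)
Lemma low_degree_alpha a (X C U : {set T}) : alpha_le a.+1 X -> C \subset X -> U \subset C ->
  U != set0 ->
  alpha_le a [set x in X :\: C | 2 * a.+1 * deg (adj e) x U < #|U|].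
Proof.
move=> aX CX UC U0 I IZ indI; rewrite leqNgt; apply/negP=> cI.
have IP x : x \in I -> [/\ x \in X, x \notin C & 2 * a.+1 * deg (adj e) x U < #|U|].
  by move/(subsetP IZ); rewrite !inE => /andP[/andP[]].
have IX : I \subset X by apply/subsetP=> x /IP[].
have {}cI : #|I| = a.+1 by apply/eqP; rewrite eqn_leq cI aX.
have [/existsP[v /andP[vU /forall_inP nv]]|/existsPn none] :=
    boolP [exists v, (v \in U) && [forall x in I, ~~ adj e x v]].
  have vC := subsetP UC _ vU.
  have vI : v \notin I by apply/negP=> /IP[_]; rewrite vC.
  suff : #|v |: I| <= a.+1 by rewrite cardsU1 vI cI ltnn.
  apply: aX; first by rewrite subUset sub1set (subsetP CX _ vC).
  move=> x y; rewrite !inE => /orP[/eqP->|xI] /orP[/eqP->|yI]; rewrite ?adj_irr ?nv //.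
    by rewrite (adj_sym e_sym) nv.
  exact: indI.
have : #|U| <= \sum_(x in I) deg (adj e) x U.
  rewrite /deg exchange_big /= -sum1_card; apply: leq_sum => v vU.
  have := none v; rewrite vU /= negb_forall => /existsP[x]; rewrite negb_imply negbK => /andP[xI xv].
  by rewrite (bigD1 x) //= xv.
rewrite -(leq_pmul2l (ltn0Sn (2 * a.+1).-1)) prednK // big_distrr /= => H.
have : \sum_(x in I) 2 * a.+1 * deg (adj e) x U <= \sum_(x in I) #|U|.
  by apply: leq_sum => x /IP[_ _ /ltnW].
rewrite sum_nat_const cI => /(leq_trans H).
have : 0 < #|U| by rewrite card_gt0.
move: #|U|; clear; nia.
Qed.

End BoundedIndependence.

(** The factor by which a set must be reduced before the reservoir of an absorber found in it can
    take over; [A] is the independence number times [r]. *)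
Definition shrink r A := 13500 * A ^ 3 * (11 * A) ^ r.-1.

(** Cycles spent on lowering the independence number by one: [3 A b] in the greedy cover; the rest
    bounds the alternating cycles, the single vertices left over and the case of a small set. *)
Definition stage r b A := 3 * A * b + 72 * A + 8 * A * r + 2 * r + 3.

Definition indep_bound r b a := \sum_(i < a) stage r b (i.+1 * r).

Section CoverBoundedIndependence.
Variables (T : finType) (r : nat) (e : 'I_r -> rel T).
Hypothesis e_sym : forall k, symmetric (e k).
Hypothesis e_irr : forall k, irreflexive (e k).
Hypothesis r0 : 0 < r.

(** With [q = s = 1] and [b = 3 / (8 A)] there is a cycle of at least [3 |X| / (8 A) - 3] vertices,
    and [|X| >= 72 A] turns this into [|X| / (3 A)]. *)
Lemma alpha_large_cycle a (V0 X : {set T}) : 0 < a -> alpha_le e a V0 -> X \subset V0 ->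
  72 * (a * r) <= #|X| ->
  exists C : {set T}, [/\ C \subset X, cpart e C 1 & #|X| <= 3 * (a * r) * #|C|].
Proof.
move=> a0 aV XV; set A := a * r => cX.
have A0 : 0 < A by rewrite muln_gt0 a0.
have [R _] : exists R : realFieldType, True by exists rat.
have aR : (0 < a%:R :> R)%R by rewrite ltr0n.
have rR : (0 < r%:R :> R)%R by rewrite ltr0n.
have AR : (0 < A%:R :> R)%R by rewrite ltr0n.
have AE : (A%:R = a%:R * r%:R :> R)%R by rewrite /A natrM.
have cXR : (72 * A%:R <= #|X|%:R :> R)%R by rewrite -natrM ler_nat.
have X0 : X != set0.
  by rewrite -card_gt0 (leq_trans _ cX) // muln_gt0 A0.
have low := alpha_dense e_sym e_irr R a0 aV.
have cX8 : 8 * a <= #|X|.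
  apply: leq_trans cX; rewrite /A; move: r0; clear; nia.
have b0 : (0 < 3 / (8 * A%:R) :> R)%R by rewrite divr_gt0 // mulr_gt0.
have kb : (2 * r%:R * (1 * (3 / (8 * A%:R))) <= 3 / (4 * a%:R) :> R)%R.
  by rewrite AE mul1r le_eqVlt; apply/orP; left; apply/eqP; field; rewrite !lt0r_neq0.
have s1 : (1%:R <= 1 * (3 / (8 * A%:R)) * #|X|%:R :> R)%R.
  by rewrite mul1r mulrAC ler_pdivlMr ?mulr_gt0 //; move: cXR AR; lra.
have [C [CX cC bC]] := large_mono_cycle e_sym e_irr r0 (ltn0Sn 0) (regular_trivial e R) ltr01 b0 X0 kb (low _ XV cX8) s1.
exists C; split=> //; rewrite -(ler_nat R) natrM natrM.
move: bC; rewrite mulrAC ler_pdivrMr ?mulr_gt0 // natrD natrM; move: cXR AR; nra.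
Qed.

(** The base [11 A] bounds [4 / b], the factor lost with each colour, for [b = 3 / (8 A)];
    [w0 = 16 A] makes [w0 b = 6]. *)
Lemma alpha_absorber a (V0 : {set T}) h : 0 < a -> alpha_le e a V0 ->
  a * r <= h -> 1500 * (a * r) ^ 2 * (h + 2) * (11 * (a * r)) ^ r.-1 <= #|V0| ->
  exists C U : {set T}, [/\ C \subset V0, absorber e C U & h <= #|U|].
Proof.
move=> a0 aV; set A := a * r => Ah cV.
have A0 : 0 < A by rewrite muln_gt0 a0.
have [R _] : exists R : realFieldType, True by exists rat.
have aR : (0 < a%:R :> R)%R by rewrite ltr0n.
have rR : (1 <= r%:R :> R)%R by rewrite ler1n.
have AR : (1 <= A%:R :> R)%R by rewrite ler1n.
have hR : (A%:R <= h%:R :> R)%R by rewrite ler_nat.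
have AE : (A%:R = a%:R * r%:R :> R)%R by rewrite /A natrM.
have Ar : (a%:R <= A%:R :> R)%R by rewrite AE ler_peMr // ltW.
have low := alpha_dense e_sym e_irr R a0 aV.
pose b : R := (3 / (8 * A%:R))%R.
have A80 : (0 < 8 * A%:R :> R)%R by move: AR; lra.
have b0 : (0 < b)%R by rewrite divr_gt0.
have bA : (b * A%:R = 3 / 8)%R by rewrite /b; field; apply: lt0r_neq0; move: AR; lra.
have b1 : (b <= 1)%R by rewrite ler_pdivrMr // mul1r; move: AR; lra.
pose x : R := (1500 * A%:R ^+ 2 * (h%:R + 2))%R.
have bx : (b * x = 1125 / 2 * A%:R * (h%:R + 2))%R.
  rewrite /x expr2 (_ : (b * _ = b * A%:R * (1500 * A%:R * (h%:R + 2)))%R); last by ring.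
  by rewrite bA; field.
have bbx : (b * b * x = 3375 / 16 * (h%:R + 2))%R.
  rewrite -mulrA bx (_ : (b * _ = b * A%:R * (1125 / 2 * (h%:R + 2)))%R); last by ring.
  by rewrite bA; field.
have AA : (A%:R <= A%:R * A%:R :> R)%R by rewrite ler_peMl //; move: AR; lra.
have Ah2 : (A%:R * A%:R <= A%:R * h%:R :> R)%R by rewrite ler_wpM2l //; move: AR; lra.
apply: (@absorber_exists _ _ _ _ e_sym e_irr r0 1%R (3 / (4 * a%:R))%R b x 1 (8 * a) (16 * A) h (11 * A)) => //.
- by rewrite mul1r /b AE le_eqVlt; apply/orP; left; apply/eqP; field;
    rewrite !lt0r_neq0 //; move: rR; lra.
- exact: regular_trivial.
- rewrite !mul1r bbx natrM; move: hR AR; clear -R r0 e_sym e_irr; lra.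
- rewrite !mul1r natrM -mulrA [(A%:R * b)%R]mulrC bA; clear -R r0 e_sym e_irr; lra.
- by rewrite muln_gt0.
- rewrite bx natrM; move: hR AR AA Ah2; clear -R r0 e_sym e_irr; lra.
- rewrite mul1r bx; move: hR AR AA Ah2; clear -R r0 e_sym e_irr; lra.
- rewrite mul1r bx; move: hR AR AA Ah2; clear -R r0 e_sym e_irr; lra.
- rewrite natrM -mulrA [(A%:R * b)%R]mulrC bA; clear -R r0 e_sym e_irr; lra.
- rewrite bx natrM; move: hR AR AA Ah2; clear -R r0 e_sym e_irr; lra.
- rewrite bx natrM; move: hR AR AA Ah2 Ar; clear -R r0 e_sym e_irr; lra.
- have B11 : (4 / b <= 11 * A%:R)%R.
    by rewrite ler_pdivrMr // -mulrA [(A%:R * b)%R]mulrC bA; clear -R r0 e_sym e_irr; lra.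
  have B0 : (0 < 4 / b)%R by rewrite divr_gt0.
  rewrite -(prednK r0) exprS mulrCA ler_pM2l //.
  move: cV; rewrite -(ler_nat R) !natrM !natrX natrM natrD; apply: le_trans.
  apply: ler_pM => //; first by rewrite !mulr_ge0 ?exprn_ge0 // addr_ge0.
    by rewrite exprn_ge0 // ltW.
  - by rewrite /x AE expr2.
  - by apply: lerXn2r => //; rewrite nnegrE ?ltW // mulr_gt0 //; move: AR; clear -R r0 e_sym e_irr; lra.
Qed.

(** Induction on the independence number. The vertices outside the absorber with few neighbours in
    its reservoir have a smaller independence number; the others are reduced greedily to a size that
    alternating cycles through the reservoir can handle. *)
Theorem cover_bounded_independence b a (X : {set T}) : alpha_le e a X ->
  (forall i, 0 < i -> i <= a -> 2 * shrink r (i * r) <= 2 ^ b) ->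
  cpart e X (indep_bound r b a).
Proof.
rewrite /indep_bound; elim: a X => [|a IHa] X aX hb.
  have -> : X = set0; last exact: cpart0.
  apply/eqP; rewrite -subset0; apply/subsetP=> x xX.
  suff : 0 < 0 by [].
  rewrite -{1}(cards1 x); apply: aX; first by rewrite sub1set.
  by move=> y z; rewrite !inE => /eqP-> /eqP->; rewrite (adj_irr e_irr).
rewrite big_ord_recr /=; set A := a.+1 * r.
have A0 : 0 < A by rewrite muln_gt0.
pose P := shrink r A.
have P0 : 0 < P.
  have A11 : 0 < 11 * A by rewrite muln_gt0 A0.
  by rewrite /P /shrink muln_gt0 muln_gt0 !expn_gt0 A0 A11.
have hP : 2 * P <= 2 ^ b by apply: hb.
pose N := #|X|; pose n1 := N %/ P; pose K := 4 * A * r + r + 3; pose nmin := 72 * A + K.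
have NP : N < P * n1.+1 by rewrite mulnC ltn_ceil.
have lc n (V : {set T}) : V \subset X -> 72 * A <= n -> forall Y : {set T}, Y \subset V -> n < #|Y| ->
    exists C : {set T}, [/\ C \subset Y, cpart e C 1 & #|Y| <= 3 * A * #|C|].
  move=> VX nA Y YV nY; apply: (alpha_large_cycle _ aX) => //.
    exact: (subset_trans YV VX).
  by apply: leq_trans nA (ltnW nY).
have M0 : 0 < 3 * A by rewrite muln_gt0.
(* A set too small for an absorber: the greedy cover leaves at most [nmin] vertices, which become
   cycles of size one. *)
have [small|big] := ltnP n1 nmin.
  have cN : #|X| <= 2 ^ b * nmin.
    apply: leq_trans (ltnW NP) (leq_mul _ small).
    by apply: leq_trans hP; rewrite leq_pmull.
  have [Y [YX cY sY]] := greedy_cover (lc nmin X (subxx X) (leq_addr _ _)) (subxx X) M0 cN.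
  apply: (@cpart_le _ _ _ _ (#|Y| + 3 * A * b)); last first.
    exact: cpartD YX (cpart_singles e Y) cY.
  rewrite /stage; move: sY; rewrite /nmin /K.
  by move: #|Y| (\sum_(i < a) _) (3 * A * b); clear; lia.
have n1A : 72 * A <= n1 by apply: leq_trans big; apply: leq_addr.
have n1K : K <= n1 by apply: leq_trans big; apply: leq_addl.
have n10 : 0 < n1 by apply: leq_trans n1K; rewrite /K addnC.
pose h := 4 * A * (n1 + K).
have [C [U [CX aCU hU]]] : exists C U : {set T}, [/\ C \subset X, absorber e C U & h <= #|U|].
  apply: (@alpha_absorber a.+1) => //; rewrite -/A.
    by rewrite /h /K; move: A0 r0; clear; nia.
  apply: (@leq_trans (P * n1)); last by rewrite mulnC leq_trunc_div.
  rewrite /P /shrink [leqRHS]mulnAC leq_mul2r; apply/orP; right.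
  have h2 : h + 2 <= 9 * A * n1.
    rewrite /h; move: n1K n1A n10 A0; rewrite /K; clear; nia.
  apply: leq_trans (leq_mul (leqnn _) h2) _.
  by rewrite (_ : 1500 * A ^ 2 * (9 * A * n1) = 13500 * A ^ 3 * n1) //; ring.
have [UC absCU] := aCU.
have K0 : 0 < K by rewrite /K addnC.
have U0 : U != set0.
  have A4 : 0 < 4 * A by rewrite muln_gt0 A0.
  by rewrite -card_gt0 (leq_trans _ hU) // /h muln_gt0 A4 addn_gt0 n10.
pose Z := [set x in X :\: C | 2 * a.+1 * deg (adj e) x U < #|U|].
have aZ : alpha_le e a Z by apply: low_degree_alpha.
have cZ := IHa Z aZ (fun i i0 ia => hb i i0 (leqW ia)).
pose R' := (X :\: C) :\: Z.
have R'X : R' \subset X by rewrite /R' setDDl subsetDl.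
have cR' : #|R'| <= 2 ^ b * n1.
  apply: leq_trans (subset_leq_card R'X) _; apply: leq_trans (ltnW NP) _.
  apply: (@leq_trans (2 * P * n1)); last by rewrite leq_mul2r hP orbT.
  by rewrite [2 * P]mulnC -mulnA leq_mul2l mul2n -addnn -addn1 leq_add2l n10 orbT.
have [Y [YR cY sY]] := greedy_cover (lc n1 R' R'X n1A) (subxx R') M0 cR'.
have [R _] : exists R : realFieldType, True by exists rat.
have AR : (0 < A%:R :> R)%R by rewrite ltr0n.
have aR : (0 < a.+1%:R :> R)%R by rewrite ltr0n.
have rR : (0 < r%:R :> R)%R by rewrite ltr0n.
have AE : (A%:R = a.+1%:R * r%:R :> R)%R by rewrite /A natrM.
have UR : (0 < #|U|%:R :> R)%R by rewrite ltr0n card_gt0.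
pose u : R := (#|U|%:R)%R.
have dYU : [disjoint Y & U].
  rewrite -setI_eq0; apply/eqP/setP=> x; rewrite in_set0 in_setI; apply/negP=> /andP[xY xU].
  by have := subsetP YR _ xY; rewrite !in_setD (subsetP UC _ xU) /= andbF.
have degY x : x \in Y -> (u / (2 * a.+1%:R) <= (deg (adj e) x U)%:R)%R.
  move/(subsetP YR); rewrite in_setD inE => /andP[nZ xXC].
  move: nZ; rewrite xXC /= -leqNgt -(ler_nat R) !natrM => H.
  by rewrite ler_pdivrMr ?mulr_gt0 // mulrC.
have h1 : (r%:R * (u / (2 * A%:R)) <= u / (2 * a.+1%:R))%R.
  rewrite le_eqVlt AE; apply/orP; left; apply/eqP; move: aR.
  by move: (a.+1%:R : R)%R => v v0; field; rewrite !lt0r_neq0.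
(* [nu = u / (4 A)] is half of the majority degree [u / (2 A)], and [t = 4 A + 1] is the first
   multiplier with [t nu > |U|]. *)
have h2 : (#|U|%:R < (4 * A + 1)%:R * (u / (4 * A%:R)))%R.
  have -> : ((4 * A + 1)%:R * (u / (4 * A%:R)) = u + u / (4 * A%:R))%R.
    by rewrite natrD natrM; field; rewrite lt0r_neq0.
  by rewrite ltrDl divr_gt0 // mulr_gt0.
have h3 : (1 * ((#|Y| + r * (4 * A + 1) + 2)%:R + u / (4 * A%:R)) <= u / (2 * A%:R))%R.
  have -> : (u / (2 * A%:R) = u / (4 * A%:R) + u / (4 * A%:R))%R.
    by field; rewrite lt0r_neq0.
  rewrite mul1r lerD2r ler_pdivlMr ?mulr_gt0 // -natrM -natrM ler_nat.
  apply: leq_trans hU; rewrite /h mulnC leq_mul2l; apply/orP; right.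
  by move: sY; rewrite /K; clear; nia.
have [Lf [Q [LfY QU cov cLf _]]] :=
  majority_cover e_sym r0 (ltn0Sn 0) ltr01 (regular_trivial e R) dYU h1 degY h2 h3.
have ZX : Z \subset X by apply/subsetP=> x; rewrite !inE => /andP[/andP[]].
have i1 (x : T) : (x \in C) ==> (x \in X) by apply/implyP; apply: (subsetP CX).
have i2 (x : T) : (x \in Z) ==> (x \in X) && (x \notin C).
  by apply/implyP; rewrite inE in_setD => /andP[/andP[-> ->]].
have i3 (x : T) : (x \in Y) ==> [&& x \in X, x \notin C & x \notin Z].
  by apply/implyP=> /(subsetP YR); rewrite !in_setD => /and3P[-> -> ->].
have i4 (x : T) : (x \in Lf) ==> (x \in Y) by apply/implyP; apply: (subsetP LfY).
have i5 (x : T) : (x \in Q) ==> (x \in C) by apply/implyP=> /(subsetP QU)/(subsetP UC).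
apply: (@cpart_le _ _ _ _ (\sum_(i < a) stage r b (i.+1 * r) +
    (3 * A * b + (r * (4 * A + 1) + (#|Lf| + 1))))).
  move: cLf; rewrite leq_add2l /stage /= ; move: (3 * A * b) #|Lf|; clear; nia.
apply: cpartD ZX cZ _; apply: cpartD cY _.
  by apply/subsetP=> x; rewrite !in_setD => /and4P[_ -> _ ->].
apply: cpartD cov _.
  apply/subsetP=> x; move: (i1 x) (i3 x) (i4 x) (i5 x) (i2 x).
  rewrite !in_setU !in_setD.
  by case: (x \in Q); case: (x \in Lf); case: (x \in Y); case: (x \in C); case: (x \in Z); case: (x \in X).
apply: cpartD (cpart_singles e Lf) _.
  apply/subsetP=> x; move: (i1 x) (i3 x) (i4 x) (i5 x) (i2 x).
  rewrite !in_setD !in_setU !in_setD.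
  by case: (x \in Q); case: (x \in Lf); case: (x \in Y); case: (x \in C); case: (x \in Z); case: (x \in X).
set S := _ :\: Lf; suff -> : S = C :\: Q by apply: absCU.
apply/setP=> x; move: (i1 x) (i3 x) (i4 x) (i5 x) (i2 x).
rewrite /S !in_setD !in_setU !in_setD.
by case: (x \in Q); case: (x \in Lf); case: (x \in Y); case: (x \in C); case: (x \in Z); case: (x \in X).
Qed.

End CoverBoundedIndependence.

(** * Hall's theorem and links *)

Section Hall.
Variable T : finType.

Definition hall_condition (D : {set T}) (A : T -> {set T}) : Prop :=
  forall J : {set T}, J \subset D -> #|J| <= #|\bigcup_(i in J) A i|.

(** Rado's argument. If both deletions fail, with violating sets [K1] and [K2] next to [i0], then
    submodularity contradicts the condition for [K1 :&: K2] and for [K1 :|: K2] together with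
    [i0]. *)
Lemma hall_shrink D A i0 w1 w2 : hall_condition D A ->
  w1 != w2 ->
  hall_condition D (fun i => if i == i0 then A i0 :\ w1 else A i) \/
  hall_condition D (fun i => if i == i0 then A i0 :\ w2 else A i).
Proof.
move=> hA w12.
pose nb (J : {set T}) := \bigcup_(i in J) A i.
pose S w := [set J : {set T} | (J \subset D) &&
   (#|\bigcup_(i in J) (if i == i0 then A i0 :\ w else A i)| < #|J|)].
have viol w : hall_condition D (fun i => if i == i0 then A i0 :\ w else A i) \/
    exists K : {set T}, [/\ i0 \notin K, i0 |: K \subset D & #|nb K :|: (A i0 :\ w)| <= #|K|].
  have [/eqP S0|/set0Pn[J]] := boolP (S w == set0).
    left=> J JD; rewrite leqNgt; apply/negP=> lt.
    by have := in_set0 J; rewrite -S0 inE JD lt.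
  rewrite inE => /andP[JD lt]; right.
  have iJ : i0 \in J.
    apply/negPn/negP=> iJ; move: lt; rewrite ltnNge; apply/negP/negPn.
    apply: leq_trans (hA _ JD) _; apply/subset_leq_card/bigcupsP=> i iiJ.
    apply: subset_trans (bigcup_sup _ iiJ); rewrite ifN //.
    by apply: contraNneq iJ => <-.
  exists (J :\ i0); split; first by rewrite !inE eqxx.
    by rewrite setD1K.
  move: lt; rewrite (cardsD1 i0 J) iJ add1n ltnS; apply: leq_trans.
  apply/subset_leq_card/subsetP=> x; rewrite inE => /orP[/bigcupP[i]|xA].
    rewrite !inE => /andP[ii0 iiJ] xi; apply/bigcupP; exists i => //.
    by rewrite (negPf ii0).
  by apply/bigcupP; exists i0 => //; rewrite eqxx.
case: (viol w1) => [|[K1 [i1 D1 c1]]]; first by left.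
case: (viol w2) => [|[K2 [i2 D2 c2]]]; first by right.
exfalso.
have U : #|i0 |: (K1 :|: K2)| <= #|(nb K1 :|: (A i0 :\ w1)) :|: (nb K2 :|: (A i0 :\ w2))|.
  apply: leq_trans (hA _ _) _.
    by apply/subsetP=> x; rewrite !inE => /or3P[/eqP->|xK|xK];
      [apply: (subsetP D1)|apply: (subsetP D1)|apply: (subsetP D2)]; rewrite !inE ?eqxx ?xK ?orbT.
  apply/subset_leq_card/subsetP=> x /bigcupP[i]; rewrite !inE.
  case/or3P=> [/eqP->|iK|iK] xi.
  - rewrite xi !andbT; case: (eqVneq x w1) => [->|] /=; last by rewrite orbT.
    by rewrite w12 !orbT.
  - by have -> : x \in nb K1 by apply/bigcupP; exists i.
  - by have -> : x \in nb K2 by [apply/bigcupP; exists i]; rewrite !orbT.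
have I : #|K1 :&: K2| <= #|(nb K1 :|: (A i0 :\ w1)) :&: (nb K2 :|: (A i0 :\ w2))|.
  apply: leq_trans (hA _ _) _.
    apply/subsetP=> x; rewrite inE => /andP[xK _]; apply: (subsetP D1).
    by rewrite !inE xK orbT.
  apply/subset_leq_card/subsetP=> x /bigcupP[i]; rewrite inE => /andP[iK1 iK2] xi.
  rewrite inE !in_setU; apply/andP; split; apply/orP; left.
    by apply/bigcupP; exists i.
  by apply/bigcupP; exists i.
have := cardsUI (nb K1 :|: (A i0 :\ w1)) (nb K2 :|: (A i0 :\ w2)).
have := cardsUI K1 K2.
move: U I c1 c2; rewrite cardsU1 inE (negPf i1) (negPf i2) /=.
move: #|K1 :|: K2| #|K1 :&: K2| #|K1| #|K2| #|_ :&: _| => u i k1 k2 v.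
move: #|nb K1 :|: _ :|: _| #|nb K1 :|: _| #|nb K2 :|: _|; clear; lia.
Qed.

(** The sets [A i] are shrunk one element at a time until they are singletons, and the condition
    then makes these distinct. *)
Theorem hall D A : hall_condition D A ->
  exists f : T -> T, {in D &, injective f} /\ forall i, i \in D -> f i \in A i.
Proof.
move: {2}(\sum_(i in D) #|A i|).+1 (ltnSn (\sum_(i in D) #|A i|)) => n.
elim: n A => // n IHn A; rewrite ltnS => cA hA.
have [/forall_inP small|] := boolP [forall i in D, #|A i| <= 1]; last first.
  rewrite negb_forall => /existsP[i0]; rewrite negb_imply -ltnNge => /andP[iD].
  case/card_gt1P=> w1 [w2 [w1A w2A w12]].
  have dec w : w \in A i0 -> \sum_(i in D) #|if i == i0 then A i0 :\ w else A i| < n.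
    move=> wA; apply: leq_trans cA; rewrite (bigD1 i0) //= eqxx [X in _ < X](bigD1 i0) //=.
    rewrite [#|A i0|](cardsD1 w) wA add1n addSn ltnS leq_add2l; apply: leq_sum => i.
    by move=> /andP[_ /negPf->].
  case: (hall_shrink i0 hA w12) => /IHn IH; [have [f [fi fA]] := IH (dec _ w1A)|have [f [fi fA]] := IH (dec _ w2A)];
    exists f; split=> // i /fA; case: eqP => // ->; by rewrite inE => /andP[].
pose f i := odflt i [pick w in A i].
have one i : i \in D -> exists w, A i = [set w].
  move=> iD; apply/cards1P; rewrite eqn_leq small //=.
  by have := hA [set i]; rewrite sub1set iD big_set1 cards1; apply.
have fE i : i \in D -> A i = [set f i].
  move=> iD; have [w wA] := one i iD; rewrite /f; case: pickP => /= [v|/(_ w)].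
    by rewrite wA inE => /eqP->.
  by rewrite wA inE eqxx.
exists f; split; last by move=> i iD; rewrite fE // inE.
move=> i j iD jD fij; apply/eqP/negPn/negP=> ij.
have := hA [set i; j]; rewrite subUset !sub1set iD jD => /(_ isT).
by rewrite cards2 ij bigcup_setU !big_set1 fE // (fE j) // fij setUid cards1.
Qed.

(** Take [X'] maximal: any other element of [X] is an image or a preimage of an element of [X'],
    which accounts for at most [2 |X'|] elements. The purpose is to make the pairs [x], [f x]
    disjoint. *)
Lemma displaced_subset (f : T -> T) (X : {set T}) :
  {in X &, injective f} -> (forall x, x \in X -> f x != x) ->
  exists X' : {set T}, [/\ X' \subset X, #|X| <= 3 * #|X'| &
    forall x y, x \in X' -> y \in X' -> f x != y].
Proof.
move=> fi fx.
pose ok (Y : {set T}) := (Y \subset X) && [forall x in Y, forall y in Y, f x != y].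
have ok0 : ok set0 by rewrite /ok sub0set; apply/forallP=> x; rewrite inE.
have [Y /maxsetP[/andP[YX /forall_inP okY] maxY] _] := maxset_exists ok0.
exists Y; split=> //; last by move=> x y xY yY; apply: (forall_inP (okY _ xY)).
have : X \subset Y :|: (f @: Y) :|: [set x in X | f x \in Y].
  apply/subsetP=> x xX; rewrite !inE xX /=.
  apply/negPn/negP; rewrite !negb_or => /andP[/andP[xY xf] fxY].
  have : x |: Y = Y.
    apply: maxY; last by apply: subsetUr.
    rewrite /ok subUset sub1set xX YX; apply/forall_inP=> y; rewrite !inE.
    case/orP=> [/eqP->|yY]; apply/forall_inP=> z; rewrite !inE => /orP[/eqP->|zY].
    - exact: fx.
    - by apply: contraNneq fxY => ->.
    - by apply: contraNneq xf => <-; apply: imset_f.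
    - exact: (forall_inP (okY _ yY)).
  by move/setP/(_ x); rewrite !inE eqxx (negPf xY).
move/subset_leq_card/leq_trans; apply.
have c1 : #|f @: Y| <= #|Y| by apply: leq_imset_card.
have c2 : #|[set x in X | f x \in Y]| <= #|Y|.
  have inj : {in [set x in X | f x \in Y] &, injective f}.
    by move=> x y; rewrite !inE => /andP[xX _] /andP[yX _]; apply: fi.
  rewrite -(card_in_imset inj); apply/subset_leq_card/subsetP=> z /imsetP[x xS ->].
  by move: xS; rewrite inE => /andP[].
have c3 := (leq_card_setU (Y :|: f @: Y) [set x in X | f x \in Y]).1.
have c4 := (leq_card_setU Y (f @: Y)).1.
rewrite (leq_trans c3) // (leq_trans (leq_add c4 c2)) // -addnA mulSn leq_add2l.
by rewrite mul2n -addnn leq_add2r.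
Qed.

End Hall.

Section Links.
Variables (T : finType) (r : nat) (e : 'I_r -> rel T).
Hypothesis e_sym : forall k, symmetric (e k).
Hypothesis e_irr : forall k, irreflexive (e k).
Hypothesis r0 : 0 < r.

Definition common (S W : {set T}) : {set T} :=
  [set w in W | [forall x in S, adj e x w]].

Definition via k x y (W : {set T}) := [set w in W | e k x w && e k w y].

(* A monochromatic cycle of links lifts to a monochromatic cycle of the graph that
   alternates with distinct connectors in [W]. *)
Definition link d W k : rel T := fun x y => (x != y) && (d <= #|via k x y W|).

Lemma link_sym d W k : symmetric (link d W k).
Proof.
move=> x y; rewrite /link eq_sym; congr (_ && (_ <= _)); apply: eq_card => w.
by rewrite !inE (e_sym k y w) (e_sym k w x); congr (_ && _); apply: andbC.
Qed.

Lemma link_irr d W k : irreflexive (link d W k).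
Proof. by move=> x; rewrite /link eqxx. Qed.

(** Each common neighbour of [r + 1] vertices sees two of them in the same colour. Averaging over
    the [(r + 1) r] ordered pairs and the [r] colours, some pair gets [d] connectors in one colour
    and is linked. *)
Lemma link_alpha d m (T0 W : {set T}) : 0 < d -> r * r * r.+1 * d <= m ->
  (forall S : {set T}, S \subset T0 -> #|S| = r.+1 -> m <= #|common S W|) ->
  alpha_le (link d W) r T0.
Proof.
move=> d0 dm hS I IT indI; rewrite leqNgt; apply/negP=> cI.
have : 0 < #|[set Z : {set T} | (Z \subset I) && (#|Z| == r.+1)]|.
  by rewrite cards_draws bin_gt0.
rewrite card_gt0 => /set0Pn[S]; rewrite inE => /andP[SI /eqP cS].
have := hS S (subset_trans SI IT) cS; apply/negP; rewrite -ltnNge.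
apply: leq_trans dm.
have small x y k : x \in S -> y \in S :\ x -> #|via k x y W| <= d.-1.
  rewrite !inE => xS /andP[yx yS]; rewrite -ltnS prednK // ltnNge.
  apply: contra (indI x y (subsetP SI _ xS) (subsetP SI _ yS)) => dk.
  by apply/existsP; exists k; rewrite /link eq_sym yx.
have : #|common S W| <= \sum_(x in S) \sum_(y in S :\ x) \sum_(k < r) #|via k x y W|.
  have -> : \sum_(x in S) \sum_(y in S :\ x) \sum_(k < r) #|via k x y W| =
      \sum_w \sum_(x in S) \sum_(y in S :\ x) \sum_(k < r) (w \in via k x y W : nat).
    rewrite [RHS]exchange_big; apply: eq_bigr => x _; rewrite [RHS]exchange_big; apply: eq_bigr => y _.
    rewrite [RHS]exchange_big; apply: eq_bigr => k _.
    by rewrite -sum1_card big_mkcond; apply: eq_bigr => w _; case: ifP.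
  rewrite -sum1_card [leqLHS]big_mkcond; apply: leq_sum => w _.
  case: ifP => // /[!inE] /andP[wW /forall_inP ad].
  pose c x := odflt (Ordinal r0) [pick k | e k x w].
  have cP x : x \in S -> e (c x) x w.
    by move=> /ad/existsP[k kx]; rewrite /c; case: pickP => //= /(_ k); rewrite kx.
  have [x [y [xS yS xy cxy]]] : exists x y, [/\ x \in S, y \in S, y != x & c x = c y].
    have [/existsP[x /existsP[y /and4P[xS yS xy /eqP cxy]]]|none] :=
      boolP [exists x, exists y, [&& x \in S, y \in S, y != x & c x == c y]].
      by exists x, y.
    have inj : {in S &, injective c}.
      move=> x y xS yS cxy; apply/eqP; apply: contraNT none => xy.
      by apply/existsP; exists x; apply/existsP; exists y; rewrite xS yS eq_sym xy cxy eqxx.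
    have := max_card (c @: S); by rewrite card_in_imset // cS card_ord ltnn.
  rewrite (bigD1 x) //= (bigD1 y) /=; last by rewrite !inE xy.
  rewrite (bigD1 (c x)) //= inE wW cP //= e_sym cxy cP //.
move/leq_ltn_trans; apply.
apply: (@leq_ltn_trans (\sum_(x in S) \sum_(y in S :\ x) \sum_(k < r) d.-1)).
  by apply: leq_sum => x xS; apply: leq_sum => y yS; apply: leq_sum => k _; apply: small.
rewrite (eq_bigr (fun _ => r * (r * d.-1))); last first.
  move=> x xS; rewrite sum_nat_const sum_nat_const card_ord.
  by move: (cardsD1 x S); rewrite xS cS add1n => -[<-].
rewrite sum_nat_const cS; move: d0 r0; clear; nia.
Qed.

Lemma flatten_block (ss : seq (seq T)) s s' z : uniq (flatten ss) ->
  s \in ss -> s' \in ss -> z \in s -> z \in s' -> s = s'.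
Proof.
elim: ss => //= a ss IH; rewrite cat_uniq => /and3P[_ /hasPn na us].
have no t : t \in ss -> z \in t -> z \notin a.
  by move=> tss zt; apply: na; apply/flattenP; exists t.
rewrite !inE => /orP[/eqP->|sss] /orP[/eqP->|sss'] zs zs' //.
- by move: (no _ sss' zs'); rewrite zs.
- by move: (no _ sss zs); rewrite zs'.
- exact: IH.
Qed.

Definition interleave (phi : T -> T) (s : seq T) := flatten [seq [:: x; phi x] | x <- s].

Lemma interleave_perm phi s : perm_eq (interleave phi s) (s ++ map phi s).
Proof.
elim: s => //= x s IH; rewrite /interleave /= -/(interleave phi s) perm_cons.
rewrite -cat1s (perm_trans (perm_cat (perm_refl _) IH)) //.
by rewrite !cat1s perm_sym -cat1s perm_catCA.
Qed.

Lemma interleave_cycle f phi s : uniq s ->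
  (forall x, x \in s -> f x (phi x) && f (phi x) (next s x)) -> cycle f (interleave phi s).
Proof.
move=> us fs; have := @cycle_from_next _ (fun x y => f x (phi x) && f (phi x) y) s us fs.
case: s {us fs} => // x s; rewrite /cycle.
have P (y z : T) : path (fun x y => f x (phi x) && f (phi x) y) y (rcons s z) ->
    path f y (phi y :: rcons (interleave phi s) z).
  elim: s y => [|a s IH] y /=; first by rewrite !andbT.
  by move=> /andP[/andP[-> ->] /IH].
by move/P.
Qed.

(** A set of links violating Hall's condition contains a third that consists of vertex-disjoint
    pairs. All their connectors lie in a set [Z] of at most three times as many vertices, and this
    is what [sparse] excludes. *)
Lemma lift_links d (T0 W : {set T}) m : 0 < d -> [disjoint T0 & W] ->
  (forall (X Z : {set T}) (f : T -> T), X != set0 -> X \subset T0 -> Z \subset W ->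
     {in X &, injective f} -> (forall x, x \in X -> f x \in T0) ->
     (forall x y, x \in X -> y \in X -> f x != y) -> #|Z| <= 3 * #|X| ->
     exists2 x, x \in X & #|common [set x; f x] Z| < d) ->
  cpart (link d W) T0 m ->
  exists2 P : {set T}, P \subset W & cpart e (T0 :|: P) m.
Proof.
move=> d0 dTW sparse [ss [sz mss pss]].
have uss : uniq (flatten ss) by rewrite (perm_uniq pss) enum_uniq.
have memT x : (x \in flatten ss) = (x \in T0) by rewrite (perm_mem pss) mem_enum.
pose blk x := nth [::] ss (find (fun s : seq T => x \in s) ss).
have blkP x : x \in T0 -> blk x \in ss /\ x \in blk x.
  rewrite -memT => /flattenP[s sss xs].
  have hs : has (fun s : seq T => x \in s) ss by apply/hasP; exists s.
  by split; [apply: mem_nth; rewrite -has_find|exact: nth_find hs].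
have blkE s x : s \in ss -> x \in s -> blk x = s.
  move=> sss xs; have xT : x \in T0 by rewrite -memT; apply/flattenP; exists s.
  by have [b1 b2] := blkP x xT; apply: flatten_block uss b1 sss b2 xs.
(* A single vertex needs no connector; a link cycle of length two needs two, and becomes a cycle of
   length four. *)
pose D := [set x in T0 | 1 < size (blk x)].
pose kap x := odflt (Ordinal r0) [pick k | cycle (link d W k) (blk x)].
pose nxt x := next (blk x) x.
have cyc x : x \in D -> cycle (link d W (kap x)) (blk x) /\ uniq (blk x).
  rewrite inE => /andP[/blkP[b1 b2] b3]; have [ub alt] := mss _ b1; split=> //.
  case: alt => [b4|[_ [k ck]]]; first by rewrite b4 in b3.
  by rewrite /kap; case: pickP => //= /(_ k); rewrite ck.
have nblk x : x \in D -> nxt x \in blk x.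
  by rewrite inE => /andP[/blkP[_ b2] _]; rewrite /nxt mem_next.
have nlink x : x \in D -> link d W (kap x) x (nxt x).
  move=> xD; have [c1 _] := cyc x xD; apply: next_cycle c1 _.
  by move: xD; rewrite inE => /andP[/blkP[_ ->]].
have nT x : x \in D -> nxt x \in T0.
  move=> xD; rewrite -memT; apply/flattenP; exists (blk x); last exact: nblk.
  by move: xD; rewrite inE => /andP[/blkP[-> _]].
have ninj : {in D &, injective nxt}.
  move=> x y xD yD xy.
  have bx : blk x \in ss by move: xD; rewrite inE => /andP[/blkP[-> _]].
  have by_ : blk y \in ss by move: yD; rewrite inE => /andP[/blkP[-> _]].
  have bb : blk x = blk y.
    by apply: flatten_block uss bx by_ (nblk _ xD) _; rewrite xy nblk.
  have [_ ub] := cyc x xD; apply: (can_inj (prev_next ub)).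
  by rewrite -/(nxt x) xy /nxt bb.
pose A x := via (kap x) x (nxt x) W.
have hA : hall_condition D A.
  move=> J JD; rewrite leqNgt; apply/negP=> lt.
  have Jinj : {in J &, injective nxt} by move=> x y /(subsetP JD) xD /(subsetP JD) yD; apply: ninj.
  have Jne x : x \in J -> nxt x != x.
    by move=> /(subsetP JD)/nlink/andP[xn _]; rewrite eq_sym.
  have [X [XJ cX Xd]] := displaced_subset Jinj Jne.
  have X0 : X != set0.
    by rewrite -card_gt0 lt0n; apply: contraTneq lt => X0; rewrite -leqNgt (leq_trans cX) // X0 muln0.
  have XD := subset_trans XJ JD.
  have DT : D \subset T0 by apply/subsetP=> x; rewrite inE => /andP[].
  have [||||||x xX] := sparse X (\bigcup_(i in J) A i) nxt X0.
  - exact: subset_trans XD DT.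
  - by apply/bigcupsP=> i _; apply/subsetP=> w; rewrite inE => /andP[].
  - by move=> x y /(subsetP XD) xD /(subsetP XD) yD; apply: ninj.
  - by move=> x /(subsetP XD); apply: nT.
  - exact: Xd.
  - exact: leq_trans (ltnW lt) cX.
  apply/negP; rewrite -leqNgt.
  have /andP[_ /leq_trans] := nlink _ (subsetP XD _ xX); apply.
  apply/subset_leq_card/subsetP=> w wA; rewrite inE; apply/andP; split.
    by apply/bigcupP; exists x => //; apply: (subsetP XJ).
  move: wA; rewrite inE => /and3P[_ w1 w2].
  apply/forall_inP=> y; rewrite !inE => /orP[/eqP->|/eqP->]; apply/existsP; exists (kap x) => //.
  by rewrite e_sym.
have [phi [pinj pA]] := hall hA.
have pW x : x \in D -> phi x \in W by move/pA; rewrite inE => /andP[].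
pose lift s := if 1 < size s then interleave phi s else s.
exists (phi @: D); first by apply/subsetP=> _ /imsetP[x xD ->]; apply: pW.
pose big := flatten [seq s <- ss | 1 < size s].
have memD x : (x \in big) = (x \in D).
  apply/flattenP/idP=> [[s]|xD].
    rewrite mem_filter => /andP[s1 sss] xs; rewrite inE (blkE s) // s1 andbT.
    by rewrite -memT; apply/flattenP; exists s.
  have := xD; rewrite inE => /andP[/blkP[b1 b2] b3]; exists (blk x) => //.
  by rewrite mem_filter b3.
have ubig : uniq big.
  apply: subseq_uniq uss; rewrite /big; elim: (ss) => //= s l IHl; case: ifP => _ /=.
    by apply: cat_subseq.
  exact: subseq_trans IHl (suffix_subseq _ _).
have pl : perm_eq (flatten [seq lift s | s <- ss]) (flatten ss ++ map phi big).
  rewrite /big; elim: (ss) => //= s l IHl; rewrite /lift; case: ifP => _ /=; last first.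
    by rewrite -catA perm_cat2l.
  rewrite map_cat (perm_trans (perm_cat (interleave_perm phi s) IHl)) //.
  by rewrite -!catA perm_cat2l perm_catCA.
have ul : uniq (flatten [seq lift s | s <- ss]).
  rewrite (perm_uniq pl) cat_uniq uss /=; apply/andP; split.
    apply/hasPn=> w /mapP[x]; rewrite memD => xD ->; rewrite /= memT.
    by have := pW _ xD; apply: contraTN => wT; rewrite (disjointFr dTW wT).
  rewrite map_inj_in_uniq // => x y; rewrite !memD; exact: pinj.
exists [seq lift s | s <- ss]; split.
- by rewrite size_map.
- move=> s' /mapP[s sss ->]; have [us alt] := mss s sss.
  rewrite /lift; case: ifP => s1; last first.
    by split=> //; case: alt => [|[]]; [left|rewrite s1].
  have sD x : x \in s -> x \in D.
    move=> xs; rewrite inE (blkE s) // s1 andbT -memT; by apply/flattenP; exists s.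
  split.
    move: ul; have : lift s \in [seq lift s | s <- ss] by apply: map_f.
    rewrite {1}/lift s1; elim: [seq lift s | s <- ss] => //= a l IHl.
    rewrite inE cat_uniq => /orP[/eqP->|/IHl IH] /and3P[] //.
  right; split.
    by rewrite (perm_size (interleave_perm _ _)) size_cat ltn_addr.
  case: s us s1 sD sss {alt} => // a s us s1 sD sss.
  exists (kap a); apply: interleave_cycle => // x xs.
  have := pA x (sD x xs); rewrite inE => /andP[_].
  have bx := blkE _ _ sss xs; have ba := blkE _ _ sss (mem_head a s).
  by rewrite /nxt /kap bx ba.
- apply: uniq_perm; rewrite ?enum_uniq // => x.
  rewrite (perm_mem pl) mem_cat mem_enum inE memT; congr (_ || _).
  apply/mapP/imsetP=> -[y yD ->]; exists y => //; by rewrite ?memD // -memD.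
Qed.

End Links.

(** * Random subsets *)

Section BinomialSubset.
Variables (R : realFieldType) (E : finType) (D : {set E}) (p : R).
Local Open Scope ring_scope.

Definition weight (G : {set E}) : R := p ^+ #|G| * (1 - p) ^+ (#|D| - #|G|).
Definition expect (F : {set E} -> R) : R := \sum_(G : {set E} | G \subset D) weight G * F G.
Definition prob (P : pred {set E}) : R := \sum_(G : {set E} | (G \subset D) && P G) weight G.

Lemma prod_setE (S : {set E}) (a b : R) :
  \prod_(x : E) (if x \in S then a else b) = a ^+ #|S| * b ^+ #|~: S|.
Proof.
rewrite (bigID (mem S)) /= (eq_bigr (fun _ => a)); last by move=> x ->.
rewrite prodr_const [X in _ * X](eq_bigr (fun _ => b)); last by move=> x /negPf->.
by rewrite prodr_const; congr (_ * _ ^+ _); apply: eq_card => x; rewrite !inE.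
Qed.

(** An element of [S] contributes the factor [p], any other element of [D] the factor [p + (1 - p)];
    expanding the product gives the sum over [G]. *)
Lemma expect_sub (S : {set E}) : S \subset D ->
  expect (fun G => (S \subset G)%:R) = p ^+ #|S|.
Proof.
move=> SD.
pose F x : R := if x \in D then p else 0.
pose H x : R := if x \in S then 0 else if x \in D then 1 - p else 1.
transitivity (\prod_x (F x + H x)); last first.
  rewrite -[RHS]mulr1 -[X in _ = _ * X](expr1n _ #|~: S|) -prod_setE; apply: eq_bigr => x _.
  rewrite /F /H; case xS: (x \in S); first by rewrite (subsetP SD) // addr0.
  by case: ifP => _; rewrite ?add0r // addrC subrK.
rewrite bigA_distr /expect [LHS]big_mkcond; apply: eq_bigr => G _.
have [GD|] := boolP (G \subset D); last first.
  case/subsetPn=> x xG xD; rewrite (bigD1 x) //= xG /F (negPf xD) mul0r //.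
have [SG|] := boolP (S \subset G); last first.
  by case/subsetPn=> x xS xG; rewrite (bigD1 x) //= (negPf xG) /H xS mul0r mulr0.
rewrite mulr1 /weight -cardsDS // (bigID (mem D)) /= [X in _ = _ * X]big1 ?mulr1; last first.
  move=> x xD; have -> : (x \in G) = false by apply: contraNF xD => /(subsetP GD).
  by rewrite /H (negPf xD); case: ifP => // xS; rewrite (subsetP SD) in xD.
rewrite (bigID (mem G)) /=; congr (_ * _).
  rewrite (eq_bigr (fun _ => p)) => [|x /andP[xD ->]]; last by rewrite /F xD.
  rewrite prodr_const; congr (_ ^+ _); apply: eq_card => x; rewrite [RHS]unfold_in.
  by case xG: (x \in G); rewrite ?andbF //= (subsetP GD).
rewrite (eq_bigr (fun _ => 1 - p)) => [|x /andP[xD xG]].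
  by rewrite prodr_const; congr (_ ^+ _); apply: eq_card => x; rewrite [RHS]unfold_in inE andbC.
rewrite (negPf xG) /H xD ifF //; by apply: contraNF xG => /(subsetP SG).
Qed.

Section Groups.
Variables (I : finType) (K : {set I}) (gam : I -> {set E}) (g : nat).
Hypothesis gamD : forall i, i \in K -> gam i \subset D.
Hypothesis gamg : forall i, i \in K -> #|gam i| = g.
Hypothesis gam_disj : forall i j, i \in K -> j \in K -> i != j -> [disjoint gam i & gam j].

Definition hits (G : {set E}) : nat := #|[set i in K | gam i \subset G]|.

Lemma card_groups (J : {set I}) : J \subset K -> #|\bigcup_(i in J) gam i| = (#|J| * g)%N.
Proof.
move: {2}#|J| (erefl #|J|) => n; elim: n J => [|n IHn] J cJ JK.
  by move/eqP: cJ; rewrite cards_eq0 => /eqP->; rewrite big_set0 !cards0.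
have [i iJ] : exists i, i \in J by apply/set0Pn; rewrite -card_gt0 cJ.
have cJ1 : #|J :\ i| = n by move: (cardsD1 i J); rewrite iJ cJ => -[].
have J1K : J :\ i \subset K by apply: subset_trans JK; apply: subsetDl.
rewrite (big_setD1 i iJ) /= cardsU IHn // gamg ?(subsetP JK) //.
have -> : gam i :&: \bigcup_(j in J :\ i) gam j = set0.
  apply/setP=> x; rewrite !inE; apply/negP=> /andP[xi /bigcupP[j]].
  rewrite !inE => /andP[ji jJ] xj.
  have := gam_disj (subsetP JK _ jJ) (subsetP JK _ iJ) ji.
  by move/disjointFr=> /(_ x xj); rewrite xi.
by rewrite cards0 subn0 cJ1 cJ mulSn.
Qed.

(** Expanding [a ^+ hits] into a sum over sets [J] with coefficient [(a - 1) ^+ #|J|] reduces the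
    moment to probabilities that whole unions are contained in [G]; disjointness of the groups
    enters through their sizes. *)
Lemma laplace (a : R) :
  expect (fun G => a ^+ hits G) = (1 + (a - 1) * p ^+ g) ^+ #|K|.
Proof.
pose F (G : {set E}) i : R := if i \in K then (a - 1) * (gam i \subset G)%:R else 0.
have E1 G : a ^+ hits G = \sum_(J : {set I} | J \subset K)
    (a - 1) ^+ #|J| * (\bigcup_(i in J) gam i \subset G)%:R.
  transitivity (\prod_i (F G i + 1)).
    rewrite /hits -[LHS]mulr1 -[X in _ * X = _](expr1n _ #|~: [set i in K | gam i \subset G]|).
    rewrite -prodr_const -[X in _ * X]prodr_const.
    rewrite [RHS](bigID (mem [set i in K | gam i \subset G])) /=; congr (_ * _).
      by apply: eq_bigr => i; rewrite inE /F => /andP[-> ->]; rewrite mulr1 subrK.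
    apply: eq_big => i; first by rewrite !inE.
    rewrite !inE /F; case: (i \in K) => //=; last by rewrite add0r.
    by move/negPf=> ->; rewrite mulr0 add0r.
  rewrite bigA_distr [RHS]big_mkcond; apply: eq_bigr => J _.
  have [JK|] := boolP (J \subset K); last first.
    by case/subsetPn=> i iJ iK; rewrite (bigD1 i) //= iJ /F (negPf iK) mul0r.
  rewrite (bigID (mem J)) /= [X in _ * X]big1 ?mulr1; last by move=> i /negPf->.
  have [sub|] := boolP (\bigcup_(i in J) gam i \subset G).
    rewrite mulr1 -prodr_const; apply: eq_bigr => i iJ; rewrite iJ /F (subsetP JK) //.
    by rewrite (subset_trans _ sub) ?mulr1 //; apply: bigcup_sup.
  rewrite mulr0; case/subsetPn=> x /bigcupP[i iJ xi] xG.
  rewrite (bigD1 i) //= iJ /F (subsetP JK) //.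
  suff -> : gam i \subset G = false by rewrite mulr0 mul0r.
  by apply: contraNF xG => /subsetP/(_ x xi).
transitivity (\sum_(J : {set I} | J \subset K) (a - 1) ^+ #|J| * (p ^+ g) ^+ #|J|).
  rewrite /expect (eq_bigr (fun G => \sum_(J : {set I} | J \subset K)
      (a - 1) ^+ #|J| * (weight G * (\bigcup_(i in J) gam i \subset G)%:R))); last first.
    by move=> G _; rewrite E1 big_distrr; apply: eq_bigr => J _; rewrite mulrCA.
  rewrite exchange_big; apply: eq_bigr => J JK; rewrite -big_distrr; congr (_ * _).
  rewrite -exprM mulnC -card_groups // -expect_sub //.
  by apply/bigcupsP=> i /(subsetP JK); apply: gamD.
pose b := (a - 1) * p ^+ g.
transitivity (\prod_i ((if i \in K then b else 0) + 1)); last first.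
  rewrite -[RHS]mulr1 -[X in _ = _ * X](expr1n _ #|~: K|) -prodr_const -[X in _ = _ * X]prodr_const.
  rewrite [LHS](bigID (mem K)) /=; congr (_ * _).
    by apply: eq_bigr => i ->; rewrite addrC.
  apply: eq_big => i; first by rewrite !inE.
  by move/negPf=> ->; rewrite add0r.
rewrite bigA_distr big_mkcond; apply: eq_bigr => J _.
have [JK|] := boolP (J \subset K); last first.
  by case/subsetPn=> i iJ iK; rewrite (bigD1 i) //= iJ (negPf iK) mul0r.
rewrite (bigID (mem J)) /= [X in _ = _ * X]big1 ?mulr1; last by move=> i /negPf->.
rewrite -exprMn -prodr_const; apply: eq_bigr => i iJ; by rewrite iJ (subsetP JK).
Qed.

End Groups.

Hypothesis p0 : 0 <= p.
Hypothesis p1 : p <= 1.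

Lemma weight_ge0 G : 0 <= weight G.
Proof. by rewrite mulr_ge0 // exprn_ge0 // subr_ge0. Qed.

Lemma prob_total : prob predT = 1.
Proof.
have := @expect_sub set0 (sub0set _); rewrite cards0 expr0 => <-.
rewrite /prob /expect; apply: eq_big => G; first by rewrite andbT.
by move=> _; rewrite sub0set mulr1.
Qed.

Lemma prob_le (P Q : pred {set E}) :
  (forall G : {set E}, G \subset D -> P G -> Q G) -> prob P <= prob Q.
Proof.
move=> PQ; rewrite /prob big_mkcond [leRHS]big_mkcond; apply: ler_sum => G _.
case GD: (G \subset D) => //=; case PG: (P G); last by case: ifP => // _; apply: weight_ge0.
by rewrite PQ.
Qed.

Lemma prob_compl P : prob (fun G => ~~ P G) = 1 - prob P.
Proof.
apply: (addIr (prob P)); rewrite subrK -prob_total.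
rewrite /prob [RHS](bigID P) /= addrC; congr (_ + _); apply: eq_bigl => G; by rewrite ?andbT.
Qed.

Lemma prob_union (I : finType) (P : I -> pred {set E}) :
  prob (fun G => [exists i, P i G]) <= \sum_i prob (P i).
Proof.
rewrite /prob (eq_bigr (fun i => \sum_(G : {set E} | G \subset D) (if P i G then weight G else 0))).
  rewrite exchange_big /= big_mkcondr; apply: ler_sum => G _.
  case: ifP => [/existsP[i PiG]|_]; last first.
    by apply: sumr_ge0 => i _; case: ifP => // _; apply: weight_ge0.
  rewrite (bigD1 i) //= PiG lerDl; apply: sumr_ge0 => j _.
  by case: ifP => // _; apply: weight_ge0.
by move=> i _; rewrite big_mkcondr.
Qed.

Lemma markov (P : pred {set E}) (F : {set E} -> R) : (forall G, 0 <= F G) ->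
  (forall G : {set E}, G \subset D -> P G -> 1 <= F G) -> prob P <= expect F.
Proof.
move=> F0 F1; rewrite /prob big_mkcondr; apply: ler_sum => G GD.
case: ifP => PG; last by rewrite mulr_ge0 // weight_ge0.
by rewrite ler_peMr ?weight_ge0 // F1.
Qed.

Section Tails.
Variables (I : finType) (K : {set I}) (gam : I -> {set E}) (g : nat).
Hypothesis gamD : forall i, i \in K -> gam i \subset D.
Hypothesis gamg : forall i, i \in K -> #|gam i| = g.
Hypothesis gam_disj : forall i j, i \in K -> j \in K -> i != j -> [disjoint gam i & gam j].

(** Markov's inequality for [2 ^+ hits]; the lower tail uses [2^-1] as base. *)
Lemma upper_tail (t : nat) :
  prob (fun G => (t <= hits K gam G)%N) <= (1 + p ^+ g) ^+ #|K| / 2 ^+ t.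
Proof.
have -> : 1 + p ^+ g = 1 + (2 - 1) * p ^+ g by congr (_ + _); rewrite [2 - 1](_ : _ = 1) ?mul1r //; lra.
rewrite -(laplace gamD gamg gam_disj) /expect big_distrl /=.
rewrite (eq_bigr (fun G => weight G * (2 ^+ hits K gam G / 2 ^+ t))); last by move=> G _; rewrite mulrA.
apply: markov => G; first by rewrite divr_ge0 ?exprn_ge0.
by move=> _ tG; rewrite ler_pdivlMr ?exprn_gt0 // mul1r ler_weXn2l // ler1n.
Qed.

Lemma lower_tail (t : nat) :
  prob (fun G => (hits K gam G <= t)%N) <= (1 - p ^+ g / 2) ^+ #|K| * 2 ^+ t.
Proof.
have -> : 1 - p ^+ g / 2 = 1 + (2^-1 - 1) * p ^+ g by field.
rewrite -(laplace gamD gamg gam_disj) /expect big_distrl /=.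
rewrite (eq_bigr (fun G => weight G * (2^-1 ^+ hits K gam G * 2 ^+ t))); last by move=> G _; rewrite mulrA.
apply: markov => G; first by rewrite mulr_ge0 ?exprn_ge0 // invr_ge0.
by move=> _ tG; rewrite exprVn mulrC ler_pdivlMr ?exprn_gt0 // mul1r ler_weXn2l // ler1n.
Qed.

End Tails.

End BinomialSubset.

(** * Common neighbourhoods as stars of edges *)

Section Stars.
Variable T : finType.
Implicit Types (S Q : {set T}) (F : {set {set T}}) (G : {set {set T}}).

Definition two_sets : {set {set T}} := [set e : {set T} | #|e| == 2].

Definition star S w : {set {set T}} := [set [set x; w] | x in S].

Definition comm G S Q : {set T} := [set w in Q | star S w \subset G].

Definition comm_count G F Q : nat := \sum_(S in F) #|comm G S Q|.

(** Disjointness makes the stars at one centre disjoint, so that the tail bounds apply; bad sets are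
    therefore always collected in families of this kind. *)
Definition uniform_family (g : nat) F : bool :=
  [&& trivIset F, F != set0 & [forall S in F, #|S| == g]].

Lemma set2_injl (x y w : T) : [set x; w] = [set y; w] -> x = y.
Proof.
move=> E; have := set21 x w; rewrite E !inE => /orP[/eqP//|/eqP xw].
by have := set21 y w; rewrite -E !inE xw orbb => /eqP->.
Qed.

Lemma star_card S w : #|star S w| = #|S|.
Proof. by apply: card_imset => x y; apply: set2_injl. Qed.

Lemma star_two S w : w \notin S -> star S w \subset two_sets.
Proof.
move=> wS; apply/subsetP=> _ /imsetP[x xS ->]; rewrite inE cards2.
by case: (eqVneq x w) => // xw; rewrite -xw xS in wS.
Qed.

Lemma comm_notin G S Q w : G \subset two_sets -> w \in comm G S Q -> w \notin S.
Proof.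
move=> G2; rewrite inE => /andP[_ sG]; apply/negP=> wS.
have : [set w; w] \in star S w by apply: imset_f.
by move/(subsetP sG)/(subsetP G2); rewrite inE cards2 eqxx.
Qed.

Lemma star_meet S S' w w' : ~~ [disjoint star S w & star S' w'] ->
  (w = w' /\ exists2 x, x \in S & x \in S') \/ (w' \in S /\ w \in S').
Proof.
case/pred0Pn=> e /andP[/imsetP[x xS ex] /imsetP[y yS ey]].
have E : [set x; w] = [set y; w'] by rewrite -ex -ey.
have := set22 x w; rewrite E !inE => /orP[/eqP wy|/eqP ww].
  right; split; last by rewrite wy.
  have := set22 y w'; rewrite -E !inE => /orP[/eqP->//|/eqP w'w].
  have : x \in [set y; w'] by rewrite -E set21.
  by rewrite !inE -wy w'w orbb => /eqP <-.
by left; split=> //; exists x => //; move: E; rewrite -ww => /set2_injl->.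
Qed.

Section Fixed.
Variables (R : realFieldType) (p : R) (g : nat) (F : {set {set T}}).
Hypothesis p0 : (0 <= p)%R.
Hypothesis p1 : (p <= 1)%R.
Hypothesis trivF : trivIset F.
Hypothesis cardF : forall S, S \in F -> #|S| = g.

Let gam (Sw : {set T} * T) := star Sw.1 Sw.2.

(** Two stars can also share an edge when each centre is a leaf of the other. Disjoint leaf sets do
    not exclude this; the second clause does. *)
Definition oriented (K : {set {set T} * T}) : Prop :=
  (forall Sw, Sw \in K -> (Sw.1 \in F) && (Sw.2 \notin Sw.1)) /\
  (forall Sw Sw', Sw \in K -> Sw' \in K -> Sw.2 \in Sw'.1 -> Sw'.2 \in Sw.1 -> False).

Lemma block_eq S S' x : S \in F -> S' \in F -> x \in S -> x \in S' -> S = S'.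
Proof.
move=> SF SF' xS xS'; apply/eqP/negPn/negP=> nE.
by have := trivIsetP trivF S S' SF SF' nE => /disjointFr/(_ xS); rewrite xS'.
Qed.

Lemma oriented_disj K : oriented K -> forall Sw Sw', Sw \in K -> Sw' \in K ->
  Sw != Sw' -> [disjoint gam Sw & gam Sw'].
Proof.
case=> KF Kor [S w] [S' w'] k1 k2; apply: contraNT => /star_meet /= [[ww [x xS xS']]|[w1 w2]].
  rewrite -ww; have /andP[/= s1 _] := KF _ k1; have /andP[/= s2 _] := KF _ k2.
  by rewrite (block_eq s1 s2 xS xS').
by case: (Kor _ _ k1 k2).
Qed.

Lemma oriented_upper K t : oriented K ->
  (prob two_sets p (fun G => t <= hits K gam G)%N <= (1 + p ^+ g) ^+ #|K| / 2 ^+ t)%R.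
Proof.
move=> oK; apply: upper_tail => //.
- by move=> [S w] /(proj1 oK) /andP[_ /=]; apply: star_two.
- by move=> [S w] /(proj1 oK) /andP[/= SF _]; rewrite star_card cardF.
- exact: oriented_disj.
Qed.

Lemma oriented_lower K t : oriented K ->
  (prob two_sets p (fun G => hits K gam G <= t)%N <= (1 - p ^+ g / 2) ^+ #|K| * 2 ^+ t)%R.
Proof.
move=> oK; apply: lower_tail => //.
- by move=> [S w] /(proj1 oK) /andP[_ /=]; apply: star_two.
- by move=> [S w] /(proj1 oK) /andP[/= SF _]; rewrite star_card cardF.
- exact: oriented_disj.
Qed.

Lemma comm_countE G Q : comm_count G F Q = #|[set Sw in setX F Q | gam Sw \subset G]|.
Proof.
set X := [set Sw in _ | _].
transitivity (\sum_(S : {set T}) \sum_(w : T) (if (S, w) \in X then 1 else 0)); last first.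
  by rewrite pair_bigA -sum1_card [RHS]big_mkcond; apply: eq_bigr => -[S w].
rewrite /comm_count big_mkcond; apply: eq_bigr => S _; case: ifP => SF.
  rewrite -sum1_card big_mkcond; apply: eq_bigr => w _.
  by rewrite !inE /= SF.
by rewrite big1 // => w _; rewrite !inE SF.
Qed.

Lemma comm_lower (Q : {set T}) t : [disjoint cover F & Q] ->
  (prob two_sets p (fun G => comm_count G F Q <= t)%N <=
    (1 - p ^+ g / 2) ^+ (#|F| * #|Q|) * 2 ^+ t)%R.
Proof.
move=> dQ; have QF S w : S \in F -> w \in Q -> w \notin S.
  move=> SF wQ; apply/negP=> wS; have := disjointFl dQ wQ.
  by move/negP; apply; apply/bigcupP; exists S.
have oK : oriented (setX F Q).
  split=> [[S w]|[S w] [S' w']]; rewrite !inE /=.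
    by move=> /andP[SF wQ]; rewrite SF QF.
  by move=> /andP[SF wQ] /andP[SF' wQ'] w1; rewrite (negPf (QF S' w SF' wQ)) in w1.
rewrite -cardsX; apply: le_trans (oriented_lower t oK).
by apply: prob_le => // G _; rewrite comm_countE.
Qed.

(** [Q] may meet [cover F], and then stars can cross. Comparing the rank of [S] with that of the
    block containing [w] splits the pairs into two oriented families, one of which receives at least
    half of the count; hence the factors 2. *)
Lemma comm_upper (Q : {set T}) t :
  (prob two_sets p (fun G => (2 * t).+1 <= comm_count G F Q)%N <=
    2 * ((1 + p ^+ g) ^+ (#|F| * #|Q|) / 2 ^+ t))%R.
Proof.
pose rk (S : {set T}) : nat := enum_rank S.
pose K1 := [set Sw : {set T} * T | [&& Sw.1 \in F, Sw.2 \in Q, Sw.2 \notin Sw.1 &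
   (Sw.2 \in cover F) ==> (rk (pblock F Sw.2) < rk Sw.1)]].
pose K2 := [set Sw : {set T} * T | [&& Sw.1 \in F, Sw.2 \in Q, Sw.2 \notin Sw.1 &
   (Sw.2 \in cover F) ==> (rk Sw.1 < rk (pblock F Sw.2))]].
have pb S w : S \in F -> w \in S -> (w \in cover F) /\ pblock F w = S.
  by move=> SF wS; split; [apply/bigcupP; exists S|apply: def_pblock].
have o1 : oriented K1.
  split=> [[S w]|[S w] [S' w']]; rewrite !inE /= => /and4P[SF wQ wS b]; first by rewrite SF.
  move=> /and4P[SF' wQ' wS' b'] w1 w2.
  have [c1 e1] := pb _ _ SF' w1; have [c2 e2] := pb _ _ SF w2.
  move: b b'; rewrite c1 c2 e1 e2 /= => l1 /(ltn_trans l1); by rewrite ltnn.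
have o2 : oriented K2.
  split=> [[S w]|[S w] [S' w']]; rewrite !inE /= => /and4P[SF wQ wS b]; first by rewrite SF.
  move=> /and4P[SF' wQ' wS' b'] w1 w2.
  have [c1 e1] := pb _ _ SF' w1; have [c2 e2] := pb _ _ SF w2.
  move: b b'; rewrite c1 c2 e1 e2 /= => l1 /(ltn_trans l1); by rewrite ltnn.
have cK (K : {set {set T} * T}) : K \subset setX F Q -> ((1 + p ^+ g) ^+ #|K| / 2 ^+ t <=
    (1 + p ^+ g) ^+ (#|F| * #|Q|) / 2 ^+ t)%R.
  move=> KX; rewrite ler_wpM2r ?invr_ge0 ?exprn_ge0 // -cardsX.
  apply: ler_weXn2l; first by rewrite lerDl exprn_ge0.
  exact: subset_leq_card.
have s1 : K1 \subset setX F Q.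
  by apply/subsetP=> [[S w]]; rewrite !inE /= => /and4P[-> ->].
have s2 : K2 \subset setX F Q.
  by apply/subsetP=> [[S w]]; rewrite !inE /= => /and4P[-> ->].
apply: (@le_trans _ _ (prob two_sets p (fun G => t <= hits K1 gam G)%N +
    prob two_sets p (fun G => t <= hits K2 gam G)%N)%R); last first.
  rewrite mulr_natl mulr2n; apply: lerD.
    exact: le_trans (oriented_upper t o1) (cK _ s1).
  exact: le_trans (oriented_upper t o2) (cK _ s2).
have := @prob_union R {set T} two_sets p p0 p1 bool
  (fun b G => t <= hits (if b then K1 else K2) gam G)%N.
rewrite big_bool; apply: le_trans; apply: prob_le => // G G2 tG.
suff : t <= hits K1 gam G \/ t <= hits K2 gam G.
  by case=> H; apply/existsP; [exists true|exists false].
have : comm_count G F Q <= hits K1 gam G + hits K2 gam G.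
  rewrite comm_countE /hits; apply: leq_trans (leq_card_setU _ _).1.
  apply/subset_leq_card/subsetP=> [[S w]]; rewrite !inE /= => /andP[/andP[SF wQ] sG].
  have wS : w \notin S by apply: (@comm_notin G S Q) => //; rewrite inE wQ.
  rewrite SF wQ wS sG !andbT /=.
  case wc: (w \in cover F) => //=.
  have : rk (pblock F w) != rk S.
    apply: contra wS => /eqP/val_inj/enum_rank_inj <-.
    by rewrite mem_pblock.
  by rewrite neq_ltn.
move: tG; move: (comm_count _ _ _) (hits K1 _ _) (hits K2 _ _); clear; lia.
Qed.

End Fixed.
End Stars.

(** * Graphs with the properties of a random graph *)

Section ColouredGraph.
Variables (T : finType) (r : nat) (G : {set {set T}}) (c : {set T} -> 'I_r).
Hypothesis G2 : G \subset two_sets T.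
Hypothesis r0 : 0 < r.

Definition gadj : rel T := fun x y => [set x; y] \in G.
Definition ecol (k : 'I_r) : rel T := fun x y => ([set x; y] \in G) && (c [set x; y] == k).

Lemma ecol_sym k : symmetric (ecol k).
Proof. by move=> x y; rewrite /ecol setUC. Qed.

Lemma gadj_irr : irreflexive gadj.
Proof.
move=> x; apply/negP=> /(subsetP G2); by rewrite inE cards2 eqxx.
Qed.

Lemma ecol_irr k : irreflexive (ecol k).
Proof. by move=> x; apply/negP=> /andP[]; rewrite -/(gadj x x) gadj_irr. Qed.

Lemma adj_gadj x y : adj ecol x y = gadj x y.
Proof.
apply/existsP/idP=> [[k /andP[]//]|xy].
by exists (c [set x; y]); rewrite /ecol eqxx andbT.
Qed.

Lemma ecount_adj X Y : ecount (adj ecol) X Y = ecount gadj X Y.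
Proof.
by apply: eq_bigr => x _; apply: eq_bigr => y _; rewrite adj_gadj.
Qed.

Lemma common_comm S W : common ecol S W = comm G S W.
Proof.
apply/setP=> w; rewrite !inE; congr (_ && _).
apply/forall_inP/subsetP=> [h _ /imsetP[x xS ->]|h x xS].
  by have := h x xS; rewrite adj_gadj.
by rewrite adj_gadj; apply/h/imset_f.
Qed.

(** Take a maximal disjoint family. Away from its cover no set satisfies [P], which is how
    exceptional sets are set aside. *)
Lemma exhaust (P : pred {set T}) g (X : {set T}) : 0 < g ->
  (forall S, P S -> #|S| = g /\ S \subset X) ->
  exists F : {set {set T}}, [/\ trivIset F, forall S, S \in F -> P S,
    #|cover F| = #|F| * g & forall S, P S -> ~~ [disjoint S & cover F]].
Proof.
move=> g0 hP.
pose ok (F : {set {set T}}) := trivIset F && [forall S in F, P S].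
have ok0 : ok set0.
  apply/andP; split; first by apply/trivIsetP=> A B; rewrite inE.
  by apply/forallP=> S; rewrite inE.
have [F /maxsetP[/andP[tF /forall_inP PF] maxF] _] := maxset_exists ok0.
exists F; split=> //.
  rewrite -(eqP tF) (eq_bigr (fun _ => g)) ?sum_nat_const // => S SF.
  by have [] := hP S (PF S SF).
move=> S PS; apply/negP=> dS; have [cS _] := hP S PS.
have SF : S |: F = F.
  apply: maxF; last by apply: subsetUr.
  apply/andP; split; last first.
    by apply/forall_inP=> S'; rewrite !inE => /orP[/eqP->|/PF].
  apply/trivIsetP=> A B; rewrite !inE => /orP[/eqP->|AF] /orP[/eqP->|BF] AB.
  - by rewrite eqxx in AB.
  - by apply: disjointWr dS; apply: (bigcup_sup B).
  - by rewrite disjoint_sym; apply: disjointWr dS; apply: (bigcup_sup A).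
  - exact: (trivIsetP tF).
have : S \in F by rewrite -SF !inE eqxx.
move=> SinF; have : S \subset cover F by apply: (bigcup_sup S).
move=> sub; have [x xS] : exists x, x \in S by apply/set0Pn; rewrite -card_gt0 cS.
by have := disjointFr dS xS; rewrite (subsetP sub).
Qed.

Variables (R : realFieldType).

(** The pairs [x], [f x] met in Hall's condition form a uniform family of 2-sets, the form in which
    sparseness is available for random graphs. *)
Lemma cover_via m d (b : nat) (T0 W : {set T}) : 0 < d -> r * r * r.+1 * d <= m ->
  [disjoint T0 & W] ->
  (forall S : {set T}, S \subset T0 -> #|S| = r.+1 -> m <= #|comm G S W|) ->
  (forall F (Z : {set T}), uniform_family 2 F -> #|F| <= #|T0| ->
     [disjoint cover F & Z] -> #|Z| <= 3 * #|F| ->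
     exists2 S, S \in F & #|comm G S Z| < d) ->
  (forall i, 0 < i -> i <= r -> 2 * shrink r (i * r) <= 2 ^ b) ->
  exists2 P : {set T}, P \subset W & cpart ecol (T0 :|: P) (indep_bound r b r).
Proof.
move=> d0 dm dTW hS h6 hb.
have aT : alpha_le (link ecol d W) r T0.
  by apply: (link_alpha ecol_sym r0 d0 dm) => // S ST cS; rewrite common_comm hS.
have cT := cover_bounded_independence (link_sym ecol_sym d W) (link_irr ecol d W) r0 aT hb.
apply: (lift_links ecol_sym r0 d0 dTW _ cT) => X Z f X0 XT ZW finj fT fd cZ.
pose F := [set [set x; f x] | x in X].
have ginj : {in X &, injective (fun x => [set x; f x])}.
  move=> x y xX yX E; have : x \in [set y; f y] by rewrite -E set21.
  rewrite !inE => /orP[/eqP//|/eqP xf].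
  by have := fd y x yX xX; rewrite xf eqxx.
have cF : #|F| = #|X| by rewrite card_in_imset.
have FT S : S \in F -> S \subset T0.
  case/imsetP=> x xX ->; apply/subsetP=> y; rewrite !inE => /orP[/eqP->|/eqP->].
    exact: (subsetP XT).
  exact: fT.
have fam : uniform_family 2 F.
  apply/and3P; split.
  - apply/trivIsetP=> _ _ /imsetP[x xX ->] /imsetP[y yX ->] ne.
    have xy : x != y by apply: contraNneq ne => ->.
    rewrite -setI_eq0; apply/eqP/setP=> z; rewrite !inE; apply/negP=> /andP[].
    case/orP=> /eqP-> /orP[] /eqP E.
    - by rewrite E eqxx in xy.
    - by have := fd y x yX xX; rewrite E eqxx.
    - by have := fd x y xX yX; rewrite E eqxx.
    - by move/eqP: (finj x y xX yX E); rewrite (negPf xy).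
  - by case/set0Pn: X0 => x xX; apply/set0Pn; exists [set x; f x]; apply: imset_f.
  - by apply/forall_inP=> _ /imsetP[x xX ->]; have := fd x x xX xX; rewrite eq_sym cards2 => ->.
have dFZ : [disjoint cover F & Z].
  apply: disjointWr ZW _; apply: disjointWl dTW.
  by apply/bigcupsP=> S SF; apply: FT.
have [|||S /imsetP[x xX ->] Sd] := h6 F Z fam.
- by rewrite cF subset_leq_card.
- exact: dFZ.
- by rewrite cF.
- by exists x => //; rewrite common_comm.
Qed.

End ColouredGraph.

(** * Recursive cover of the vertices that are poor in the reservoir *)

Section Levels.
Variables (T : finType) (r : nat) (G : {set {set T}}) (c : {set T} -> 'I_r).
Hypothesis G2 : G \subset two_sets T.
Hypothesis r0 : 0 < r.
Variable R : realFieldType.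
Variables (W : nat -> {set T}) (K m d b ell : nat) (rho : R).
Local Notation e := (ecol G c).
Hypothesis rho0 : (0 < rho)%R.
Hypothesis d0 : 0 < d.
Hypothesis dm : r * r * r.+1 * d <= m.
Hypothesis hb : forall i, 0 < i -> i <= r -> 2 * shrink r (i * r) <= 2 ^ b.
Hypothesis Wdisj : forall i j, i < j -> [disjoint W i & W j].
Hypothesis Wrich : forall i (S : {set T}), i < K -> #|S| = r.+1 -> 2 * m <= #|comm G S (W i)|.
Hypothesis few_crowded : forall F (Q : {set T}), uniform_family r.+1 F -> #|Q| <= ell ->
  (forall S, S \in F -> m <= #|comm G S Q|) ->
  (rho * (#|F| * r.+1)%:R <= #|Q|%:R)%R.
Hypothesis sparse : forall F (Z : {set T}), uniform_family 2 F -> #|F| <= ell ->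
  [disjoint cover F & Z] -> #|Z| <= 3 * #|F| -> exists2 S, S \in F & #|comm G S Z| < d.

Lemma comm_split S Q Q' : #|comm G S Q| <= #|comm G S (Q :&: Q')| + #|comm G S (Q :\: Q')|.
Proof.
apply: leq_trans (leq_card_setU _ _).1; apply/subset_leq_card/subsetP=> w.
by rewrite !inE => /andP[-> ->]; case: (w \in Q').
Qed.

Lemma comm_card S Q : #|comm G S Q| <= #|Q|.
Proof. by apply/subset_leq_card/subsetP=> w; rewrite inE => /andP[]. Qed.

(** Part of [X] may lie in [W j], and connectors must avoid it. By [light], fewer than [m] of the
    [2 m] common neighbours are lost in this way. *)
Lemma level_step j (X D' : {set T}) n : j < K -> #|X| <= ell ->
  D' \subset X :|: \bigcup_(i < j) W i -> cpart e D' n ->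
  (forall S : {set T}, #|S| = r.+1 -> S \subset X :\: D' -> #|comm G S (X :&: W j)| < m) ->
  exists D : {set T}, [/\ X \subset D, D \subset X :|: \bigcup_(i < j.+1) W i
    & cpart e D (n + indep_bound r b r)].
Proof.
move=> jK sX D'X cD' light.
have dTW : [disjoint X :\: D' & W j :\: X].
  rewrite -setI_eq0; apply/eqP/setP=> x; rewrite !inE.
  by case: (x \in X); rewrite ?andbF.
have [P PW cP] : exists2 P : {set T}, P \subset W j :\: X &
    cpart e ((X :\: D') :|: P) (indep_bound r b r).
  apply: (cover_via c r0 d0 dm dTW) => // [S SX cS|F Z fF cF].
    have := light S cS SX; have := Wrich jK cS; have := comm_split S (W j) X.
    by rewrite setIC; move: #|comm _ _ _| #|comm _ _ _| #|comm _ _ _|; clear; lia.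
  apply: sparse => //; apply: leq_trans cF _; apply: leq_trans sX.
  by apply/subset_leq_card/subsetDl.
exists (D' :|: ((X :\: D') :|: P)); split.
- by apply/subsetP=> x xX; rewrite !inE xX; case: (x \in D').
- rewrite big_ord_recr /=; apply/subsetP=> x; rewrite !inE => /orP[xD'|/orP[/andP[_ ->]//|xP]].
    by have := subsetP D'X _ xD'; rewrite !inE => /orP[->//|->]; rewrite orbT.
  by have := subsetP PW _ xP; rewrite !inE => /andP[_ ->]; rewrite !orbT.
- apply: cpartU => //; rewrite -setI_eq0; apply/eqP/setP=> x; rewrite !inE.
  apply/negP=> /andP[xD' /orP[|xP]]; first by rewrite xD'.
  have := subsetP PW _ xP; rewrite inE => /andP[xX xW].
  have := subsetP D'X _ xD'; rewrite !inE (negPf xX) /= => /bigcupP[i _ xWi].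
  by have := disjointFr (Wdisj (ltn_ord i)) xWi; rewrite xW.
Qed.

(* The sets seeing too much of [X] itself are covered recursively; they span few vertices. *)
Lemma level_cover j (X : {set T}) : j < K -> #|X| <= ell -> (#|X|%:R < m%:R * rho ^+ j)%R ->
  exists D : {set T}, [/\ X \subset D, D \subset X :|: \bigcup_(i < j.+1) W i
    & cpart e D (j.+1 * indep_bound r b r)].
Proof.
elim: j X => [|j IHj] X jK sX; rewrite ?expr0 ?mulr1.
  rewrite ltr_nat => Xm; rewrite -(addn0 (1 * _)) addnC mul1n.
  apply: (level_step jK sX (sub0set _)); first exact: cpart0.
  move=> S _ _; apply: leq_ltn_trans (comm_card _ _) _; apply: leq_ltn_trans Xm.
  by apply/subset_leq_card/subsetIl.
move=> bX.
pose P (S : {set T}) := [&& #|S| == r.+1, S \subset X & m <= #|comm G S (X :&: W j.+1)|].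
have [//|S /and3P[/eqP cS sS _]//|F [tF PF cF maxF]] := @exhaust T P r.+1 X.
have FX : cover F \subset X by apply/bigcupsP=> S /PF/and3P[].
have sX' : (rho * #|cover F|%:R <= #|X|%:R)%R.
  have [F0|F0] := eqVneq F set0.
    by rewrite cF F0 cards0 mul0n mulr0.
  have sQ : #|X :&: W j.+1| <= #|X| by apply/subset_leq_card/subsetIl.
  rewrite cF; apply: le_trans (_ : #|X :&: W j.+1|%:R <= _)%R; last by rewrite ler_nat.
  apply: few_crowded; [|exact: leq_trans sX|by move=> S /PF/and3P[]].
  by apply/and3P; split=> //; apply/forall_inP=> S /PF/and3P[].
have [|D' [XD' D'W cD']] := IHj (cover F) (ltnW jK) (leq_trans (subset_leq_card FX) sX).
  rewrite -(ltr_pM2l rho0); apply: le_lt_trans sX' _.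
  by apply: lt_le_trans bX _; rewrite exprS mulrCA.
rewrite mulSnr; apply: (level_step (j := j.+1) jK sX _ cD').
  by apply: subset_trans D'W _; apply: setSU.
move=> S cS SX; rewrite ltnNge; apply/negP=> mS.
have : ~~ [disjoint S & cover F].
  apply: maxF; apply/and3P; split=> //; first by rewrite cS.
  by apply: subset_trans SX _; apply: subsetDl.
move/negP; apply; rewrite -setI_eq0; apply/eqP/setP=> x; rewrite !inE.
apply/negP=> /andP[/(subsetP SX)]; rewrite inE => /andP[xD' _] /(subsetP XD').
by rewrite (negPf xD').
Qed.

End Levels.

(** * Covering a graph with typical edge counts and common neighbourhoods *)

Section Assembly.
Variables (T : finType) (r : nat) (G : {set {set T}}) (c : {set T} -> 'I_r).
Hypothesis G2 : G \subset two_sets T.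
Hypothesis r2 : 2 <= r.
Variable R : realFieldType.
Variables (p : R) (s : nat).
Local Notation e := (ecol G c).
Hypothesis p0 : (0 < p)%R.
Hypothesis p1 : (p <= 1)%R.
Hypothesis s0 : 0 < s.
Hypothesis edges_le : forall X Y : {set T}, s <= #|X| ->
  ((ecount (gadj G) X Y)%:R <= 4 * p * #|X|%:R * (#|Y| + s)%:R)%R.
Hypothesis edges_ge : forall X Y : {set T}, [disjoint X & Y] -> s <= #|X| -> s <= #|Y| ->
  (3 / 5 * p * #|X|%:R * #|Y|%:R <= (ecount (gadj G) X Y)%:R)%R.

Lemma upper_regular_gadj : upper_regular e (4 * p)%R s.
Proof. by move=> X Y sX; rewrite ecount_adj; apply: edges_le. Qed.

(** Between two halves of [X] there are about [2 * (3 / 5) / 4 = 3 / 10] times [p |X|^2] ordered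
    pairs; [1 / 4] leaves room for an odd [|X| >= 5]. *)
Lemma lower_dense_gadj (V : {set T}) : lower_dense e (p / 4)%R (2 * s + 3) V.
Proof.
move=> X _ sX; rewrite ecount_adj.
have [A AX cA] : exists2 A : {set T}, A \subset X & #|A| = #|X|./2.
  have : #|X|./2 <= #|X| by rewrite leq_half_double -addnn; move: #|X|; clear; lia.
  by move/card_geqP => [l [ul sl lX]]; exists [set x in l];
    [apply/subsetP=> x; rewrite inE => /lX | rewrite cardsE (card_uniqP ul)].
have cB : #|X :\: A| = #|X| - #|X|./2 by rewrite cardsD (setIidPr AX) cA.
have dAB : [disjoint A & X :\: A].
  by rewrite -setI_eq0; apply/eqP/setP=> x; rewrite !inE; case: (x \in A).
have gsym : symmetric (gadj G) by move=> x y; rewrite /gadj setUC.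
have split2 : 2 * ecount (gadj G) A (X :\: A) <= ecount (gadj G) X X.
  rewrite mul2n -addnn {2}(ecountC _ _ gsym).
  have XE : X = A :|: (X :\: A) by rewrite setUC -{1}(setID X A) (setIidPr AX) setUC.
  have -> : ecount (gadj G) X X = ecount (gadj G) A X + ecount (gadj G) (X :\: A) X.
    by rewrite /ecount [LHS](big_setID A) (setIidPr AX).
  by apply: leq_add; apply: ecount_mono => //; apply: subsetDl.
have e1 : #|X|./2.*2 <= #|X| <= #|X|./2.*2.+1.
  by rewrite -{2 3}(odd_double_half #|X|); case: (odd _); rewrite ?leqnn ?leqnSn.
have := edges_ge dAB; rewrite cA cB => h.
have {}h : (3 / 5 * p * (#|X|./2)%:R * (#|X| - #|X|./2)%:R
    <= (ecount (gadj G) A (X :\: A))%:R)%R.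
  by apply: h; move: e1 sX; move: #|X| (#|X|./2); clear; lia.
move: split2; rewrite -(ler_nat R) natrM; apply: le_trans.
apply: le_trans (_ : 2 * (3 / 5 * p * (#|X|./2)%:R * (#|X| - #|X|./2)%:R) <= _)%R; last first.
  by rewrite ler_pM2l.
have -> : (2 * (3 / 5 * p * (#|X|./2)%:R * (#|X| - #|X|./2)%:R) =
           p * (6 / 5 * ((#|X|./2)%:R * (#|X| - #|X|./2)%:R)))%R by ring.
rewrite mulrAC -mulrA ler_pM2l //.
have x5 : 5 <= #|X| by move: s0 sX; clear; lia.
rewrite natrB; last by move: e1; clear; lia.
move: e1 x5 => /andP[]; rewrite -!(ler_nat R) -addn1 natrD -!muln2 !natrM.
move: (_%:R)%R (#|X|%:R)%R => a x h1 h2 h3.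
have : (0 <= (x - a * 2) * (1 - (x - a * 2)))%R by apply: mulr_ge0; lra.
by nra.
Qed.

Lemma atypical_small (A U : {set T}) : [disjoint A & U] -> s <= #|U| ->
  #|[set x in A | ((deg (gadj G) x U)%:R < 3 / 5 * p * #|U|%:R)%R]| < s.
Proof.
move=> dAU sU; set X := [set x in A | _]; rewrite ltnNge; apply/negP=> sX.
have dXU : [disjoint X & U].
  by apply: disjointWl dAU; apply/subsetP=> x; rewrite inE => /andP[].
have := edges_ge dXU sX sU; apply/negP; rewrite -ltNge /ecount natr_sum.
have -> : (3 / 5 * p * #|X|%:R * #|U|%:R = \sum_(x in X) (3 / 5 * p * #|U|%:R))%R.
  by rewrite sumr_const -[RHS]mulr_natl; ring.
have [x xX] : exists x, x \in X by apply/card_gt0P; apply: leq_trans sX.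
rewrite (bigD1 x) //= [ltRHS](bigD1 x) //=; apply: ltr_leD.
  by move: xX; rewrite inE => /andP[].
by apply: ler_sum => y /andP[]; rewrite inE => /andP[_ /ltW].
Qed.

Variables (V1 : {set T}) (W : nat -> {set T}) (xmin rho : R).
Variables (u mh d1 d2 mu ell n1 b bb : nat).
Hypothesis Wdisj : forall i j, i < j -> [disjoint W i & W j].
Hypothesis Vdisj : forall i, [disjoint V1 & W i].
Hypothesis xmin_V1 : (xmin * (128 * r%:R) ^+ r <= 128 * r%:R * #|V1|%:R)%R.
Hypothesis c1 : (s%:R <= p / (8 * r%:R) * (p / (8 * r%:R)) * xmin / 8)%R.
Hypothesis c2 : (6 <= s%:R * (p / (8 * r%:R)))%R.
Hypothesis c8 :
  (1 + 12 * (128 * r%:R + 1) * (u%:R + s%:R) <= xmin / (256 * r%:R))%R.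
Hypothesis u_large : 20 * r * (20 * r ^ 2 + r + 2 * s) <= u.
Hypothesis n1_small : 20 * r * n1 <= u.
Hypothesis n1_large : 864 * r * s <= n1.
Hypothesis n1_p : (s%:R <= p / (8 * r%:R) * n1%:R)%R.
Hypothesis n1_T : #|T| <= 2 ^ bb * n1.
Hypothesis d1_gt0 : 0 < d1.
Hypothesis d2_gt0 : 0 < d2.
Hypothesis d1_mh : r * r * r.+1 * d1 <= mh.
Hypothesis d2_mu : r * r * r.+1 * d2 <= mu.
Hypothesis hb : forall i, 0 < i -> i <= r -> 2 * shrink r (i * r) <= 2 ^ b.
Hypothesis rho0 : (0 < rho)%R.
Hypothesis ell_mh : (ell%:R < mh%:R * rho ^+ 3)%R.
Hypothesis Wrich : forall i (S : {set T}), i < 4 -> #|S| = r.+1 -> 2 * mh <= #|comm G S (W i)|.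
Hypothesis few_poor : forall F (U : {set T}), uniform_family r.+1 F -> #|U| = u ->
  [disjoint cover F & U] -> (forall S, S \in F -> #|comm G S U| < mu) ->
  #|F| * r.+1 <= ell.
Hypothesis few_crowded : forall F (Q : {set T}), uniform_family r.+1 F -> #|Q| <= ell ->
  (forall S, S \in F -> mh <= #|comm G S Q|) ->
  (rho * (#|F| * r.+1)%:R <= #|Q|%:R)%R.
Let ell2 := s + r * ((20 * r + 1) * s.*2.-1 + s.-1).
Hypothesis sparse1 : forall F (Z : {set T}), uniform_family 2 F -> #|F| <= ell ->
  [disjoint cover F & Z] -> #|Z| <= 3 * #|F| -> exists2 S, S \in F & #|comm G S Z| < d1.
Hypothesis sparse2 : forall F (Z : {set T}), uniform_family 2 F -> #|F| <= ell2 ->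
  [disjoint cover F & Z] -> #|Z| <= 3 * #|F| -> exists2 S, S \in F & #|comm G S Z| < d2.

Let r0 : 0 < r. Proof. exact: leq_trans r2. Qed.
Let rR : (2 <= r%:R :> R)%R. Proof. by rewrite ler_nat. Qed.
Let sR : (1 <= s%:R :> R)%R. Proof. by rewrite ler1n. Qed.
Let b_gt0 : (0 < (32 * r%:R)^-1 :> R)%R.
Proof. by rewrite invr_gt0; move: rR; lra. Qed.

Lemma qbE : (4 * p * (32 * r%:R)^-1 = p / (8 * r%:R))%R.
Proof. by field; rewrite pnatr_eq0 -lt0n. Qed.

Lemma kap_qb : (2 * r%:R * (4 * p * (32 * r%:R)^-1) <= p / 4)%R.
Proof.
have r_neq0 : (r%:R != 0 :> R)%R by rewrite pnatr_eq0 -lt0n.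
by rewrite qbE; rewrite le_eqVlt; apply/orP; left; apply/eqP; field.
Qed.

(** [b = 1 / (32 r)] is the largest value with [2 r q b <= kap] for [q = 4 p] and [kap = p / 4]; the
    factor lost per colour is then [4 / b = 128 r]. *)
Lemma gnp_absorber : exists C U : {set T}, [/\ C \subset V1, absorber e C U & 2 * u <= #|U|].
Proof.
pose A := (p^-1 : R)%R; have A1 : (1 <= A)%R by rewrite invf_ge1.
have r_neq0 : (r%:R != 0 :> R)%R by rewrite pnatr_eq0 -lt0n.
have x1 : (512 * r%:R ^+ 2 * s%:R * A ^+ 2 <= xmin)%R.
  have := c1; rewrite -(ler_pM2l (_ : 0 < 512 * r%:R ^+ 2 * A ^+ 2)%R); last first.
    by rewrite !mulr_gt0 ?exprn_gt0 ?invr_gt0 ?ltr0n.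
  have -> : (512 * r%:R ^+ 2 * A ^+ 2 * (p / (8 * r%:R) * (p / (8 * r%:R)) * xmin / 8) = xmin)%R.
    by rewrite /A; field; rewrite r_neq0 gt_eqF.
  by rewrite mulrAC.
have sA : (s%:R * A ^+ 2 >= s%:R * A)%R.
  by rewrite ler_wpM2l // expr2 ler_peMl // (le_trans ler01).
have sA1 : (s%:R * A >= s%:R)%R by rewrite ler_peMr.
have rs : (2 * (s%:R * A ^+ 2) <= r%:R * (s%:R * A ^+ 2))%R.
  by rewrite ler_wpM2r // mulr_ge0 // exprn_ge0 // (le_trans ler01).
have x2 : (2 * r%:R * (s%:R * A ^+ 2) <= xmin / (256 * r%:R))%R.
  by rewrite ler_pdivlMr; [move: x1; rewrite expr2; lra|move: rR; lra].
have bE : (4 / (32 * r%:R)^-1 = 128 * r%:R :> R)%R by rewrite invrK; ring.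
have bx : ((32 * r%:R)^-1 * xmin / 8 = xmin / (256 * r%:R))%R by field.
have bx2 : ((32 * r%:R)^-1 * xmin / 4 = 2 * (xmin / (256 * r%:R)))%R by field.
have px : (p / (8 * r%:R) * xmin = 32 * p * (xmin / (256 * r%:R)))%R by field.
have px2 : (64 * r%:R * s%:R * A <= p / (8 * r%:R) * xmin)%R.
  have -> : (64 * r%:R * s%:R * A = 32 * p * (2 * r%:R * (s%:R * A ^+ 2)))%R.
    by rewrite /A; field; rewrite gt_eqF.
  by rewrite px ler_wpM2l // mulr_ge0 // ltW.
have rsA : (2 * (s%:R * A) <= r%:R * (s%:R * A))%R.
  by rewrite ler_wpM2r // mulr_ge0 // (le_trans ler01).
apply: (@absorber_exists R T r e (ecol_sym G c) (ecol_irr c G2) r0 (4 * p)%R (p / 4)%R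
  (32 * r%:R)^-1%R xmin s (2 * s + 3) s (2 * u) (128 * r + 1) V1) => //.
- by rewrite mulr_gt0.
- by rewrite invf_le1; move: rR; lra.
- exact: kap_qb.
- exact: upper_regular_gadj.
- exact: lower_dense_gadj.
- by rewrite qbE.
- by rewrite qbE.
- by rewrite bx; move: x2 rs sA sA1 sR; lra.
- by rewrite qbE; move: px2 rsA sA1 sR; lra.
- by rewrite qbE; move: px2 rsA sA1 sR; lra.
- by rewrite natrD natrM mulrDl mul1r mulrC mulrA; 
  rewrite (_ : _ * _ = 4)%R; [rewrite ltrDl|field].
- rewrite bx; apply: le_trans c8; rewrite lerD2l natrD !natrM.
  by rewrite le_eqVlt; apply/orP; left; apply/eqP; ring.
- by rewrite bx2 natrD natrM; move: x2 rs sA sA1 sR; lra.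
- by rewrite bE.
Qed.

(** A long cycle has at least [|Y| / (32 r) - 3 s] vertices, and [|Y| >= 864 r s] bounds [3 s] by
    [|Y| / (288 r)]; what remains is [|Y| / (36 r)]. *)
Lemma gnp_greedy (X : {set T}) : exists Y : {set T},
  [/\ Y \subset X, cpart e (X :\: Y) (36 * r * bb) & #|Y| <= n1].
Proof.
apply: (@greedy_cover T r e setT (36 * r) n1); rewrite ?subsetT ?muln_gt0 //; last first.
  by apply: leq_trans n1_T; apply: max_card.
move=> Y _ Yn.
have q0 : (0 < 4 * p)%R by rewrite mulr_gt0.
have Y0 : Y != set0 by rewrite -card_gt0; apply: leq_trans Yn.
have n1s : 2 * s + 3 <= n1.
  apply: leq_trans n1_large; rewrite -mulnA; apply: (@leq_trans (864 * (2 * s))).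
    by move: s0; clear; lia.
  by rewrite leq_mul2l leq_mul2r r2 orbT.
have dense := @lower_dense_gadj Y Y (subxx _) (leq_trans n1s (ltnW Yn)).
have pY : (s%:R <= 4 * p * (32 * r%:R)^-1 * #|Y|%:R)%R.
  rewrite qbE; apply: le_trans n1_p _; rewrite ler_wpM2l ?ler_nat ?(ltnW Yn) //.
  by rewrite divr_ge0 ?mulr_ge0 // ltW.
have [C [CY cC bC]] := large_mono_cycle (ecol_sym G c) (ecol_irr c G2) r0 s0
  upper_regular_gadj q0 b_gt0 Y0 kap_qb dense pY.
exists C; split=> //; have := leq_trans n1_large (ltnW Yn).
rewrite -!(ler_nat R) !natrM; move: bC; rewrite natrD natrM mulrC ler_pdivrMr; last first.
  by move: rR; lra.
by lra.
Qed.

(** [Ua] serves the alternating cycles and [Ub] provides the connectors for what these leave over.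
    The vertices of a maximal family of sets poor in [Ub] are covered beforehand, by [D], so that
    any [r + 1] leftover vertices are rich in [Ub]. *)
Theorem gnp_cover :
  cpart e setT (5 * indep_bound r b r + 36 * r * bb + r * (20 * r + 1) + 1).
Proof.
have [C [U [CV absC cU]]] := gnp_absorber; have [UC absC'] := absC.
have subcard (X : {set T}) n : n <= #|X| -> exists2 Y : {set T}, Y \subset X & #|Y| = n.
  by move/card_geqP => [l [ul sl lX]]; exists [set x in l];
    [apply/subsetP=> x; rewrite inE => /lX | rewrite cardsE (card_uniqP ul)].
have [|Ua UaU cUa] := subcard U u; first by apply: leq_trans cU; rewrite leq_pmull.
have [|Ub UbU cUb] := subcard (U :\: Ua) u.
  by rewrite cardsD (setIidPr UaU) cUa leq_subRL ?addnn -?mul2n // (leq_trans _ cU) // leq_pmull.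
have UaC := subset_trans UaU UC.
have UbC : Ub \subset C by apply: subset_trans UbU (subset_trans (subsetDl _ _) UC).
have dUab x : x \in Ub -> x \notin Ua by move/(subsetP UbU); rewrite inE => /andP[].
pose P (S : {set T}) := [&& #|S| == r.+1, S \subset ~: C & #|comm G S Ub| < mu].
have [//|S /and3P[/eqP cS sS _]//|F [tF PF cF maxF]] := @exhaust T P r.+1 (~: C).
pose B := cover F.
have BC : B \subset ~: C by apply/bigcupsP=> S /PF/and3P[].
have cB : #|B| <= ell.
  have [F0|F0] := eqVneq F set0; first by rewrite /B cF F0 cards0.
  rewrite /B cF; apply: few_poor cUb _ _.
  - by apply/and3P; split=> //; apply/forall_inP=> S /PF/and3P[].
  - by apply: disjointWl BC _; rewrite disjoint_sym disjoints_subset setCK.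
  - by move=> S /PF/and3P[].
have bB : (#|B|%:R < mh%:R * rho ^+ 3)%R by apply: le_lt_trans ell_mh; rewrite ler_nat.
have [D [BD DW cD]] := level_cover c r0 rho0 d1_gt0 d1_mh hb Wdisj Wrich few_crowded
  sparse1 (isT : 3 < 4) cB bB.
have DC x : x \in D -> x \notin C.
  move/(subsetP DW); rewrite inE => /orP[/(subsetP BC)|/bigcupP[i _ xW]]; first by rewrite inE.
  by apply/negP=> /(subsetP CV) xV; have := disjointFr (Vdisj i) xV; rewrite xW.
have [Y [YX cX Yn]] := gnp_greedy (~: (C :|: D)).
have YCD x : x \in Y -> (x \notin C) && (x \notin D).
  by move/(subsetP YX); rewrite !inE negb_or.
have su : s <= u.
  apply: leq_trans u_large; rewrite -mulnA; apply: (@leq_trans (20 * (1 * (2 * s)))).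
    by move: s; clear; lia.
  by rewrite leq_mul2l leq_mul // leq_addl.
have u0 : 0 < u by apply: leq_trans su.
pose Y0 := [set x in Y | ((deg (gadj G) x Ua)%:R < 3 / 5 * p * #|Ua|%:R)%R].
have dYUa : [disjoint Y & Ua].
  rewrite -setI_eq0; apply/eqP/setP=> x; rewrite !inE; apply/negP=> /andP[/YCD/andP[xC _]].
  by move/(subsetP UaC); rewrite (negPf xC).
have sY0 : #|Y0| < s by apply: atypical_small => //; rewrite cUa.
pose A := Y :\: Y0.
have dAUa : [disjoint A & Ua] by apply: disjointWl dYUa; apply: subsetDl.
have degA x : x \in A -> (3 / 5 * p * u%:R <= (deg (adj e) x Ua)%:R)%R.
  rewrite !inE => /andP[+ xY]; rewrite xY /= -leNgt cUa; move/le_trans; apply.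
  by rewrite ler_nat; apply: leq_sum => y _; rewrite adj_gadj.
have r_neq0 : (r%:R != 0 :> R)%R by rewrite pnatr_eq0 -lt0n.
have uR : (0 < u%:R :> R)%R by rewrite ltr0n.
have q0 : (0 < 4 * p)%R by rewrite mulr_gt0.
(* With [nu = u / (20 r)] the majority degree is [q * (3 nu)]: one [nu] for [A], one for the error
   terms and one for [nu] itself. [t = 20 r + 1] gives [t nu > |Ua|]. *)
have [|||Lf [P1 [LfA P1U cA cLf _]]] :=
  @majority_cover R T r e (ecol_sym G c) r0 (4 * p)%R s s0 q0 upper_regular_gadj
    (3 / 5 * p * u%:R)%R (3 / 5 * p * u%:R / r%:R)%R (u%:R / (20 * r%:R))%R (20 * r + 1) A Ua
    dAUa _ degA _ _.
- by rewrite mulrC divfK.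
- rewrite cUa natrD natrM mulrDl mul1r.
  have -> : (20 * r%:R * (u%:R / (20 * r%:R)) = u%:R :> R)%R by field.
  by rewrite ltrDl divr_gt0 // mulr_gt0 // ltr0n.
- have rv : (0 < 20 * r%:R :> R)%R by rewrite mulr_gt0 // ltr0n.
  have h1 : (n1%:R <= u%:R / (20 * r%:R) :> R)%R.
    by rewrite ler_pdivlMr // mulrC -!natrM ler_nat.
  have h2 : ((r * (20 * r + 1) + s.*2)%:R <= u%:R / (20 * r%:R) :> R)%R.
    rewrite ler_pdivlMr // mulrC -!natrM ler_nat; apply: leq_trans u_large.
    by rewrite leq_mul2l -mul2n mulnDr muln1 mulnCA mulnn leqnn orbT.
  have h3 : (#|A|%:R <= n1%:R :> R)%R.
    by rewrite ler_nat; apply: leq_trans Yn; apply/subset_leq_card/subsetDl.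
  have -> : (3 / 5 * p * u%:R / r%:R = 4 * p * (3 * (u%:R / (20 * r%:R))) :> R)%R by field.
  apply: ler_wpM2l; first exact: ltW.
  by rewrite -addnA natrD; move: h1 h2 h3; lra.
have Y0Y : Y0 \subset Y by apply/subsetP=> x; rewrite inE => /andP[].
have cT0 : #|Y0 :|: Lf| <= ell2.
  by apply: leq_trans (leq_card_setU _ _).1 _; apply: leq_add cLf; apply: ltnW.
have dTU : [disjoint Y0 :|: Lf & Ub].
  rewrite -setI_eq0; apply/eqP/setP=> x; rewrite in_setI in_setU in_set0; apply/negP=> /andP[xT].
  move/(subsetP UbC); suff /YCD/andP[/negPf->] : x \in Y by [].
  by case/orP: xT => [/(subsetP Y0Y)//|/(subsetP LfA)]; rewrite in_setD => /andP[].
have TY x : x \in Y0 :|: Lf -> x \in Y.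
  rewrite in_setU => /orP[/(subsetP Y0Y)//|/(subsetP LfA)].
  by rewrite in_setD => /andP[].
have hS (S : {set T}) : S \subset Y0 :|: Lf -> #|S| = r.+1 -> mu <= #|comm G S Ub|.
  move=> ST cS; rewrite leqNgt; apply/negP=> light.
  have : ~~ [disjoint S & cover F].
    apply: maxF; apply/and3P; split; rewrite ?cS //.
    apply/subsetP=> x xS; have /YCD/andP[xC _] := TY x (subsetP ST x xS).
    by rewrite in_setC.
  move/negP; apply; rewrite -setI_eq0; apply/eqP/setP=> x; rewrite in_setI in_set0.
  apply/negP=> /andP[/(subsetP ST)/TY/YCD/andP[_ xD] /(subsetP BD)].
  by rewrite (negPf xD).
have h6 F' (Z : {set T}) : uniform_family 2 F' -> #|F'| <= #|Y0 :|: Lf| ->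
    [disjoint cover F' & Z] -> #|Z| <= 3 * #|F'| -> exists2 S, S \in F' & #|comm G S Z| < d2.
  by move=> fF cF'; apply: sparse2 => //; apply: leq_trans cF' _.
have [P2 P2U cT] := cover_via c r0 d2_gt0 d2_mu dTU hS h6 hb.
have facts x : [&& (x \in P1) ==> (x \in C), (x \in P2) ==> (x \in C),
    ~~ ((x \in P1) && (x \in P2)), (x \in D) ==> (x \notin C),
    (x \in Y) ==> (x \notin C) && (x \notin D),
    (x \in Lf) ==> (x \in Y) && (x \notin Y0) & (x \in Y0) ==> (x \in Y)].
  apply/and5P; split.
  - by apply/implyP=> /(subsetP P1U)/(subsetP UaC).
  - by apply/implyP=> /(subsetP P2U)/(subsetP UbC).
  - by apply/negP=> /andP[/(subsetP P1U) xa /(subsetP P2U)/dUab]; rewrite xa.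
  - by apply/implyP=> /DC.
  - apply/and3P; split; apply/implyP.
    + exact: YCD.
    + by move/(subsetP LfA); rewrite in_setD andbC.
    + exact: (subsetP Y0Y).
have cC : cpart e (C :\: (P1 :|: P2)) 1.
  apply: absC'; rewrite subUset (subset_trans P1U UaU) (subset_trans P2U) //.
  by apply: subset_trans UbU (subsetDl _ _).
have disj (X Z : {set T}) : (forall x, (x \in X) && (x \in Z) = false) -> [disjoint X & Z].
  by move=> h; rewrite -setI_eq0; apply/eqP/setP=> x; rewrite in_setI in_set0 h.
have -> : setT = ((A :\: Lf) :|: P1) :|: ((Y0 :|: Lf) :|: P2) :|: (D :|: (~: (C :|: D) :\: Y)) :|:
    (C :\: (P1 :|: P2)).
  apply/setP=> x; move: (facts x); rewrite /A !(in_setU, in_setD, in_setC, in_setT).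
  by do 7!case: (x \in _).
(* Five covers through links: four in the levels and one for the leftover of the alternating
   cycles. *)
have -> : 5 * indep_bound r b r + 36 * r * bb + r * (20 * r + 1) + 1 =
    (r * (20 * r + 1) + indep_bound r b r) + (4 * indep_bound r b r + 36 * r * bb) + 1.
  by move: (indep_bound _ _ _) (r * (_ + _)) (36 * _ * _); clear; lia.
apply: cpartU cC; last apply: cpartU; try apply: cpartU => //.
all: apply: disj => x; move: (facts x); rewrite /A !(in_setU, in_setD, in_setC).
all: by do 7!case: (x \in _).
Qed.

End Assembly.

From mathcomp Require Import reals sequences exp.

(** * Union bounds *)

Section UnionBounds.
Variable R : realType.
Local Open Scope ring_scope.

(** In the tail bounds [5 / 8] and [3 / 4] stand for [ln 2] from below and from above. *)
Lemma expR_le2 : expR (5 / 8) <= 2 :> R.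
Proof.
have h : 15 / 16 <= expR (- (1 / 16)) :> R.
  by apply: le_trans (expR_ge1Dx _); lra.
have -> : 5 / 8 = 10%:R * (1 / 16) :> R by lra.
rewrite expRM_natl -[1/16]opprK expRN exprVn.
rewrite -[leRHS]invrK lef_pV2 ?posrE ?invr_gt0 ?exprn_gt0 ?expR_gt0 ?ltr0n //.
apply: (@le_trans _ _ ((15 / 16) ^+ 10)); last by apply: lerXn2r => //; rewrite nnegrE ?expR_ge0 //; lra.
by lra.
Qed.

Lemma expR_ge2 : 2 <= expR (3 / 4) :> R.
Proof.
have h : 9 / 8 <= expR (1 / 8) :> R by apply: le_trans (expR_ge1Dx _); lra.
have -> : 3 / 4 = 6%:R * (1 / 8) :> R by lra.
rewrite expRM_natl; apply: (@le_trans _ _ ((9 / 8) ^+ 6)); first by lra.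
by apply: lerXn2r => //; rewrite nnegrE ?expR_ge0 //; lra.
Qed.

Lemma sum_subsets (I : finType) (B : {set I}) (z : R) :
  \sum_(F : {set I} | F \subset B) z ^+ #|F| = (1 + z) ^+ #|B|.
Proof.
transitivity (\prod_i ((if i \in B then z else 0) + 1)).
  rewrite bigA_distr big_mkcond; apply: eq_bigr => F _.
  have [FB|] := boolP (F \subset B); last first.
    by case/subsetPn=> i iF iB; rewrite (bigD1 i) //= iF (negPf iB) mul0r.
  rewrite (bigID (mem F)) /= [X in _ = _ * X]big1 ?mulr1; last by move=> i /negPf->.
  by rewrite -prodr_const; apply: eq_bigr => i iF; rewrite iF (subsetP FB).
rewrite (bigID (mem B)) /= [X in _ * X]big1 ?mulr1; last by move=> i /negPf->; rewrite add0r.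
by rewrite -prodr_const; apply: eq_bigr => i ->; rewrite addrC.
Qed.

(** The sum is at most [(1 + 1 / N)^N]. So a union bound over all subsets of an [N]-element set
    costs a factor [N] per element. *)
Lemma sum_subsets_le (I : finType) (B : {set I}) (N : nat) : (#|B| <= N)%N -> (0 < N)%N ->
  \sum_(F : {set I} | F \subset B) N%:R^-1 ^+ #|F| <= expR 1 :> R.
Proof.
move=> BN N0; rewrite sum_subsets; have NR : 0 < N%:R :> R by rewrite ltr0n.
apply: (@le_trans _ _ (expR N%:R^-1 ^+ #|B|)).
  by apply: lerXn2r; rewrite ?nnegrE ?expR_ge0 ?expR_ge1Dx // addr_ge0 // invr_ge0.
by rewrite -expRM_natl ler_expR ler_pdivrMr // mul1r ler_nat.
Qed.

Lemma bin_le_exp n g : ('C(n, g) <= n ^ g)%N.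
Proof.
elim: n g => [|n IHn] [|g]; rewrite ?bin0 ?bin0n ?expn0 //.
rewrite binS; apply: leq_trans (leq_add (IHn g.+1) (IHn g)) _.
rewrite expnS -mulSnr expnS leq_mul2l; apply/orP; right.
by case: g => // g; rewrite leq_exp2r.
Qed.

Variables (T : finType) (p L : R) (g : nat).
Local Notation n := #|T|.
Hypothesis p0 : 0 <= p.
Hypothesis p1 : p <= 1.
Hypothesis g0 : (0 < g)%N.
Hypothesis n0 : (0 < n)%N.
Hypothesis nL : expR L = n%:R.

Lemma sum_sets : \sum_(Q : {set T}) expR (- (2 * #|Q|%:R * L)) <= expR 1.
Proof.
have := @sum_subsets_le T setT #|T| (max_card _) n0; apply: le_trans.
rewrite [leRHS]big_mkcond /=; apply: ler_sum => Q _; rewrite subsetT.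
have -> : 2 * #|Q|%:R * L = (2 * #|Q|)%N%:R * L by rewrite natrM.
rewrite -mulrN expRM_natl expRN nL !exprVn lef_pV2 ?posrE ?exprn_gt0 ?ltr0n //.
by rewrite ler_weXn2l ?ler1n // leq_pmull.
Qed.

Local Notation family := (@uniform_family T g).

(** There are at most [n^g] sets of size [g]. The weight [n^(-2 g)] per set is the square of what
    the union bound needs, and as [F] is nonempty the surplus gives the factor [1 / n]. *)
Lemma sum_families : \sum_(F | family F) expR (- (2 * g%:R * #|F|%:R * L)) <= expR 1 / n%:R.
Proof.
have nR : 0 < n%:R :> R by rewrite ltr0n.
pose B := [set S : {set T} | #|S| == g].
have cB : (#|B| <= n ^ g)%N.
  have -> : #|B| = 'C(n, g).
    rewrite -cardsT -cards_draws; apply: eq_card => S; by rewrite !inE subsetT.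
  exact: bin_le_exp.
have ng : (0 < n ^ g)%N by rewrite expn_gt0 n0.
have := sum_subsets_le cB ng; rewrite -(ler_pM2r (_ : 0 < n%:R^-1)) ?invr_gt0 //.
apply: le_trans; rewrite big_distrl /= big_mkcond [leRHS]big_mkcond /=; apply: ler_sum => F _.
case: ifP => [/and3P[_ F0 /forall_inP cF]|_]; last first.
  by case: ifP => // _; rewrite mulr_ge0 ?exprn_ge0 ?invr_ge0.
rewrite ifT; last by apply/subsetP=> S /cF; rewrite inE.
have -> : 2 * g%:R * #|F|%:R * L = (2 * g * #|F|)%N%:R * L by rewrite !natrM.
rewrite -mulrN expRM_natl expRN nL exprVn natrX exprVn -exprM -invfM -exprSr.
rewrite lef_pV2 ?posrE ?exprn_gt0 // ler_weXn2l ?ler1n //.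
have F1 : (0 < #|F|)%N by rewrite card_gt0.
have : (0 < g * #|F|)%N by rewrite muln_gt0 g0.
by rewrite -mulnA mul2n -addnn; move: (g * _)%N; clear; lia.
Qed.

(* The summand [2 * #|Q|%:R * L + 2 * g%:R * #|F|%:R * L] pays for the union bound
   over [F] and [Q]. *)
Definition crowded (F : {set {set T}}) (Q : {set T}) (t : nat) : Prop :=
  #|F|%:R * #|Q|%:R * p ^+ g + 2 * #|Q|%:R * L + 2 * g%:R * #|F|%:R * L <= 5 / 8 * t%:R.

Lemma many_common_unlikely (ok : {set {set T}} -> {set T} -> bool)
    (t : {set {set T}} -> {set T} -> nat) :
  (forall F Q, family F -> ok F Q -> crowded F Q (t F Q)) ->
  prob (two_sets T) p (fun G => [exists F, exists Q,
     [&& family F, ok F Q & (2 * t F Q < comm_count G F Q)%N]]) <=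
  2 * expR 1 * expR 1 / n%:R.
Proof.
move=> hok; have nR : 0 < n%:R :> R by rewrite ltr0n.
apply: le_trans (prob_union _ p0 p1 _) _.
apply: (@le_trans _ _ (\sum_(F | family F)
    \sum_(Q : {set T}) 2 * (expR (- (2 * g%:R * #|F|%:R * L)) * expR (- (2 * #|Q|%:R * L))))).
  rewrite [leRHS]big_mkcond /=; apply: ler_sum => F _; case: ifP => fF; last first.
    rewrite /prob big_pred0 // => G; apply/negP=> /andP[_ /existsP[Q /and3P[]]].
    by [].
  apply: le_trans (prob_union _ p0 p1 _) _; apply: ler_sum => Q _.
  case okQ: (ok F Q); last first.
    rewrite /prob big_pred0 ?mulr_ge0 ?expR_ge0 // => G.
    by rewrite /= andbF.
  have /and3P[tF F0 /forall_inP cF] := fF.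
  have cF' S : S \in F -> #|S| = g by move/cF/eqP.
  apply: le_trans (_ : prob (two_sets T) p (fun G => (2 * t F Q < comm_count G F Q)%N) <= _).
    by apply: prob_le => // G _ /and3P[].
  apply: le_trans (comm_upper p0 p1 tF cF' Q (t F Q)) _.
  rewrite ler_wpM2l // ler_pdivrMr ?exprn_gt0 //.
  apply: (@le_trans _ _ (expR (p ^+ g) ^+ (#|F| * #|Q|))).
    by apply: lerXn2r; rewrite ?nnegrE ?expR_ge0 ?expR_ge1Dx // addr_ge0 // exprn_ge0.
  apply: (@le_trans _ _ (expR (- (2 * g%:R * #|F|%:R * L)) * expR (- (2 * #|Q|%:R * L)) *
      expR (5 / 8) ^+ t F Q)); last first.
    rewrite ler_wpM2l ?mulr_ge0 ?expR_ge0 //; apply: lerXn2r; rewrite ?nnegrE ?expR_ge0 //.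
    exact: expR_le2.
  rewrite -!expRM_natl -!expRD ler_expR natrM.
  by have := hok F Q fF okQ; rewrite /crowded; lra.
apply: (@le_trans _ _ (\sum_(F | family F) 2 * expR 1 * expR (- (2 * g%:R * #|F|%:R * L)))).
  apply: ler_sum => F _; rewrite -big_distrr -big_distrr /=.
  by have := ler_wpM2l (expR_ge0 (- (2 * g%:R * #|F|%:R * L))) sum_sets; lra.
rewrite -big_distrr /= -[leRHS]mulrA ler_wpM2l ?mulr_ge0 ?expR_ge0 //.
exact: sum_families.
Qed.

(** [lam Q] pays for the choice of [Q]. It is left free because [Q] is charged by its size, by the
    number of admissible sets, or at the flat rate [n]. *)
Definition rich (F : {set {set T}}) (Q : {set T}) (lam : {set T} -> R) (t : nat) : Prop :=
  3 / 4 * t%:R + lam Q + 2 * g%:R * #|F|%:R * L <= #|F|%:R * #|Q|%:R * p ^+ g / 2.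

Lemma few_common_unlikely (ok : {set {set T}} -> {set T} -> bool)
    (lam : {set T} -> R) (pQ : pred {set T}) (c : R)
    (t : {set {set T}} -> {set T} -> nat) :
  0 <= c -> \sum_(Q | pQ Q) expR (- lam Q) <= c ->
  (forall F Q, family F -> ok F Q ->
     [/\ pQ Q, [disjoint cover F & Q] & rich F Q lam (t F Q)]) ->
  prob (two_sets T) p (fun G => [exists F, exists Q,
     [&& family F, ok F Q & (comm_count G F Q <= t F Q)%N]]) <= c * expR 1 / n%:R.
Proof.
move=> c0 hc hok; have nR : 0 < n%:R :> R by rewrite ltr0n.
apply: le_trans (prob_union _ p0 p1 _) _.
apply: (@le_trans _ _ (\sum_(F | family F)
    \sum_(Q | pQ Q) (expR (- (2 * g%:R * #|F|%:R * L)) * expR (- lam Q)))).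
  rewrite [leRHS]big_mkcond /=; apply: ler_sum => F _; case: ifP => fF; last first.
    rewrite /prob big_pred0 // => G; apply/negP=> /andP[_ /existsP[Q /and3P[]]].
    by [].
  apply: le_trans (prob_union _ p0 p1 _) _; rewrite [leRHS]big_mkcond; apply: ler_sum => Q _.
  case okQ: (ok F Q); last first.
    rewrite /prob big_pred0 ?fun_if; first by case: ifP => // _; rewrite mulr_ge0 ?expR_ge0.
    by move=> G; rewrite /= andbF.
  have [pQQ dFQ hQ] := hok F Q fF okQ; rewrite pQQ.
  have /and3P[tF F0 /forall_inP cF] := fF.
  have cF' S : S \in F -> #|S| = g by move/cF/eqP.
  apply: le_trans (_ : prob (two_sets T) p (fun G => (comm_count G F Q <= t F Q)%N) <= _).
    by apply: prob_le => // G _ /and3P[].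
  apply: le_trans (comm_lower p0 p1 tF cF' (t F Q) dFQ) _.
  apply: (@le_trans _ _ (expR (- (p ^+ g / 2)) ^+ (#|F| * #|Q|) * expR (3 / 4) ^+ t F Q)).
    apply: ler_pM; rewrite ?exprn_ge0 //.
    - rewrite subr_ge0 ler_pdivrMr //; apply: le_trans (_ : 1 <= _); last by lra.
      by rewrite exprn_ile1.
    - apply: lerXn2r; rewrite ?nnegrE ?expR_ge0 ?expR_ge1Dx //.
      rewrite subr_ge0 ler_pdivrMr //; apply: le_trans (_ : 1 <= _); last by lra.
      by rewrite exprn_ile1.
    - by apply: lerXn2r; rewrite ?nnegrE ?expR_ge0 //; exact: expR_ge2.
  rewrite -!expRM_natl -!expRD ler_expR natrM.
  by move: hQ; rewrite /rich; lra.
apply: (@le_trans _ _ (\sum_(F | family F) c * expR (- (2 * g%:R * #|F|%:R * L)))).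
  apply: ler_sum => F _; rewrite -big_distrr /= mulrC ler_wpM2r ?expR_ge0 //.
rewrite -big_distrr /= -[leRHS]mulrA ler_wpM2l //.
exact: sum_families.
Qed.

End UnionBounds.

Lemma disjoint_regions (T : finType) (j k : nat) : 0 < k -> j * k <= #|T| ->
  exists W : nat -> {set T}, (forall i i', i != i' -> [disjoint W i & W i']) /\
    forall i, i < j -> #|W i| = k.
Proof.
move=> k0 jk; pose W i := [set x : T | enum_rank x %/ k == i].
exists W; split=> [i i' ii'|i ij].
  rewrite -setI_eq0; apply/eqP/setP=> x; rewrite !inE; apply/negP=> /andP[/eqP E /eqP E'].
  by rewrite -E -E' eqxx in ii'.
have ik (m : 'I_k) : i * k + m < #|T|.
  apply: leq_trans jk; apply: (@leq_trans (i * k + k)); first by rewrite ltn_add2l.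
  by rewrite -mulSnr leq_mul2r ij orbT.
have -> : W i = [set enum_val (Ordinal (ik m)) | m : 'I_k].
  apply/setP=> x; rewrite inE; apply/eqP/imsetP=> [E|[m _ ->]].
    exists (Ordinal (ltn_pmod (enum_rank x) k0)) => //.
    by apply: enum_rank_inj; rewrite enum_valK; apply: val_inj; rewrite /= -E -divn_eq.
  by rewrite enum_valK /= divnMDl // divn_small // addn0.
rewrite card_imset ?card_ord // => m m' /enum_val_inj/(congr1 val)/= /addnI.
exact: val_inj.
Qed.

(** * Numerical constants *)

Section Constants.
Variable r : nat.
Hypothesis r2 : 2 <= r.

Let lam := up_log 2 r.
(* The ratio of [n] to the size of the reservoir. *)
Definition reservoir_ratio := 2 ^ 22 * r ^ 2 * (128 * r) ^ r.-1.
(** From [2 * 13500 <= 2^15] and [11 <= 2^4], with [i * r <= r^2] for the argument of [shrink]. *)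
Definition shrink_log := 15 + 6 * up_log 2 r + (4 + 2 * up_log 2 r) * r.-1.
(** From [25 * 2^22 <= 2^27] and [128 = 2^7]. *)
Definition greedy_log := 27 + 3 * up_log 2 r + (7 + up_log 2 r) * r.-1.
Definition cover_number :=
  5 * indep_bound r shrink_log r + 36 * r * greedy_log + r * (20 * r + 1) + 1.

Let r_lam : r <= 2 ^ lam. Proof. exact: up_logP. Qed.

Lemma reservoir_ratio_gt0 : 0 < reservoir_ratio.
Proof. by rewrite !muln_gt0 !expn_gt0 /= muln_gt0 (ltn_trans _ r2). Qed.

Lemma greedy_log_large : 25 * r * reservoir_ratio <= 2 ^ greedy_log.
Proof.
rewrite /reservoir_ratio /greedy_log -/lam expnD expnM mulnA (expnD 2 27).
apply: leq_mul; last first.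
  rewrite leq_exp2r ?expnD ?leq_mul //; move: r2; clear; lia.
have -> : 25 * r * (2 ^ 22 * r ^ 2) = (25 * 2 ^ 22) * r ^ 3.
  by rewrite (expnS r 2); move: (2 ^ 22) (r ^ 2); clear; nia.
apply: leq_mul; first by rewrite (expnD 2 5 22) leq_mul2r orbT.
by rewrite mulnC expnM leq_exp2r.
Qed.

Lemma shrink_log_large i : 0 < i -> i <= r -> 2 * shrink r (i * r) <= 2 ^ shrink_log.
Proof.
move=> i0 ir.
have irl : i * r <= 2 ^ (2 * lam).
  by rewrite mul2n -addnn expnD; apply: leq_mul => //; apply: leq_trans r_lam.
rewrite /shrink /shrink_log -/lam; move: (i * r) irl => A irl.
rewrite expnD expnM (expnD 2 15) mulnA.
apply: leq_mul; last first.
  rewrite leq_exp2r; last by move: r2; clear; lia.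
  by rewrite expnD leq_mul.
rewrite mulnA; apply: leq_mul; first by vm_compute.
have -> : 6 * lam = 2 * lam * 3 by clear; lia.
by rewrite expnM leq_exp2r.
Qed.

(** For [p = C n^(-1/(2r))] one has [n p^(2r) = C^(2r)], while Hall's condition asks for [2^18 r^4]
    times the reservoir ratio; [C = 2^9 r^5] is enough. *)
Lemma density_constant : 2 ^ 18 * r ^ 4 * reservoir_ratio <= (2 ^ 9 * r ^ 5) ^ (2 * r).
Proof.
have E1 : 2 ^ 18 * r ^ 4 * reservoir_ratio = 2 ^ (40 + 7 * r.-1) * r ^ (6 + r.-1).
  have key (a b c d f g : nat) : a * b * (c * d * (f * g)) = a * c * f * (b * d * g).
    by rewrite (mulnACA c) mulnACA !mulnA.
  have -> : 40 + 7 * r.-1 = 18 + 22 + 7 * r.-1 by [].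
  have -> : 6 + r.-1 = 4 + 2 + r.-1 by [].
  rewrite /reservoir_ratio expnMn key 4!expnD; congr (_ * _ * _).
  by rewrite expnM.
rewrite E1 expnMn -!expnM.
have [e1 e2] : 40 + 7 * r.-1 <= 9 * (2 * r) + (4 + 9 * r.-1) /\
    5 * (2 * r) = (4 + 9 * r.-1) + (6 + r.-1) by move: r2; clear; lia.
rewrite e2 (expnD r (4 + 9 * r.-1)) mulnA leq_mul2r; apply/orP; right.
apply: (@leq_trans (2 ^ (9 * (2 * r) + (4 + 9 * r.-1)))); first by rewrite leq_exp2l.
by rewrite expnD leq_mul2l leq_exp2r ?r2 ?orbT.
Qed.

Lemma indep_bound_eq b a :
  2 * indep_bound r b a = (3 * b + 72 + 8 * r) * (r * (a * a.+1)) + a * (4 * r + 6).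
Proof.
rewrite /indep_bound; elim: a => [|a IH]; first by rewrite big_ord0 !muln0.
rewrite big_ord_recr /= mulnDr IH /stage; clear; nia.
Qed.

Lemma cover_number_le (R : realType) :
  (cover_number%:R <= 1000 * r%:R ^+ 4 * ln (r%:R : R))%R.
Proof.
have lam1 : 0 < lam by rewrite up_log_gt0.
(* A lower bound for the binary logarithm of [r]; the maximum takes care of [r = 2]. As
   [ln 2 >= 5 / 8], a bound [625 r^4 kap] gives the constant [1000]. *)
pose kap := maxn 1 lam.-1.
have kapln : (5 / 8 * kap%:R <= ln (r%:R : R))%R.
  have : 2 ^ kap <= r.
    rewrite /kap /maxn; case: ifP => // _; apply: ltnW; exact: up_log_gtn.
  rewrite -(ler_nat R) => h.
  have ln2 : (5 / 8 <= ln (2 : R))%R.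
    by rewrite -[leLHS]expRK ler_ln ?posrE ?expR_gt0 // expR_le2.
  apply: le_trans (_ : ln ((2 ^ kap)%:R : R) <= _)%R; last first.
    by rewrite ler_ln // posrE ltr0n ?expn_gt0 // (ltn_trans _ r2).
  by rewrite natrX lnXn // -[leRHS]mulr_natr ler_wpM2r.
have lamk : lam <= kap.+1 by rewrite /kap; clear; lia.
have kap1 : 0 < kap by rewrite /kap leq_maxl.
have [m rE] : exists m, r = m.+2 by exists r.-2; move: r2; clear; lia.
have [j kE] : exists j, kap = j.+1 by exists kap.-1; rewrite prednK.
have nat_bound : cover_number <= 625 * r ^ 4 * kap.
  have lamj : lam <= j.+2 by rewrite -kE.
  have r1 : r.-1 = m.+1 by rewrite rE.
  have b_le : shrink_log <= 35 + 8 * j + 8 * m + 2 * (j * m).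
    rewrite /shrink_log -/lam r1; move: lam lamj; clear; nia.
  have bb_le : greedy_log <= 42 + 4 * j + 9 * m + j * m.
    rewrite /greedy_log -/lam r1; move: lam lamj; clear; nia.
  have := indep_bound_eq shrink_log r; rewrite /cover_number.
  move: shrink_log greedy_log (indep_bound _ _ _) b_le bb_le => b bb f b_le bb_le fE.
  rewrite -(leq_pmul2l (isT : 0 < 2)).
  have -> : 2 * (5 * f + 36 * r * bb + r * (20 * r + 1) + 1) =
      5 * (2 * f) + 72 * r * bb + 2 * r * (20 * r + 1) + 2 by clear; lia.
  rewrite fE kE rE.
  apply: (@leq_trans (5 * ((3 * (35 + 8 * j + 8 * m + 2 * (j * m)) + 72 + 8 * m.+2) *
      (m.+2 * (m.+2 * m.+3)) + m.+2 * (4 * m.+2 + 6)) +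
      72 * m.+2 * (42 + 4 * j + 9 * m + j * m) + 2 * m.+2 * (20 * m.+2 + 1) + 2)).
    by do ![apply: leq_add => //|apply: leq_mul => //].
  rewrite !expnS expn0; clear; nia.
move: nat_bound; rewrite -(ler_nat R) => /le_trans; apply.
rewrite natrM natrM natrX; have r4 : (0 <= r%:R ^+ 4 :> R)%R by rewrite exprn_ge0.
by have := ler_wpM2l r4 kapln; lra.
Qed.

End Constants.

Local Open Scope ring_scope.

(** * Properties of a random graph that fail with probability of order [1 / n] *)

Section Likely.
Variables (R : realType) (T : finType) (p L : R).
Local Notation n := #|T|.
Hypothesis p0 : 0 < p.
Hypothesis p1 : p <= 1.
Hypothesis n0 : (0 < n)%N.
Hypothesis nL : expR L = n%:R.
Hypothesis L1 : 1 <= L.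

(* [H] fails only if one of [j] events of probability at most [2 e^2 / n] occurs. *)
Definition likely (j : nat) (H : {set {set T}} -> Prop) : Prop :=
  exists bad : pred {set {set T}},
    prob (two_sets T) p bad <= j%:R * (2 * expR 1 * expR 1 / n%:R) /\
    forall G : {set {set T}}, G \subset two_sets T -> ~~ bad G -> H G.

Lemma likely_and i j H H' : likely i H -> likely j H' -> likely (i + j) (fun G => H G /\ H' G).
Proof.
move=> [b1 [h1 k1]] [b2 [h2 k2]].
pose bad G := [exists b : bool, (if b then b1 else b2) G].
exists bad; split; last first.
  move=> G GD nb; split; [apply: k1|apply: k2] => //; apply: contra nb => b.
    by apply/existsP; exists true.
  by apply/existsP; exists false.
apply: le_trans (prob_union _ (ltW p0) p1 _) _.
by rewrite big_bool natrD mulrDl lerD.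
Qed.

Lemma likely_sub j (H H' : {set {set T}} -> Prop) : (forall G, H G -> H' G) -> likely j H -> likely j H'.
Proof. by move=> HH [bad [h k]]; exists bad; split=> // G GD nb; apply/HH/k. Qed.

Lemma likely_many g (ok : {set {set T}} -> {set T} -> bool) (t : {set {set T}} -> {set T} -> nat) :
  (0 < g)%N ->
  (forall F Q, uniform_family g F -> ok F Q -> crowded p L g F Q (t F Q)) ->
  likely 1 (fun G => forall F Q, uniform_family g F -> ok F Q -> (comm_count G F Q <= 2 * t F Q)%N).
Proof.
move=> g0 hok; exists (fun G => [exists F, exists Q,
     [&& uniform_family g F, ok F Q & (2 * t F Q < comm_count G F Q)%N]]); split.
  by rewrite mul1r; apply: many_common_unlikely (ltW p0) p1 g0 n0 nL _ _ hok.
move=> G GD /existsPn nb F Q fF okFQ; rewrite leqNgt.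
by have /existsPn/(_ Q) := nb F; rewrite fF okFQ.
Qed.

Lemma likely_few g (ok : {set {set T}} -> {set T} -> bool) (lam : {set T} -> R) (pQ : pred {set T})
    (t : {set {set T}} -> {set T} -> nat) : (0 < g)%N ->
  \sum_(Q | pQ Q) expR (- lam Q) <= expR 1 ->
  (forall F Q, uniform_family g F -> ok F Q ->
     [/\ pQ Q, [disjoint cover F & Q] & rich p L g F Q lam (t F Q)]) ->
  likely 1 (fun G => forall F Q, uniform_family g F -> ok F Q -> (t F Q < comm_count G F Q)%N).
Proof.
move=> g0 hc hok; exists (fun G => [exists F, exists Q,
     [&& uniform_family g F, ok F Q & (comm_count G F Q <= t F Q)%N]]); split.
  apply: le_trans (few_common_unlikely (ltW p0) p1 g0 n0 nL (expR_ge0 1) hc hok) _.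
  rewrite mul1r ler_wpM2r ?invr_ge0 // -mulrA ler_peMl ?mulr_ge0 ?expR_ge0 //.
  by rewrite ler1n.
move=> G GD /existsPn nb F Q fF okFQ; rewrite ltnNge.
by have /existsPn/(_ Q) := nb F; rewrite fF okFQ.
Qed.

(** Edge counts are the case [g = 1] of counting common neighbours. *)
Definition singletons (X : {set T}) : {set {set T}} := [set [set x] | x in X].

Lemma cover_singletons X : cover (singletons X) = X.
Proof.
apply/setP=> x; apply/bigcupP/idP=> [[_ /imsetP[y yX ->]]|xX]; first by rewrite inE => /eqP->.
by exists [set x]; [apply: imset_f|rewrite inE].
Qed.

Lemma card_singletons X : #|singletons X| = #|X|.
Proof. by apply: card_imset; apply: set1_inj. Qed.

Lemma family_singletons X : X != set0 -> uniform_family 1 (singletons X).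
Proof.
case/set0Pn=> x xX; apply/and3P; split.
- rewrite /trivIset cover_singletons (eq_bigr (fun _ => 1%N)) ?sum1_card ?card_singletons //.
  by move=> _ /imsetP[y _ ->]; rewrite cards1.
- by apply/set0Pn; exists [set x]; apply: imset_f.
- by apply/forall_inP=> _ /imsetP[y _ ->]; rewrite cards1.
Qed.

Lemma comm_count_singletons G X Y : comm_count G (singletons X) Y = ecount (gadj G) X Y.
Proof.
rewrite /comm_count big_imset /=; last by move=> x y _ _ /set1_inj.
apply: eq_bigr => x _; rewrite degE; apply: eq_card => y; rewrite !inE /star imset_set1.
by rewrite sub1set.
Qed.

Variable s : nat.
Hypothesis s_large : 80 * L <= p * s%:R.

Let s0 : (0 < s)%N.
Proof. by rewrite lt0n; apply/eqP=> s_eq; move: s_large L1; rewrite s_eq mulr0; lra. Qed.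

(** With [t] about [2 p |F| (|Q| + s)] the allowance [5 / 8 * t] exceeds the mean by a quarter,
    which pays for the choice of [Q]; the summand [s] pays for [F]. *)
Lemma likely_edges_le : likely 1 (fun G => forall X Y : {set T}, (s <= #|X|)%N ->
  (ecount (gadj G) X Y)%:R <= 4 * p * #|X|%:R * (#|Y| + s)%:R).
Proof.
pose t (F : {set {set T}}) (Q : {set T}) := Num.truncn (2 * p * #|F|%:R * (#|Q| + s)%:R).
have tP F Q : (t F Q)%:R <= 2 * p * #|F|%:R * (#|Q| + s)%:R < (t F Q).+1%:R.
  by apply: truncn_itv; rewrite !mulr_ge0 // ltW.
apply: likely_sub (likely_many (g := 1) (ok := fun F _ => (s <= #|F|)%N) (t := t) isT _).
  move=> G h X Y sX.
  have X0 : X != set0.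
    by rewrite -card_gt0; apply: leq_trans sX.
  have := h _ Y (family_singletons X0); rewrite card_singletons comm_count_singletons => /(_ sX).
  rewrite -(ler_nat R) natrM => /le_trans; apply.
  by have /andP[] := tP (singletons X) Y; rewrite card_singletons; lra.
move=> F Q fF sF; rewrite /crowded expr1.
have /andP[_] := tP F Q; rewrite -natr1 (natrD _ #|Q| s).
have pF : 80 * L <= p * #|F|%:R.
  by apply: le_trans s_large _; rewrite ler_wpM2l ?ler_nat // ltW.
have h1 : 0 <= (p * #|F|%:R - 80 * L) * #|Q|%:R by rewrite mulr_ge0 // subr_ge0.
have h2 : 0 <= (p * s%:R - 80 * L) * #|F|%:R by rewrite mulr_ge0 // subr_ge0.
have F1 : 1 <= #|F|%:R :> R by rewrite ler1n card_gt0; case/and3P: fF.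
have h3 : L <= L * #|F|%:R by rewrite ler_peMr // (le_trans ler01).
have h4 : 0 <= L * #|Q|%:R by rewrite mulr_ge0 // (le_trans ler01).
by move: L1; lra.
Qed.

Lemma likely_edges_ge : likely 1 (fun G => forall X Y : {set T}, [disjoint X & Y] ->
  (s <= #|X|)%N -> (s <= #|Y|)%N ->
  3 / 5 * p * #|X|%:R * #|Y|%:R <= (ecount (gadj G) X Y)%:R).
Proof.
pose t (F : {set {set T}}) (Q : {set T}) := Num.truncn (3 / 5 * p * #|F|%:R * #|Q|%:R).
have tP F Q : (t F Q)%:R <= 3 / 5 * p * #|F|%:R * #|Q|%:R < (t F Q).+1%:R.
  by apply: truncn_itv; rewrite !mulr_ge0 ?invr_ge0 // ltW.
pose ok (F : {set {set T}}) (Q : {set T}) := [&& (s <= #|F|)%N, (s <= #|Q|)%N & [disjoint cover F & Q]].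
apply: likely_sub (likely_few (g := 1) (ok := ok) (t := t) (pQ := predT)
    (lam := fun Q => 2 * #|Q|%:R * L) isT (sum_sets n0 nL) _).
  move=> G h X Y dXY sX sY.
  have X0 : X != set0.
    by rewrite -card_gt0; apply: leq_trans sX.
  have := h _ Y (family_singletons X0).
  rewrite /ok card_singletons comm_count_singletons cover_singletons sX sY => /(_ dXY).
  rewrite -(ler_nat R) => /(le_trans _); apply.
  by have /andP[_ /ltW] := tP (singletons X) Y; rewrite card_singletons.
move=> F Q fF /and3P[sF sQ dFQ]; split=> //; rewrite /rich expr1.
have /andP[+ _] := tP F Q.
have pF : 80 * L <= p * #|F|%:R.
  by apply: le_trans s_large _; rewrite ler_wpM2l ?ler_nat // ltW.
have pQ : 80 * L <= p * #|Q|%:R.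
  by apply: le_trans s_large _; rewrite ler_wpM2l ?ler_nat // ltW.
have h1 : 0 <= (p * #|F|%:R - 80 * L) * #|Q|%:R by rewrite mulr_ge0 // subr_ge0.
have h2 : 0 <= (p * #|Q|%:R - 80 * L) * #|F|%:R by rewrite mulr_ge0 // subr_ge0.
by lra.
Qed.

(** The lower tail wants [Q] disjoint from the family, so [S] is tested against [W :\: S]. There are
    at most [n^g] such sets, hence the charge [g L]. *)
Lemma likely_rich g (W : {set T}) (t : nat) : (0 < g)%N ->
  3 / 4 * t%:R + 3 * g%:R * L <= (#|W|%:R - g%:R) * p ^+ g / 2 ->
  likely 1 (fun G => forall S : {set T}, #|S| = g -> (t < #|comm G S W|)%N).
Proof.
move=> g0 ht.
pose Qs := [set W :\: S | S in [set S : {set T} | #|S| == g]].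
pose ok (F : {set {set T}}) (Q : {set T}) := (#|F| == 1%N) && (Q == W :\: cover F).
apply: likely_sub (likely_few (g := g) (ok := ok) (t := fun _ _ => t) (pQ := mem Qs)
    (lam := fun Q => g%:R * L) g0 _ _).
- move=> G h S cS.
  have fS : uniform_family g [set S].
    apply/and3P; split.
    + by rewrite /trivIset /cover !big_set1.
    + by apply/set0Pn; exists S; rewrite inE.
    + by apply/forall_inP=> S'; rewrite inE => /eqP->; rewrite cS.
  have := h _ (W :\: S) fS; rewrite /ok cards1 /cover big_set1 !eqxx /comm_count big_set1.
  move/(_ isT)/leq_trans; apply; apply/subset_leq_card/subsetP=> w.
  by rewrite !inE => /andP[/andP[_ ->]].
- rewrite sumr_const -mulrN expRM_natl expRN nL -[_ *+ _]mulr_natr.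
  have gT : 0 < n%:R ^+ g :> R by rewrite exprn_gt0 // ltr0n.
  apply: (@le_trans _ _ 1); last by rewrite -[leLHS]expR0 ler_expR.
  rewrite exprVn mulrC ler_pdivrMr // mul1r -natrX ler_nat.
  apply: leq_trans (leq_imset_card _ _) _; apply: leq_trans (bin_le_exp _ _).
  by rewrite -cardsT -cards_draws; apply/subset_leq_card/subsetP=> S; rewrite !inE subsetT.
- move=> F Q /and3P[tF _ /forall_inP cF] /andP[/cards1P[S FE] /eqP QE].
  have cS : #|S| = g by apply/eqP/cF; rewrite FE inE.
  have cv : cover F = S by rewrite FE /cover big_set1.
  split.
  + by rewrite QE cv; apply/imsetP; exists S => //; rewrite inE cS.
  + by rewrite QE -setI_eq0; apply/eqP/setP=> x; rewrite !inE; case: (x \in cover F).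
  + rewrite /rich FE cards1 QE cv mulr1 mul1r.
    have : #|W|%:R - g%:R <= #|W :\: S|%:R :> R.
      rewrite lerBlDr -natrD ler_nat -cS cardsD.
      have := subset_leq_card (subsetIr W S); have := subset_leq_card (subsetIl W S).
      by move: #|W :&: S| #|W| #|S|; clear; lia.
    move/(ler_wpM2r (exprn_ge0 g (ltW p0))) => h.
    by move: ht h; lra.
Qed.

(** Every [Q] is charged [n], since [2^n exp(-n) <= 1]. This leads to [ell] of order [n / (u p^g)],
    that is [p^-g] for a reservoir of linear size. *)
Lemma likely_few_poor g (u mu ell : nat) : (0 < g)%N ->
  mu%:R <= u%:R * p ^+ g / 2 -> 16 * g%:R * n%:R <= ell%:R * (u%:R * p ^+ g) ->
  32 * g%:R * L <= u%:R * p ^+ g ->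
  likely 1 (fun G => forall F (U : {set T}), uniform_family g F -> #|U| = u ->
    [disjoint cover F & U] -> (forall S, S \in F -> (#|comm G S U| < mu)%N) -> (#|F| * g <= ell)%N).
Proof.
move=> g0 hmu hell hL.
pose ok (F : {set {set T}}) (Q : {set T}) :=
  [&& #|Q| == u, [disjoint cover F & Q] & (ell < #|F| * g)%N].
apply: likely_sub (likely_few (g := g) (ok := ok) (t := fun F _ => (#|F| * mu)%N) (pQ := predT)
    (lam := fun Q => n%:R) g0 _ _).
- move=> G h F U fF cU dFU poor; rewrite leqNgt; apply/negP=> big.
  have := h F U fF; rewrite /ok cU eqxx dFU big => /(_ isT); apply/negP; rewrite -leqNgt.
  rewrite -sum_nat_const; apply: leq_sum => S SF; exact/ltnW/poor.
- rewrite (eq_bigl (fun Q => Q \in powerset [set: T])) => [|Q]; last by rewrite powersetE subsetT.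
  rewrite sumr_const card_powerset cardsT -[_ *+ _]mulr_natr natrX.
  apply: (@le_trans _ _ 1); last by rewrite -[leLHS]expR0 ler_expR.
  rewrite expRN mulrC ler_pdivrMr ?expR_gt0 // mul1r.
  rewrite -[n%:R in leRHS]mulr1 expRM_natl; apply: lerXn2r; rewrite ?nnegrE ?expR_ge0 //.
  by apply: le_trans (expR_ge1Dx 1); lra.
- move=> F Q fF /and3P[/eqP cQ dFQ big]; split=> //; rewrite /rich cQ natrM.
  have F0 : 0 <= #|F|%:R :> R by [].
  have h1 := ler_wpM2l F0 hmu; have h2 := ler_wpM2l F0 hL.
  have h3 : n%:R * 16 <= #|F|%:R * (u%:R * p ^+ g).
    rewrite -(ler_pM2r (_ : 0 < g%:R)) ?ltr0n // mulrAC [leRHS]mulrAC -(natrM _ #|F| g).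
    apply: le_trans (_ : ell%:R * (u%:R * p ^+ g) <= _); first by move: hell; lra.
    by apply: ler_wpM2r; [rewrite mulr_ge0 // exprn_ge0 // ltW|rewrite ler_nat ltnW].
  by lra.
Qed.

(** [rho] is chosen so that the cost of [Q] is at most an eighth of [|F| mq]; with the mean and the
    cost of [F] this makes three eighths. *)
Lemma likely_few_crowded g (ell mq : nat) (rho : R) : (0 < g)%N -> (0 < mq)%N ->
  ell%:R * p ^+ g <= mq%:R / 8 -> 2 * g%:R * L <= mq%:R / 8 ->
  rho = mq%:R / (16 * g%:R * L) ->
  likely 1 (fun G => forall F (Q : {set T}), uniform_family g F -> (#|Q| <= ell)%N ->
    (forall S, S \in F -> (4 * mq <= #|comm G S Q|)%N) -> rho * (#|F| * g)%:R <= #|Q|%:R).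
Proof.
move=> g0 mq0 hell hL rhoE.
have L0 : 0 < L by apply: lt_le_trans L1.
pose ok (F : {set {set T}}) (Q : {set T}) := (#|Q| <= ell)%N && (#|Q|%:R < rho * (#|F| * g)%:R).
apply: likely_sub (likely_many (g := g) (ok := ok) (t := fun F _ => (#|F| * mq)%N) g0 _).
  move=> G h F Q fF cQ full; rewrite leNgt; apply/negP=> big.
  have := h F Q fF; rewrite /ok cQ big => /(_ isT).
  have : (#|F| * (4 * mq) <= comm_count G F Q)%N.
    by rewrite -sum_nat_const; apply: leq_sum => S SF; apply: full.
  have : (0 < #|F| * mq)%N by rewrite muln_gt0 mq0 card_gt0 andbT; case/and3P: fF.
  rewrite mulnCA; move: (#|F| * mq)%N (comm_count _ _ _); clear; lia.
move=> F Q fF /andP[cQ small]; rewrite /crowded natrM.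
have F0 : 0 <= #|F|%:R :> R by [].
have h1 : #|Q|%:R * p ^+ g <= mq%:R / 8.
  by apply: le_trans hell; rewrite ler_wpM2r ?ler_nat // exprn_ge0 // ltW.
have {}h1 := ler_wpM2l F0 h1; have h2 := ler_wpM2l F0 hL.
have h3 : #|Q|%:R * L <= #|F|%:R * mq%:R / 16.
  have := ler_wpM2r (ltW L0) (ltW small); rewrite rhoE natrM.
  suff -> : mq%:R / (16 * g%:R * L) * (#|F|%:R * g%:R) * L = #|F|%:R * mq%:R / 16 by [].
  by field; rewrite pnatr_eq0 -lt0n g0 gt_eqF.
have h4 : 0 <= #|F|%:R * mq%:R :> R by rewrite mulr_ge0.
by lra.
Qed.

(** The [10 L] per pair in [F] is [6 L] for the choice of at most three vertices of [Q] and [4 L]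
    for the pair. *)
Lemma likely_sparse (E dq : nat) : (0 < dq)%N ->
  3 * E%:R * p ^+ 2 + 10 * L <= 5 / 8 * dq%:R ->
  likely 1 (fun G => forall F (Z : {set T}), uniform_family 2 F -> (#|F| <= E)%N ->
    [disjoint cover F & Z] -> (#|Z| <= 3 * #|F|)%N ->
    exists2 S, S \in F & (#|comm G S Z| < 4 * dq)%N).
Proof.
move=> dq0 hE.
have L0 : 0 < L by apply: lt_le_trans L1.
pose ok (F : {set {set T}}) (Q : {set T}) := (#|F| <= E)%N && (#|Q| <= 3 * #|F|)%N.
apply: likely_sub (likely_many (g := 2) (ok := ok) (t := fun F _ => (#|F| * dq)%N) isT _).
  move=> G h F Z fF cF _ cZ; apply/exists_inP; rewrite -[X in is_true X]negbK negb_exists_in.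
  apply/negP=> /forall_inP full.
  have := h F Z fF; rewrite /ok cF cZ => /(_ isT).
  have : (#|F| * (4 * dq) <= comm_count G F Z)%N.
    by rewrite -sum_nat_const; apply: leq_sum => S SF; rewrite leqNgt full.
  have : (0 < #|F| * dq)%N by rewrite muln_gt0 dq0 card_gt0 andbT; case/and3P: fF.
  rewrite mulnCA; move: (#|F| * dq)%N (comm_count _ _ _); clear; lia.
move=> F Q fF /andP[cF cQ]; rewrite /crowded natrM.
have F0 : 0 <= #|F|%:R :> R by [].
have p2 : 0 <= p ^+ 2 by rewrite exprn_ge0 // ltW.
have h0 : #|Q|%:R <= 3 * #|F|%:R :> R by rewrite -natrM ler_nat.
have h1 : #|Q|%:R * p ^+ 2 <= 3 * E%:R * p ^+ 2.
  by rewrite ler_wpM2r // (le_trans h0) // ler_wpM2l // ler_nat.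
have {}h1 := ler_wpM2l F0 h1; have h2 := ler_wpM2l F0 hE.
have h3 := ler_wpM2r (ltW L0) h0.
by lra.
Qed.

End Likely.

Theorem likely_cover (R : realType) (T : finType) (r : nat) (p L xmin rho : R)
    (k s u mq mu dq1 dq2 ell n1 b bb : nat) :
  (2 <= r)%N -> 0 < p -> p <= 1 -> (0 < #|T|)%N -> expR L = #|T|%:R -> 1 <= L ->
  (0 < k)%N -> (5 * k <= #|T|)%N -> 80 * L <= p * s%:R ->
  6 * mq%:R + 3 * r.+1%:R * L <= (k%:R - r.+1%:R) * p ^+ r.+1 / 2 ->
  mu%:R <= u%:R * p ^+ r.+1 / 2 -> 16 * r.+1%:R * #|T|%:R <= ell%:R * (u%:R * p ^+ r.+1) ->
  32 * r.+1%:R * L <= u%:R * p ^+ r.+1 ->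
  (0 < mq)%N -> ell%:R * p ^+ r.+1 <= mq%:R / 8 -> 2 * r.+1%:R * L <= mq%:R / 8 ->
  rho = mq%:R / (16 * r.+1%:R * L) ->
  (0 < dq1)%N -> 3 * ell%:R * p ^+ 2 + 10 * L <= 5 / 8 * dq1%:R ->
  (0 < dq2)%N ->
  3 * (s + r * ((20 * r + 1) * s.*2.-1 + s.-1))%N%:R * p ^+ 2 + 10 * L <= 5 / 8 * dq2%:R ->
  (r * r * r.+1 * dq1 <= mq)%N -> (r * r * r.+1 * (4 * dq2) <= mu)%N ->
  xmin * (128 * r%:R) ^+ r <= 128 * r%:R * k%:R ->
  s%:R <= p / (8 * r%:R) * (p / (8 * r%:R)) * xmin / 8 ->
  6 <= s%:R * (p / (8 * r%:R)) ->
  1 + 12 * (128 * r%:R + 1) * (u%:R + s%:R) <= xmin / (256 * r%:R) ->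
  (20 * r * (20 * r ^ 2 + r + 2 * s) <= u)%N -> (20 * r * n1 <= u)%N ->
  (864 * r * s <= n1)%N -> s%:R <= p / (8 * r%:R) * n1%:R ->
  (#|T| <= 2 ^ bb * n1)%N ->
  (forall i, (0 < i)%N -> (i <= r)%N -> (2 * shrink r (i * r) <= 2 ^ b)%N) ->
  ell%:R < (4 * mq)%N%:R * rho ^+ 3 ->
  likely p 11 (fun G => forall c : {set T} -> 'I_r,
    cpart (ecol G c) setT (5 * indep_bound r b r + 36 * r * bb + r * (20 * r + 1) + 1)).
Proof.
move=> r2 p0 p1 n0 nL L1 k0 k5 hs hm hmu hell hu mq0 hellm hLm rhoE dq10 h61 dq20 h62 hd1 hd2
  hV c1 c2 c8 hu2 hn1 hn1s hn1p hT hb hellrho.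
have L0 : 0 < L by apply: lt_le_trans L1.
have s0 : (0 < s)%N.
  by rewrite -(ltr_nat R) -(pmulr_rgt0 _ p0); apply: lt_le_trans hs; rewrite mulr_gt0.
(* [W 0] houses the absorber, [W 1] to [W 4] provide the connectors of the four levels. *)
have [W [Wd Wc]] := disjoint_regions k0 k5.
have rich i : (i < 4)%N -> likely p 1 (fun G => forall S : {set T}, #|S| = r.+1 ->
    (8 * mq < #|comm G S (W i.+1)|)%N).
  move=> i4; apply: (likely_rich p0 p1 n0 nL (g := r.+1)) => //.
  by rewrite Wc // natrM; move: hm; lra.
have ev := likely_and p0 p1 (likely_edges_le p0 p1 n0 nL L1 hs) (likely_edges_ge p0 p1 n0 nL L1 hs).
have {}ev := likely_and p0 p1 ev (likely_few_poor p0 p1 n0 nL (ltn0Sn r) hmu hell hu).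
have {}ev := likely_and p0 p1 ev (likely_few_crowded p0 p1 n0 nL L1 (ltn0Sn r) mq0 hellm hLm rhoE).
have {}ev := likely_and p0 p1 ev (likely_sparse p0 p1 n0 nL L1 dq10 h61).
have {}ev := likely_and p0 p1 ev (likely_sparse p0 p1 n0 nL L1 dq20 h62).
have {}ev := likely_and p0 p1 ev (rich 0%N isT).
have {}ev := likely_and p0 p1 ev (rich 1%N isT).
have {}ev := likely_and p0 p1 ev (rich 2%N isT).
have [bad [hbad evG]] := likely_and p0 p1 ev (rich 3%N isT).
exists bad; split; first by apply: le_trans hbad _; rewrite ler_wpM2r ?ler_nat // divr_ge0 // !mulr_ge0 // expR_ge0.
move=> G GD nb c; have [[[[[[[[[h1 h2] h3] h4] h5] h6] r0] r1] r2'] r3] := evG G GD nb.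
apply: (@gnp_cover T r G c GD r2 R p s p0 p1 s0 h1 h2 (W 0%N) (fun i => W i.+1) xmin rho u (4 * mq)
  (4 * dq1) (4 * dq2) mu ell n1 b bb) => //.
- by move=> i j ij; apply: Wd; rewrite neq_ltn ltnS ij.
- by move=> i; apply: Wd.
- by rewrite Wc.
- by rewrite muln_gt0.
- by rewrite muln_gt0.
- by rewrite mulnCA leq_mul2l hd1.
- by rewrite rhoE divr_gt0 ?ltr0n // !mulr_gt0 ?ltr0n.
- move=> [|[|[|[|//]]]] S _ cS; rewrite mulnA; apply: ltnW; [exact: r0|exact: r1|exact: r2'|exact: r3].
Qed.

(** * Choice of the sizes *)

Lemma divn_bounds (R : realType) (m d : nat) : (0 < d)%N ->
  m%:R / d%:R - 1 <= (m %/ d)%:R :> R /\ (m %/ d)%:R <= m%:R / d%:R :> R.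
Proof.
move=> d0; have dR : 0 < d%:R :> R by rewrite ltr0n.
rewrite lerBlDr !(ler_pdivrMr, ler_pdivlMr) // natr1 -!natrM !ler_nat.
by rewrite leq_trunc_div ltnW // ltn_ceil.
Qed.

Lemma truncn_bounds (R : realType) (x : R) : 0 <= x -> x - 1 <= (Num.truncn x)%:R <= x.
Proof. by move/truncn_itv => /andP[-> h]; rewrite lerBlDr natr1 ltW. Qed.

(** The inequality that makes four levels sufficient: [ell < 4 m rho^3] multiplied out, with [ell P]
    at most [19 g D] and [rho = m / (16 g L)]. *)
Lemma level_sizes (R : realFieldType) (g q L x P D m : R) : 0 < q -> 0 < L -> 0 < P -> 1 <= D ->
  0 < x -> 0 <= g -> g <= 3 / 2 * q -> 2 ^+ 60 * q ^+ 4 * L ^+ 3 <= x ^+ 4 * P ->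
  x * D / 200 <= m -> 19 * g * D * (16 * g * L) ^+ 3 < 4 * m ^+ 4 * P.
Proof.
move=> q0 L0 P0 D1 x0 g0 gq hx hm.
have D0 : 0 < D by apply: lt_le_trans D1.
have m4 : (x * D / 200) ^+ 4 <= m ^+ 4.
  have m0 : 0 <= x * D / 200 by rewrite divr_ge0 // mulr_ge0 // ltW.
  by apply: lerXn2r (hm); rewrite nnegrE //; apply: le_trans hm.
have g4 : g ^+ 4 <= (3 / 2 * q) ^+ 4.
  by apply: lerXn2r (gq); rewrite nnegrE //; apply: le_trans gq.
apply: lt_le_trans (_ : 4 * ((x * D / 200) ^+ 4 * P) <= _); last first.
  by rewrite -[leRHS]mulrA ler_wpM2l // ler_wpM2r // ltW.
apply: lt_le_trans (_ : 4 * (2 ^+ 60 * q ^+ 4 * L ^+ 3 * D / 200 ^+ 4) <= _); last first.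
  rewrite ler_wpM2l // expr_div_n exprMn [leRHS]mulrAC ler_wpM2r ?invr_ge0 ?exprn_ge0 //.
  rewrite [leRHS]mulrAC; apply: ler_pM => //; rewrite ?(ltW D0) //.
    by rewrite !mulr_ge0 ?exprn_ge0 // ltW.
  by rewrite exprS ler_peMr ?(ltW D0) // exprn_ege1.
rewrite mulrA ltr_pdivlMr ?exprn_gt0 //.
have -> : 19 * g * D * (16 * g * L) ^+ 3 * 200 ^+ 4 =
    19 * 16 ^+ 3 * 200 ^+ 4 * (g ^+ 4 * (D * L ^+ 3)) by ring.
have -> : 4 * (2 ^+ 60 * q ^+ 4 * L ^+ 3 * D) = 4 * 2 ^+ 60 * (q ^+ 4 * (D * L ^+ 3)) by ring.
have z0 : 0 < D * L ^+ 3 by rewrite mulr_gt0 // exprn_gt0.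
apply: le_lt_trans (_ : 19 * 16 ^+ 3 * 200 ^+ 4 * (3 / 2) ^+ 4 * (q ^+ 4 * (D * L ^+ 3)) < _).
  rewrite -[leRHS]mulrA ler_wpM2l ?mulr_ge0 ?exprn_ge0 //.
  by rewrite [leRHS]mulrA -exprMn ler_wpM2r // ltW.
rewrite ltr_pM2r; last by rewrite mulr_gt0 // exprn_gt0.
by clear; lra.
Qed.

Section Sizes.
Variables (R : realType) (T : finType) (r D bb b : nat) (p L v A P x : R).
Local Notation q := (r%:R : R).
Local Notation n := #|T|.
Hypothesis r2 : (2 <= r)%N.
Hypothesis p0 : 0 < p.
Hypothesis p1 : p <= 1.
Hypothesis n0 : (0 < n)%N.
Hypothesis nL : expR L = n%:R.
Hypothesis D0 : (0 < D)%N.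
Hypothesis nE : n%:R = v * D%:R.
Hypothesis Ap : A * p = L.
Hypothesis PE : P = p ^+ r.+1.
Hypothesis xE : x = v * P.
Hypothesis DE : D%:R = 2 ^+ 22 * q ^+ 2 * (128 * q) ^+ r.-1.
Hypothesis L_large : 2 ^+ 60 * q ^+ 6 <= L.
Hypothesis v_large : 2 ^+ 60 * q ^+ 6 * L <= v * p ^+ 3.
Hypothesis x_large : 2 ^+ 60 * q ^+ 6 * L <= x.
Hypothesis dense : 2 ^+ 18 * q ^+ 4 <= v * p ^+ (2 * r).
Hypothesis levels : 2 ^+ 60 * q ^+ 4 * L ^+ 3 <= x ^+ 4 * P.
Hypothesis bb_large : 25 * q * D%:R <= 2 ^+ bb.
Hypothesis b_large : forall i, (0 < i)%N -> (i <= r)%N -> (2 * shrink r (i * r) <= 2 ^ b)%N.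

Let q2 : 2 <= q. Proof. by rewrite ler_nat. Qed.
Let DR : 0 < D%:R :> R. Proof. by rewrite ltr0n. Qed.
Let P0 : 0 < P. Proof. by rewrite PE exprn_gt0. Qed.
Let P1 : P <= 1. Proof. by rewrite PE exprn_ile1 // ltW. Qed.

Let pw k i : (k <= 60)%N -> (i <= 6)%N -> 2 ^+ k * q ^+ i <= 2 ^+ 60 * q ^+ 6.
Proof.
move=> hk hi; have q1 : 1 <= q by move: q2; lra.
by apply: ler_pM; rewrite ?exprn_ge0 ?ler_weXn2l //; lra.
Qed.

Let L1 : 1 <= L.
Proof. by have := @pw 0 0 isT isT; rewrite !expr0 mulr1 => /le_trans; apply. Qed.

Let A0 : 0 < A. Proof. by rewrite -(pmulr_lgt0 _ p0) Ap; move: L1; lra. Qed.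

Let AL : L <= A. Proof. by rewrite -Ap ger_pMr. Qed.

Let vA : 2 ^+ 60 * q ^+ 6 * A <= v * p ^+ 2.
Proof.
rewrite -(ler_pM2r p0).
have -> : 2 ^+ 60 * q ^+ 6 * A * p = 2 ^+ 60 * q ^+ 6 * L by rewrite -Ap mulrA.
by apply: le_trans v_large _; rewrite -mulrA -exprSr.
Qed.

Let v0 : 0 < v. Proof. by rewrite -(pmulr_lgt0 _ DR) -nE ltr0n. Qed.

Let vA1 : 2 ^+ 60 * q ^+ 6 * A <= v.
Proof. by apply: le_trans vA _; rewrite ger_pMr // exprn_ile1 // ltW. Qed.

Let pwA k i : (k <= 60)%N -> (i <= 6)%N -> 2 ^+ k * q ^+ i * A <= v.
Proof.
move=> hk hi; apply: le_trans vA1; rewrite ler_wpM2r ?pw //.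
by apply: le_trans AL; move: L1; lra.
Qed.

Let pwL k i : (k <= 60)%N -> (i <= 6)%N -> 2 ^+ k * q ^+ i * L <= x.
Proof. by move=> hk hi; apply: le_trans x_large; rewrite ler_wpM2r ?pw //; move: L1; lra. Qed.

Let D_r : 2 ^+ 22 * q ^+ 2 <= D%:R.
Proof.
rewrite DE ler_peMr ?mulr_ge0 ?exprn_ge0 // exprn_ege1 //.
by move: q2; lra.
Qed.

Let D1 : 16 <= D%:R :> R.
Proof.
apply: le_trans D_r; apply: (@le_trans _ _ (2 ^+ 22 * 1)); first by rewrite !exprS expr0; lra.
by rewrite ler_wpM2l ?exprn_ge0 // exprn_ege1 //; move: q2; lra.
Qed.

(** Here [A = L / p], [v = n / D] is the reservoir size before rounding, and [x = v P] the typical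
    number of common neighbours of [r + 1] vertices in it. *)
Let s := (Num.truncn (80 * A)).+1.
Let k := (n %/ 5)%N.
Let u := (n %/ D)%N.
Let mq := Num.truncn (k%:R * P / 32).
Let mu := Num.truncn (u%:R * P / 2).
(** As [u] is about [n / D], this is of order [r D / P]. *)
Let ell := (Num.truncn (16 * r.+1%:R * n%:R / (u%:R * P))).+1.
Let dq1 := (mq %/ (r * r * r.+1))%N.
Let dq2 := (mu %/ (4 * (r * r * r.+1)))%N.
Let n1 := (u %/ (20 * r))%N.
Let xmin := k%:R / (128 * q) ^+ r.-1.
Let rho := mq%:R / (16 * r.+1%:R * L).

Let sP : 80 * A <= s%:R <= 81 * A.
Proof.
have A1 : 1 <= A by apply: le_trans L1 AL.
have /truncn_bounds/andP[h1 h2] : 0 <= 80 * A by lra.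
by rewrite /s -[(Num.truncn _).+1%:R]natr1; apply/andP; split; lra.
Qed.

Let vbig : 2 ^+ 20 <= v.
Proof.
apply: le_trans (_ : 2 ^+ 20 * q ^+ 0 * A <= _); last exact: pwA.
by rewrite expr0 mulr1 ler_peMr ?exprn_ge0 // (le_trans L1).
Qed.

Let e20 : 1000 <= 2 ^+ 20 :> R. Proof. by rewrite !exprS expr0; lra. Qed.

Let kP : n%:R / 6 <= k%:R :> R /\ k%:R <= n%:R / 5 :> R.
Proof.
have [h1 h2] := @divn_bounds R n 5 isT.
split=> //; apply: le_trans h1.
have : 1000 * 1 <= v * D%:R by rewrite ler_pM //; move: vbig e20 D1; lra.
by rewrite -nE; lra.
Qed.

Let uP : 9 / 10 * v <= u%:R <= v.
Proof.
have [] := @divn_bounds R n D D0; rewrite nE mulfK ?gt_eqF // -/u => h1 ->; rewrite andbT.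
by move: vbig e20 h1; lra.
Qed.

Let xbig : 2 ^+ 60 <= x.
Proof.
apply: le_trans (_ : 2 ^+ 60 * q ^+ 0 * L <= _); last exact: pwL.
by rewrite expr0 mulr1 ler_peMr ?exprn_ge0.
Qed.

Let e60 : 1000 <= 2 ^+ 60 :> R.
Proof. by apply: le_trans e20 _; rewrite ler_weXn2l //; lra. Qed.

Let xD : 1000 * D%:R <= x * D%:R.
Proof. by rewrite ler_wpM2r //; move: xbig e60; lra. Qed.

Let Dx : 16 * x <= x * D%:R.
Proof. by rewrite mulrC ler_wpM2l //; move: xbig e60; lra. Qed.

Let mqP : x * D%:R / 200 <= mq%:R /\ mq%:R <= x * D%:R / 160.
Proof.
have [h1 h2] := kP; rewrite nE in h1 h2.
have /truncn_bounds/andP[h3 h4] : 0 <= k%:R * P / 32 by rewrite divr_ge0 ?mulr_ge0 // ltW.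
have h5 := ler_wpM2r (ltW P0) h1; have h6 := ler_wpM2r (ltW P0) h2.
have E : x * D%:R = v * D%:R * P by rewrite xE mulrAC.
split; last by rewrite E; move: h4 h6; rewrite -/mq; lra.
by move: h3 h5 Dx xbig e60; rewrite -/mq E; lra.
Qed.

Let muP : x * (2 / 5) <= mu%:R /\ mu%:R <= u%:R * P / 2.
Proof.
have /andP[h1 h2] := uP.
have /truncn_bounds/andP[h3 h4] : 0 <= u%:R * P / 2 by rewrite divr_ge0 ?mulr_ge0 // ltW.
have h5 := ler_wpM2r (ltW P0) h1.
split; last by rewrite -/mu in h4.
by move: h3 h5 xbig e60; rewrite -/mu xE; lra.
Qed.

Let ellP : 16 * r.+1%:R * n%:R <= ell%:R * (u%:R * P) /\ ell%:R * P <= 19 * r.+1%:R * D%:R.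
Proof.
have /andP[h1 h2] := uP.
have u0 : 0 < u%:R :> R by move: v0 h1; lra.
have uP0 : 0 < u%:R * P by rewrite mulr_gt0.
have /truncn_bounds/andP[h3 h4] : 0 <= 16 * r.+1%:R * n%:R / (u%:R * P).
  by rewrite divr_ge0 ?mulr_ge0 // ltW.
split.
  rewrite -ler_pdivrMr // /ell -[(Num.truncn _).+1%:R]natr1.
  by move: h3; lra.
have h5 := ler_wpM2r (ltW P0) h4.
have h6 : 16 * r.+1%:R * n%:R / (u%:R * P) * P <= 18 * r.+1%:R * D%:R.
  rewrite invfM mulrA divfK ?gt_eqF // ler_pdivrMr // nE.
  have := ler_wpM2l (_ : 0 <= r.+1%:R * D%:R :> R) h1; rewrite mulr_ge0 // => /(_ isT).
  have : 0 <= r.+1%:R * D%:R * v by rewrite !mulr_ge0 // ltW.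
  by lra.
rewrite /ell -[(Num.truncn _).+1%:R]natr1 mulrDl mul1r.
have h7 : 1 <= r.+1%:R * D%:R :> R by rewrite -natrM ler1n muln_gt0.
by move: h5 h6 P1; lra.
Qed.

Let g2q : r.+1%:R <= 3 / 2 * q.
Proof. by rewrite -natr1; move: q2; lra. Qed.

Let rrg0 : (0 < r * r * r.+1)%N. Proof. by rewrite !muln_gt0 ltnS leq0n (ltn_trans _ r2). Qed.

Let G := q ^+ 2 * r.+1%:R.
Let GE : (r * r * r.+1)%N%:R = G. Proof. by rewrite !natrM /G expr2. Qed.
Let G0 : 0 < G. Proof. by rewrite -GE ltr0n. Qed.
Let Gq : G <= 2 * q ^+ 3.
Proof.
have : 0 <= q ^+ 2 by rewrite exprn_ge0.
move/ler_wpM2l/(_ _ _ g2q); rewrite -/G exprS => /le_trans; apply.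
have : 0 <= q ^+ 3 by rewrite exprn_ge0.
by rewrite !exprS expr0; lra.
Qed.

Let dq1P : x * D%:R / (250 * G) <= dq1%:R.
Proof.
have [h1 _] := @divn_bounds R mq _ rrg0; apply: le_trans h1; rewrite GE.
have [h2 _] := mqP.
have h3 : 1000 * G <= x.
  apply: le_trans (_ : 2 ^+ 11 * q ^+ 3 * L <= _); last exact: pwL.
  have q3 : 0 <= q ^+ 3 by rewrite exprn_ge0.
  have := ler_wpM2l q3 L1; move: Gq q3; rewrite [2 ^+ 11]exprS [2 ^+ 10]exprS !exprS expr0; lra.
rewrite lerBrDr ler_pdivlMr // mulrDl mul1r.
have -> : x * D%:R / (250 * G) * G = x * D%:R / 250 by field; rewrite gt_eqF.
by move: Dx G0; lra.
Qed.

Let dq2P : x / (16 * G) <= dq2%:R.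
Proof.
have g4 : (0 < 4 * (r * r * r.+1))%N by rewrite muln_gt0.
have [h1 _] := @divn_bounds R mu _ g4; apply: le_trans h1; rewrite natrM GE.
have [h2 _] := muP.
have h3 : 1000 * G <= x.
  apply: le_trans (_ : 2 ^+ 11 * q ^+ 3 * L <= _); last exact: pwL.
  have q3 : 0 <= q ^+ 3 by rewrite exprn_ge0.
  have := ler_wpM2l q3 L1; move: Gq q3; rewrite [2 ^+ 11]exprS [2 ^+ 10]exprS !exprS expr0; lra.
have G4 : 0 < 4 * G by move: G0; lra.
rewrite lerBrDr ler_pdivlMr // mulrDl mul1r.
have -> : x / (16 * G) * (4 * G) = x / 4 by field; rewrite gt_eqF.
by move: xbig e60 G0; lra.
Qed.

Let n1P : v * (1 / 25) <= q * n1%:R.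
Proof.
have r20 : (0 < 20 * r)%N by rewrite muln_gt0 (ltn_trans _ r2).
have q0 : 0 < q by move: q2; lra.
have [h1 _] := @divn_bounds R u _ r20.
have := ler_wpM2l (ltW q0) h1; rewrite natrM -/n1; apply: le_trans.
have -> : q * (u%:R / (20 * q) - 1) = u%:R / 20 - q by field; rewrite gt_eqF.
have : 2 ^+ 20 * q ^+ 1 * A <= v by exact: pwA.
have : q <= q * A by rewrite ler_peMr ?(ltW q0) // (le_trans L1).
have /andP[+ _] := uP.
by move: e20 A0 q0; rewrite expr1 => e20' A0' q0'; have := ler_wpM2r (ltW (mulr_gt0 q0' A0')) e20'; lra.
Qed.

Let e18 : 200 * 1000 <= 2 ^+ 18 :> R. Proof. by rewrite !exprS expr0; lra. Qed.
Let e22 : 4 * 1000 * 1000 <= 2 ^+ 22 :> R. Proof. by rewrite !exprS expr0; lra. Qed.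
Let e40 : 1000 * 1000 * 1000 * 1000 <= 2 ^+ 40 :> R. Proof. by rewrite !exprS expr0; lra. Qed.

Let xminP : 2 ^+ 22 * q ^+ 2 * v / 6 <= xmin.
Proof.
have E0 : 0 < (128 * q) ^+ r.-1 by rewrite exprn_gt0 //; move: q2; lra.
rewrite /xmin ler_pdivlMr //; have [+ _] := kP; rewrite nE DE.
by move: (_ ^+ r.-1) => E; lra.
Qed.

Let sL : 80 * L <= p * s%:R.
Proof. by have /andP[h _] := sP; have := ler_wpM2l (ltW p0) h; rewrite -Ap; lra. Qed.

Let q_pos : 0 < q. Proof. by move: q2; lra. Qed.

Let gL : 1000 * 1000 * (r.+1%:R * L) <= x.
Proof.
apply: le_trans (_ : 2 ^+ 40 * q ^+ 1 * L <= _); last exact: pwL.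
rewrite expr1 mulrA ler_wpM2r ?(le_trans ler01) //.
by have := ler_wpM2r (ltW q_pos) e40; move: g2q; lra.
Qed.

(* The only place where the constant in the hypothesis on [p] matters. *)
Let connectors_sparse : 3 * ell%:R * p ^+ 2 + 10 * L <= 5 / 8 * dq1%:R.
Proof.
have p2 : 0 <= p ^+ 2 by rewrite exprn_ge0 // ltW.
have x0 : 0 < x by move: xbig e60; lra.
(* The origin of the exponent [2 r]: [p^2 / P] is compared with [x = v P], and
   [P^2 = p^2 p^(2r)]. *)
have xP : 2 ^+ 18 * q ^+ 4 * p ^+ 2 <= x * P.
  apply: le_trans (ler_wpM2r p2 dense) _.
  rewrite xE PE -!mulrA -!exprD (_ : (2 * r + 2 = r.+1 + r.+1)%N) //.
  by clear; lia.
have [_ h1] := ellP.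
have h2 : ell%:R * p ^+ 2 * (2 ^+ 18 * q ^+ 4) <= 19 * r.+1%:R * D%:R * x.
  have := ler_wpM2l (ler0n R ell) xP; have := ler_wpM2r (ltW x0) h1.
  by lra.
have q4 : 0 < 2 ^+ 18 * q ^+ 4 by rewrite mulr_gt0 ?exprn_gt0.
have gg : 24 * 1000 * G * r.+1%:R <= 2 ^+ 18 * q ^+ 4.
  apply: le_trans (_ : 200 * 1000 * q ^+ 4 <= _); last first.
    by apply: ler_wpM2r e18; rewrite exprn_ge0 // ltW.
  have : r.+1%:R * r.+1%:R <= 3 / 2 * q * (3 / 2 * q) by apply: ler_pM.
  have q2' : 0 <= q ^+ 2 by rewrite exprn_ge0 // ltW.
  by move/(ler_wpM2l q2'); rewrite /G !exprS expr0; lra.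
have h3 : 24 * 1000 * G * (ell%:R * p ^+ 2) <= 19 * (x * D%:R).
  rewrite -(ler_pM2r q4).
  have xD0 : 0 <= 19 * (x * D%:R) by rewrite !mulr_ge0 // ltW.
  have := ler_wpM2l xD0 gg; have := ler_wpM2l (ltW G0) h2.
  by lra.
have h4 : 1000 * 1000 * (G * L) <= x.
  apply: le_trans (_ : 2 ^+ 40 * q ^+ 3 * L <= _); last exact: pwL.
  rewrite mulrA ler_wpM2r ?(le_trans ler01) //.
  have q3 : 0 <= q ^+ 3 by rewrite exprn_ge0 // ltW.
  by have := ler_wpM2r q3 e40; move: Gq q3; lra.
have h5 : 3 * (ell%:R * p ^+ 2) + 10 * L <= 5 / 8 * (x * D%:R / (250 * G)).
  rewrite [leRHS]mulrA ler_pdivlMr; last by move: G0; lra.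
  by move: Dx x0; lra.
by move: dq1P h5; lra.
Qed.

(** The leftover has [O(r^2 s)] vertices and [s p] is of order [L], so only [O(r^2 L)] has to be
    compared with [x]. *)
Let leftover_sparse :
  3 * (s + r * ((20 * r + 1) * s.*2.-1 + s.-1))%N%:R * p ^+ 2 + 10 * L <= 5 / 8 * dq2%:R.
Proof.
have p2 : 0 <= p ^+ 2 by rewrite exprn_ge0 // ltW.
have e2 : (s + r * ((20 * r + 1) * s.*2.-1 + s.-1) <= 50 * r ^ 2 * s)%N.
  apply: (@leq_trans (s + r * ((20 * r + 1) * (2 * s) + s))).
    by rewrite leq_add2l leq_mul2l leq_add ?orbT // ?leq_mul2l -?mul2n ?leq_pred ?orbT.
  have : (s * (4 + 3 * r) <= s * (10 * r ^ 2))%N by rewrite leq_mul2l; move: r2; clear; nia.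
  have : (s <= s * 4)%N by rewrite leq_pmulr.
  by rewrite -!mulnn; clear; nia.
have h0 : (s + r * ((20 * r + 1) * s.*2.-1 + s.-1))%N%:R <= 50 * q ^+ 2 * s%:R.
  by rewrite -natrX -!natrM ler_nat.
have /andP[_ hs] := sP.
have qq : 0 <= 50 * q ^+ 2 by rewrite mulr_ge0 // exprn_ge0 // ltW.
have h1 : (s + r * ((20 * r + 1) * s.*2.-1 + s.-1))%N%:R * p ^+ 2 <= 50 * q ^+ 2 * (81 * L).
  apply: le_trans (ler_wpM2r p2 h0) _.
  have -> : 50 * q ^+ 2 * s%:R * p ^+ 2 = 50 * q ^+ 2 * (s%:R * p ^+ 2) by rewrite mulrA.
  apply: ler_wpM2l => //.
  apply: le_trans (ler_wpM2r p2 hs) _; rewrite expr2.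
  have : L * p <= L by rewrite ger_pMr // (lt_le_trans ltr01).
  by rewrite -Ap; lra.
have h4 : 1000 * 1000 * (G * q ^+ 2 * L) <= x.
  apply: le_trans (_ : 2 ^+ 40 * q ^+ 5 * L <= _); last exact: pwL.
  rewrite mulrA ler_wpM2r ?(le_trans ler01) //.
  have q3 : 0 <= q ^+ 5 by rewrite exprn_ge0 // ltW.
  have q2' : 0 <= q ^+ 2 by rewrite exprn_ge0 // ltW.
  have := ler_wpM2r q3 e40; have := ler_wpM2r q2' Gq.
  by move: q3; lra.
have h6 : L <= q ^+ 2 * L.
  by rewrite ler_peMl ?(le_trans ler01) // exprn_ege1 //; move: q2; lra.
have h5 : 3 * (50 * q ^+ 2 * (81 * L)) + 10 * L <= 5 / 8 * (x / (16 * G)).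
  rewrite [leRHS]mulrA ler_pdivlMr; last by move: G0; lra.
  have := ler_wpM2l (ltW G0) h6.
  have : 0 <= G * L by apply: mulr_ge0; [exact: ltW|move: L1; lra].
  by move: h4; lra.
by move: dq2P h1 h5; lra.
Qed.

Let rho_large : ell%:R < (4 * mq)%N%:R * rho ^+ 3.
Proof.
have [h1 _] := mqP; have [_ h2] := ellP.
rewrite -(ltr_pM2r P0); apply: le_lt_trans h2 _.
have B0 : 0 < (16 * r.+1%:R * L) ^+ 3 by rewrite exprn_gt0 // !mulr_gt0 // (lt_le_trans ltr01).
have -> : (4 * mq)%N%:R * rho ^+ 3 * P = 4 * mq%:R ^+ 4 * P / (16 * r.+1%:R * L) ^+ 3.
  by rewrite natrM /rho expr_div_n mulrA mulrAC -(mulrA 4) -exprS.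
rewrite ltr_pdivlMr //; apply: level_sizes levels h1 => //.
- exact: lt_le_trans L1.
- by apply: le_trans D1; rewrite ler1n.
- by move: xbig e60; lra.
Qed.

Let L0 : 0 < L. Proof. by move: L1; lra. Qed.
Let x0 : 0 < x. Proof. by move: xbig e60; lra. Qed.
Let gL0 : 0 <= r.+1%:R * L. Proof. by rewrite mulr_ge0 // ltW. Qed.

Let regions_rich : 6 * mq%:R + 3 * r.+1%:R * L <= (k%:R - r.+1%:R) * P / 2.
Proof.
have [_ h1] := mqP; have [h2 _] := kP; rewrite nE in h2.
have h3 := ler_wpM2r (ltW P0) h2.
have h4 : r.+1%:R * P <= r.+1%:R * L by rewrite ler_wpM2l // (le_trans P1).
by move: h1 h3 h4 gL Dx x0; rewrite xE; lra.
Qed.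

Let reservoir_rich : 32 * r.+1%:R * L <= u%:R * P.
Proof.
have /andP[h1 _] := uP; have h3 := ler_wpM2r (ltW P0) h1.
by move: h3 gL x0; rewrite xE; lra.
Qed.

Let ell_mq : ell%:R * P <= mq%:R / 8.
Proof.
have [h1 _] := mqP; have [_ h2] := ellP.
have h3 : 1000 * 1000 * r.+1%:R <= x.
  by apply: le_trans gL; rewrite mulrA ler_peMr // !mulr_ge0.
have h4 := ler_wpM2r (ltW DR) h3.
by have c0 : 0 <= x * D%:R; [rewrite mulr_ge0 // ltW|move: c0 h4 h1 h2; lra].
Qed.

Let log_mq : 2 * r.+1%:R * L <= mq%:R / 8.
Proof. by have [h1 _] := mqP; move: h1 gL Dx x0 gL0; lra. Qed.

Let mq0 : (0 < mq)%N.
Proof. by have [h1 _] := mqP; rewrite -(ltr_nat R); move: h1 Dx x0; lra. Qed.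

Let dq10 : (0 < dq1)%N.
Proof.
rewrite -(ltr_nat R); apply: lt_le_trans dq1P.
by rewrite divr_gt0 ?mulr_gt0.
Qed.

Let dq20 : (0 < dq2)%N.
Proof.
rewrite -(ltr_nat R); apply: lt_le_trans dq2P.
by rewrite divr_gt0 ?mulr_gt0.
Qed.

Let absorber_room : s%:R <= p / (8 * q) * (p / (8 * q)) * xmin / 8.
Proof.
have /andP[_ h1] := sP.
have c0 : 0 <= p / (8 * q) * (p / (8 * q)) / 8.
  by rewrite divr_ge0 // mulr_ge0 // divr_ge0 ?mulr_ge0 // ltW.
have h2 := ler_wpM2l c0 xminP.
have h3 : 2 ^+ 22 * (v * p ^+ 2) / 3072 <= p / (8 * q) * (p / (8 * q)) / 8 * xmin.
  apply: le_trans h2; rewrite le_eqVlt; apply/orP; left; apply/eqP.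
  by field; rewrite gt_eqF.
have h4 : 2 ^+ 60 * q ^+ 0 * A <= v * p ^+ 2.
  by apply: le_trans vA; rewrite ler_wpM2r ?pw // ltW.
rewrite expr0 mulr1 in h4; have h5 := ler_wpM2r (ltW A0) e60.
have vp : 0 <= v * p ^+ 2 by rewrite mulr_ge0 ?exprn_ge0 // ltW.
have h6 := ler_wpM2r vp e22.
have h7 := h4; rewrite mulrAC in h3.
by move: h1 h3 h4 h5 h6 A0; lra.
Qed.

Let s_p : 6 <= s%:R * (p / (8 * q)).
Proof.
rewrite mulrA ler_pdivlMr ?mulr_gt0 //.
have : 2 ^+ 0 * q ^+ 1 <= L by apply: le_trans L_large; apply: pw.
by rewrite expr0 expr1 mul1r; move: sL L0; lra.
Qed.

Let absorber_size : 1 + 12 * (128 * q + 1) * (u%:R + s%:R) <= xmin / (256 * q).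
Proof.
have /andP[_ h1] := sP; have /andP[_ h2] := uP.
rewrite ler_pdivlMr ?mulr_gt0 //; apply: le_trans xminP.
have h3 : 1000 * A <= v.
  apply: le_trans (_ : 2 ^+ 20 * q ^+ 0 * A <= _); last exact: pwA.
  by rewrite expr0 mulr1 ler_wpM2r // ltW.
have h4 : u%:R + s%:R <= 11 / 10 * v by move: h1 h2 h3 v0; lra.
have c0 : 0 <= 12 * (128 * q + 1) by move: q2; lra.
have h5 := ler_wpM2l c0 h4.
have h6 : 1 + 12 * (128 * q + 1) * (u%:R + s%:R) <= 1 + 12 * (257 / 2 * q) * (11 / 10 * v).
  rewrite lerD2l; apply: le_trans h5 _; rewrite ler_wpM2r //; last by move: q2; lra.
  by move: v0; lra.
have h7 : 1 <= q * v.
  apply: (@le_trans _ _ (1 * 1)); first by rewrite mulr1.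
  by rewrite ler_pM //; move: q2 vbig e20; lra.
have h8 : 1 + 12 * (128 * q + 1) * (u%:R + s%:R) <= 1700 * (q * v) by move: h6 h7; lra.
have h9 := ler_wpM2r (_ : 0 <= 256 * q) h8; have q0 := ltW q_pos.
apply: le_trans (h9 _) _; first by rewrite mulr_ge0.
have h10 := ler_wpM2r (_ : 0 <= q ^+ 2 * v) e22.
have qv : 0 <= q ^+ 2 * v by rewrite mulr_ge0 ?exprn_ge0 // ltW.
by have := h10 qv; lra.
Qed.

Let u_large : (20 * r * (20 * r ^ 2 + r + 2 * s) <= u)%N.
Proof.
rewrite -(ler_nat R) natrM natrM natrD natrD natrM natrX natrM.
have /andP[_ h1] := sP; have /andP[h2 _] := uP.
have h3 : 1000 * 1000 * (q ^+ 3 * A) <= v.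
  apply: le_trans (_ : 2 ^+ 40 * q ^+ 3 * A <= _); last exact: pwA.
  have c0 : 0 <= q ^+ 3 * A by rewrite mulr_ge0 ?exprn_ge0 // ltW.
  by have := ler_wpM2r c0 e40; move: c0; lra.
have A1 := le_trans L1 AL.
have q1 : 1 <= q by move: q2; lra.
have h4 : q <= q ^+ 2 * A.
  by rewrite expr2 -mulrA ler_peMr ?(ltW q_pos) // mulr_ege1.
have h5 : q ^+ 2 <= q ^+ 2 * A by rewrite ler_peMr ?exprn_ge0 // ltW.
have h6 : A <= q ^+ 2 * A by rewrite ler_peMl ?(ltW A0) // exprn_ege1.
have h7 : 20 * q ^+ 2 + q + 2 * s%:R <= 200 * (q ^+ 2 * A) by move: h1 h4 h5 h6; lra.
have c0 : 0 <= 20 * q by rewrite mulr_ge0.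
apply: le_trans (ler_wpM2l c0 h7) _.
by move: h3 h2 v0; lra.
Qed.

Let n1_large : (864 * r * s <= n1)%N.
Proof.
have /andP[_ h1] := sP.
rewrite -(ler_nat R) !natrM -(ler_pM2l q_pos); apply: le_trans n1P.
have c0 : 0 <= q ^+ 2 * A by rewrite mulr_ge0 ?exprn_ge0 // ltW.
have h3 : 1000 * 1000 * 1000 * (q ^+ 2 * A) <= v.
  apply: le_trans (_ : 2 ^+ 40 * q ^+ 2 * A <= _); last exact: pwA.
  by have := ler_wpM2r c0 e40; move: c0; lra.
have q0 : 0 <= q ^+ 2 by rewrite exprn_ge0.
by have := ler_wpM2l q0 h1; move: h3; lra.
Qed.

Let n1_p : s%:R <= p / (8 * q) * n1%:R.
Proof.
have /andP[_ h1] := sP.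
rewrite mulrAC ler_pdivlMr ?mulr_gt0 // -(ler_pM2l q_pos).
have h2 := ler_wpM2l (ltW p0) n1P.
have c0 : 0 <= q ^+ 2 * A by rewrite mulr_ge0 ?exprn_ge0 // ltW.
have h3 : 1000 * 1000 * (q ^+ 2 * A) <= v * p.
  apply: le_trans (_ : 2 ^+ 60 * q ^+ 6 * A <= _).
    apply: le_trans (_ : 2 ^+ 40 * q ^+ 2 * A <= _); last by rewrite ler_wpM2r ?pw // ltW.
    by have := ler_wpM2r c0 e40; move: c0; lra.
  by apply: le_trans vA _; rewrite expr2 mulrA ger_pMr // mulr_gt0.
have q0 : 0 <= q ^+ 2 by rewrite exprn_ge0.
by have := ler_wpM2l q0 h1; move: h2 h3; lra.
Qed.

Let cover_n : (n <= 2 ^ bb * n1)%N.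
Proof.
rewrite -(ler_nat R) natrM natrX nE.
have h1 := ler_wpM2r (ler0n R n1) bb_large.
by have := ler_wpM2r (ltW DR) n1P; move: h1; lra.
Qed.

Theorem likely_cover_large :
  likely p 11 (fun G => forall c : {set T} -> 'I_r,
    cpart (ecol G c) setT (5 * indep_bound r b r + 36 * r * bb + r * (20 * r + 1) + 1)).
Proof.
have [h1 _] := kP; have [_ h2] := muP; have [h3 _] := ellP.
have k0 : (0 < k)%N.
  rewrite -(ltr_nat R); apply: lt_le_trans h1; rewrite divr_gt0 //.
  by rewrite ltr0n.
apply: (@likely_cover R T r p L xmin rho k s u mq mu dq1 dq2 ell n1 b bb) => //.
- by rewrite mulnC leq_trunc_div.
- by rewrite -PE; exact: regions_rich.
- by rewrite -PE.
- by rewrite -PE.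
- by rewrite -PE; exact: reservoir_rich.
- by rewrite -PE; exact: ell_mq.
- by rewrite mulnC leq_trunc_div.
- have E (a d : nat) : (a * (4 * d) = d * (4 * a))%N by rewrite mulnCA [RHS]mulnCA (mulnC a).
  by rewrite E leq_trunc_div.
- rewrite /xmin le_eqVlt; apply/orP; left; apply/eqP.
  have -> : (128 * q) ^+ r = (128 * q) ^+ r.-1 * (128 * q) by rewrite -exprSr (ltn_predK r2).
  have E0 : (128 * q) ^+ r.-1 != 0 by rewrite expf_neq0 // mulf_neq0 // gt_eqF.
  by rewrite mulrA divfK // mulrC.
- by rewrite mulnC leq_trunc_div.
Qed.

End Sizes.

(** With [y = n^(1/(2r))] the conditions on [n] and [p] concern monomials [y^j p^i]. If [i < j],
    such a monomial is at least [y], as [p y >= 1], and beats every power of [log n]. Only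
    [n p^(2r)] has equal exponents, and there the constant counts. *)
Lemma likely_cover_large_n (R : realType) (r D bb b : nat) : (2 <= r)%N -> (0 < D)%N ->
  D%:R = 2 ^+ 22 * r%:R ^+ 2 * (128 * r%:R) ^+ r.-1 :> R ->
  2 ^+ 18 * r%:R ^+ 4 * D%:R <= (2 ^+ 9 * r%:R ^+ 5) ^+ (2 * r) :> R ->
  25 * r%:R * D%:R <= 2 ^+ bb :> R ->
  (forall i, (0 < i)%N -> (i <= r)%N -> (2 * shrink r (i * r) <= 2 ^ b)%N) ->
  exists N : nat, forall (T : finType) (p : R), (N <= #|T|)%N ->
    2 ^+ 9 * r%:R ^+ 5 * (#|T|%:R `^ (- (2 * r%:R)^-1)) <= p -> p <= 1 ->
    likely p 11 (fun G => forall c : {set T} -> 'I_r, 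
      cpart (ecol G c) setT (5 * indep_bound r b r + 36 * r * bb + r * (20 * r + 1) + 1)).
Proof.
move=> r2 D0; set q := r%:R : R; set Dr := D%:R : R => DE dens bbP bP.
have q2 : 2 <= q by rewrite ler_nat.
have D1 : 1 <= Dr by rewrite ler1n.
have q0 : 0 < q by move: q2; lra.
pose K : R := 2 ^+ 60 * q ^+ 6 * Dr ^+ 4.
have K1 : 1 <= K.
  apply: mulr_ege1; last exact: exprn_ege1.
  by apply: mulr_ege1; apply: exprn_ege1; move: q2; lra.
pose M := K * (8 * q) ^+ 4.
have M1 : K <= M by rewrite ler_peMr ?(le_trans ler01) // exprn_ege1 //; move: q2; lra.
exists (Num.truncn (expR M)).+1 => T p nN hp p1.
have nR : expR M < #|T|%:R.
  by apply: lt_le_trans (_ : (Num.truncn (expR M)).+1%:R <= _);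
    [have /andP[] := truncn_itv (expR_ge0 M)|rewrite ler_nat].
have n0 : (0 < #|T|)%N by apply: leq_trans nN.
pose L := ln (#|T|%:R : R).
have nL : expR L = #|T|%:R by rewrite lnK // posrE ltr0n.
have ML : M <= L by rewrite -ler_expR nL ltW.
have L1 : 1 <= L by apply: le_trans ML; apply: le_trans M1.
have L0 : 0 < L by move: L1; lra.
pose y := expR (L / (2 * q)).
have y0 : 0 < y by apply: expR_gt0.
have ny : #|T|%:R = y ^+ (2 * r).
  rewrite -nL -expRM_natl natrM mulrC divfK // mulf_neq0 // gt_eqF //.
have y1 : 1 <= y by rewrite -expR0 ler_expR divr_ge0 ?mulr_ge0 // ltW.
have yL : K * L ^+ 3 <= y.
  (* The fourth power of [z <= exp z] at [z = L / (8 q)]; it gains one factor [L] over the power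
     [L^3] that is needed. *)
  have h : (L / (8 * q)) ^+ 4 <= y.
    have -> : y = expR (L / (8 * q)) ^+ 4.
      by rewrite -expRM_natl; congr expR; field; rewrite gt_eqF.
    apply: lerXn2r; rewrite ?nnegrE ?expR_ge0 ?divr_ge0 ?mulr_ge0 ?(ltW L0) ?(ltW q0) //.
    by apply: le_trans (expR_ge1Dx _); rewrite lerDr.
  apply: le_trans h; rewrite expr_div_n ler_pdivlMr ?exprn_gt0 ?mulr_gt0 //.
  by rewrite mulrAC [L ^+ 4]exprS ler_wpM2r // exprn_ge0 // ltW.
have py : 2 ^+ 9 * q ^+ 5 <= p * y.
  rewrite -ler_pdivrMr //; apply: le_trans hp; rewrite -/q /powR gt_eqF ?ltr0n //.
  by rewrite -/L -expRN mulNr [_^-1 * L]mulrC.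
have py1 : 1 <= p * y.
  by apply: le_trans py; rewrite mulr_ege1 ?exprn_ege1 //; move: q2; lra.
have p0 : 0 < p by rewrite -(pmulr_lgt0 _ y0) (lt_le_trans ltr01).
have ypE i j : (i <= j)%N -> y ^+ j * p ^+ i = y ^+ (j - i) * (p * y) ^+ i.
  by move=> ij; rewrite -{1}(subnK ij) exprD exprMn; ring.
have yp i j : (i < j)%N -> y <= y ^+ j * p ^+ i.
  move=> ij; rewrite ypE 1?ltnW // -[leLHS]mulr1; apply: ler_pM => //; rewrite ?(ltW y0) //.
    by rewrite -[leLHS]expr1 ler_weXn2l // subn_gt0.
  by rewrite exprn_ege1.
have Dr0 : 0 < Dr by move: D1; lra.
pose v := #|T|%:R / Dr.
have vE i : v * p ^+ i = y ^+ (2 * r) * p ^+ i / Dr by rewrite /v ny mulrAC.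
have large : 2 ^+ 60 * q ^+ 6 * L <= y / Dr.
  rewrite ler_pdivlMr //; apply: le_trans yL; rewrite /K.
  have -> : 2 ^+ 60 * q ^+ 6 * L * Dr = 2 ^+ 60 * q ^+ 6 * (Dr * L) by ring.
  rewrite -[leRHS]mulrA; apply: ler_wpM2l; first by rewrite mulr_ge0 ?exprn_ge0 ?(ltW q0).
  apply: ler_pM; rewrite ?(ltW Dr0) ?(ltW L0) //.
    by rewrite exprS ler_peMr ?(ltW Dr0) // exprn_ege1.
  by rewrite exprS ler_peMr ?(ltW L0) // exprn_ege1.
apply: (@likely_cover_large R T r D bb b p L v (L / p) (p ^+ r.+1)
  (v * p ^+ r.+1)) => //.
- by rewrite divfK // gt_eqF.
- by rewrite divfK // gt_eqF.
- apply: le_trans ML; apply: le_trans M1.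
  by rewrite ler_peMr ?exprn_ege1 // mulr_ge0 ?exprn_ge0 // ltW.
- apply: le_trans large _; rewrite vE ler_wpM2r ?invr_ge0 ?(ltW Dr0) //.
  by apply: yp; move: r2; clear; lia.
- apply: le_trans large _; rewrite vE ler_wpM2r ?invr_ge0 ?(ltW Dr0) //.
  by apply: yp; move: r2; clear; lia.
- rewrite vE ler_pdivlMr // ypE // subnn mul1r.
  apply: le_trans dens _; apply: lerXn2r py; rewrite nnegrE; last exact: le_trans py1.
  by rewrite mulr_ge0 // exprn_ge0 // ltW.
- have -> : (v * p ^+ r.+1) ^+ 4 * p ^+ r.+1 = y ^+ (8 * r) * p ^+ (5 * r.+1) / Dr ^+ 4.
    have E (a P : R) : (a / Dr * P) ^+ 4 * P = a ^+ 4 * P ^+ 5 / Dr ^+ 4.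
      by field; rewrite gt_eqF.
    rewrite /v ny E -!exprM; congr (_ ^+ _ * _ ^+ _ / _); clear; lia.
  rewrite ler_pdivlMr ?exprn_gt0 //.
  (* The exponents satisfy [5 (r + 1) < 8 r], true from [r = 2] on; with three levels instead of
     four this would fail for [r = 2]. *)
  apply: le_trans (_ : y <= _); last by apply: yp; move: r2; clear; lia.
  apply: le_trans yL; rewrite /K.
  have -> : 2 ^+ 60 * q ^+ 4 * L ^+ 3 * Dr ^+ 4 = 2 ^+ 60 * q ^+ 4 * Dr ^+ 4 * L ^+ 3 by ring.
  rewrite ler_wpM2r ?exprn_ge0 ?(ltW L0) // ler_wpM2r ?exprn_ge0 ?(ltW Dr0) //.
  by rewrite ler_wpM2l ?exprn_ge0 // ler_weXn2l //; move: q2; lra.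
Qed.

From mathcomp Require Import all_classical all_reals all_analysis.
Import numFieldNormedType.Exports.
Local Open Scope classical_set_scope.

(** The upper bound 1 is included so that the limit follows by squeezing. *)
Lemma likely_gnp (R : realType) (n j : nat) (p : R) (P : {set {set 'I_n}} -> Prop) :
  0 <= p -> p <= 1 -> likely p j P ->
  1 - j%:R * (2 * expR 1 * expR 1 / n%:R) <= gnp_prob p P <= 1.
Proof.
move=> p0 p1 [bad [hbad hP]].
have -> : gnp_prob p P = prob (two_sets 'I_n) p (fun G => `[< P G >]) by [].
apply/andP; split; last first.
  by rewrite -(prob_total (two_sets 'I_n) p); apply: prob_le.
have := prob_compl (two_sets 'I_n) p (fun G => `[< P G >]).
rewrite lerBlDr -lerBlDl => <-; rewrite card_ord in hbad; apply: le_trans hbad.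
apply: prob_le => // G GD /negP nP; apply/negPn/negP=> nb; apply: nP.
by apply/asboolP; apply: hP.
Qed.

Theorem theorem1p1 (R : realType) (r : nat) (p : nat -> R) :
  (2 <= r)%N ->
  (exists N : nat, forall n : nat, (N <= n)%N ->
      2 ^+ 9 * (r%:R) ^+ 5 * (n%:R `^ (- (2 * r%:R)^-1)) <= p n /\ p n <= 1) ->
  @gnp_prob R n (p n)
     (@cycle_partition_property R n r (1000 * (r%:R) ^+ 4 * ln (r%:R : R)))
    @[n --> \oo] --> (1 : R).
Proof.
move=> r2 [N1 pN].
have DE : (reservoir_ratio r)%:R = 2 ^+ 22 * r%:R ^+ 2 * (128 * r%:R) ^+ r.-1 :> R.
  by rewrite /reservoir_ratio natrM natrM natrX natrX natrX natrM.
have dens : 2 ^+ 18 * r%:R ^+ 4 * (reservoir_ratio r)%:R <=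
    (2 ^+ 9 * r%:R ^+ 5) ^+ (2 * r) :> R.
  have := density_constant r2; rewrite -(ler_nat R).
  by rewrite natrM natrM natrX natrX natrX natrM natrX natrX.
have greedy : 25 * r%:R * (reservoir_ratio r)%:R <= 2 ^+ greedy_log r :> R.
  by have := greedy_log_large r2; rewrite -(ler_nat R) natrM natrM natrX.
have [N2 hN2] := likely_cover_large_n r2 (reservoir_ratio_gt0 r2) DE dens greedy
  (shrink_log_large r2).
pose K : R := 11%:R * (2 * expR 1 * expR 1).
have bounds n : (N1 <= n)%N -> (N2 <= n)%N ->
    1 - K / n%:R <= gnp_prob (p n)
      (@cycle_partition_property R n r (1000 * (r%:R) ^+ 4 * ln (r%:R : R))) <= 1.
  move=> n1 n2; have [pl p1] := pN n n1.
  have p0 : 0 <= p n.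
    by apply: le_trans pl; rewrite !mulr_ge0 ?exprn_ge0 ?powR_ge0.
  rewrite /K -mulrA; apply: likely_gnp => //.
  have := hN2 'I_n (p n); rewrite card_ord => /(_ n2 pl p1).
  apply: likely_sub => G hG c; have [ss [sz mono pss]] := hG c.
  exists ss; split=> //; last by rewrite enum_setT -enumT in pss.
  apply: le_trans (cover_number_le r2 R); rewrite ler_nat; exact: sz.
apply/cvgrPdist_le => e e0.
near=> n.
have n1 : (N1 <= n)%N by near: n; exists N1.
have n2 : (N2 <= n)%N by near: n; exists N2.
have nK : K / e < n%:R by near: n; exact: nbhs_infty_gtr.
have K0 : 0 < K by rewrite !mulr_gt0 ?expR_gt0 // ltr0n.
have n0 : 0 < n%:R :> R by apply: lt_trans nK; rewrite divr_gt0.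
have /andP[b1 b2] := bounds n n1 n2.
rewrite ger0_norm ?subr_ge0 // lerBlDr -lerBlDl; apply: le_trans b1.
rewrite lerD2l lerN2 ler_pdivrMr // mulrC -ler_pdivrMr //; exact: ltW.
Unshelve. all: by end_near.
Qed.
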